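(* Any smoothing operator $R\in \Psi^{-\infty}(\mathbb{R}^n)$ can be written in the form $$R=[x_{1}, P_{1}]+\ldots+ [x_{n}, P_{n}],$$ with $P_{1}, \ldots, P_{n}$ in $\Psi^{-n+1}(\mathbb{R}^n)$.
   Context: $\Psi^{-\infty}(\mathbb{R}^n)$ is the space of operators $C_c^\infty(\mathbb{R}^n)\to C^\infty(\mathbb{R}^n)$ with smooth Schwartz kernel (no support or decay condition). $\Psi^m(\mathbb{R}^n)$ is the space of classical pseudodifferential operators of order $m$, that is, operators $C_c^\infty(\mathbb{R}^n)\to C^\infty(\mathbb{R}^n)$ of the form $p(x,D)+R'$ with $R'$ smoothing and $p(x,\xi)\sim\sum_{j\ge0}p_{m-j}(x,\xi)$, where $p_{m-j}$ is smooth for $\xi\neq 0$ and positively homogeneous of degree $m-j$ in $\xi$, the asymptotic expansion holding with symbol estimates for $|\xi|\ge 1$ locally uniformly in $x$. Here $x_j$ denotes the operator of multiplication by the $j$-th coordinate function. *)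

(* Defs.v *)
(* Mathematical Components and MathComp-Analysis, over an arbitrary realType. *)
From HB Require Import structures.
From mathcomp Require Import all_boot all_order all_algebra.
From mathcomp Require Import all_classical all_reals all_analysis.
From mathcomp Require Export complex.

Set Implicit Arguments.
Unset Strict Implicit.
Unset Printing Implicit Defensive.

Import Order.TTheory GRing.Theory Num.Theory.
Import numFieldNormedType.Exports.

Local Open Scope classical_set_scope.
Local Open Scope complex_scope.
Local Open Scope ring_scope.

(* Lebesgue measure on R^n, built on the product sigma-algebra of n-tuples by
   transporting the product measure along (t, s) |-> t :: s. *)
Section lebesgue_cons.
Context (R : realType) (n : nat).
Local Notation tpl k := (k.-tuple (measurableTypeR R)).
Variable m : {sigma_finite_measure set (tpl n) -> \bar R}.
Local Notation prodm := ((@lebesgue_measure R) \x m)%E.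

Definition cons_pair (z : measurableTypeR R * tpl n) : tpl n.+1 :=
  [tuple of z.1 :: z.2].

Lemma measurable_cons_pair : measurable_fun setT cons_pair.
Proof. by apply: measurable_cons. Qed.

Definition lebesgue_cons : set (tpl n.+1) -> \bar R :=
  pushforward prodm cons_pair.

Let lebesgue_cons_measure : {measure set (tpl n.+1) -> \bar R} :=
  measure_function_pushforward__canonical__measure_function_Measure prodm
    measurable_cons_pair.

HB.instance Definition _ := isMeasure.Build _ _ _ lebesgue_cons
  (measure0 lebesgue_cons_measure) (measure_ge0 lebesgue_cons_measure)
  (@measure_semi_sigma_additive _ _ _ lebesgue_cons_measure).

Let lebesgue_cons_sigma_finite : sigma_finite setT lebesgue_cons.
Proof.
have /sigma_finiteP[F [FT ndF Foo]] := sigma_finiteT (@lebesgue_measure R).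
have /sigma_finiteP[G [GT ndG Goo]] := sigma_finiteT m.
pose g (t : tpl n.+1) : measurableTypeR R * tpl n :=
  (tnth t ord0, [tuple of behead t]).
have mg : measurable_fun setT g.
  apply/measurable_fun_pairP; split.
    exact: measurable_tnth.
  exact: measurable_behead.
have gK z : g (cons_pair z) = z.
  case: z => t s; rewrite /g /cons_pair /=; congr pair.
  exact/val_inj.
have FGT : setT = \bigcup_k (F k `*` G k).
  rewrite -setXTT FT GT predeqE => -[x y]; split.
    move=> [/= [i _ Fix] [k _ Gky]]; exists (maxn i k) => //; split.
    - by move: x Fix; exact/subsetPset/ndF/leq_maxl.
    - by move: y Gky; exact/subsetPset/ndG/leq_maxr.
  by move=> [i _ []/= ? ?]; split; exists i.
exists (fun k => g @^-1` (F k `*` G k)).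
  by rewrite -preimage_bigcup -FGT preimage_setT.
move=> k; have [mF Fk] := Foo k; have [mG Gk] := Goo k; split.
  by rewrite -[X in measurable X]setTI; apply: mg => //; exact: measurableX.
rewrite /lebesgue_cons /pushforward -comp_preimage.
rewrite (_ : g \o cons_pair = id); last by apply/funext => z /=; exact: gK.
by rewrite preimage_id product_measure1E// lte_mul_pinfty// ge0_fin_numE.
Qed.

HB.instance Definition _ := Measure_isSigmaFinite.Build _ _ _ lebesgue_cons
  lebesgue_cons_sigma_finite.

End lebesgue_cons.

Fixpoint lebesgue_tuple (R : realType) (n : nat) :
    {sigma_finite_measure set (n.-tuple (measurableTypeR R)) -> \bar R} :=
  match n with
  | 0 => \d_([tuple] : 0.-tuple (measurableTypeR R))
  | k.+1 => lebesgue_cons (lebesgue_tuple R k)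
  end.

Definition int_rV (R : realType) (n : nat) (f : 'rV[R]_n -> R) : R :=
  Rintegral (lebesgue_tuple R n) setT (fun t => f (\row_i tnth t i)).

Definition cint_rV (R : realType) (n : nat) (f : 'rV[R]_n -> R[i]) : R[i] :=
  int_rV (fun x => complex.Re (f x)) +i* int_rV (fun x => complex.Im (f x)).

(* [:: v1; ...; vk] |-> the iterated directional derivative D_v1 ... D_vk f. *)
Fixpoint iter_derive (R : realType) (V : normedModType R) (vs : seq V)
    (f : V -> R) : V -> R :=
  if vs is v :: vs' then 'D_v (iter_derive vs' f) else f.

Definition iter_cderive (R : realType) (V : normedModType R) (vs : seq V)
    (f : V -> R[i]) (x : V) : R[i] :=
  iter_derive vs (fun y => complex.Re (f y)) x +i*
  iter_derive vs (fun y => complex.Im (f y)) x.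

(* C^infty on an open set D of a finite-dimensional space V: every iterated
   derivative is Frechet differentiable (in particular continuous, with all
   its directional derivatives) at every point of D. *)
Definition rsmooth_on (R : realType) (V : normedModType R) (D : set V)
    (f : V -> R) : Prop :=
  forall (vs : seq V) (x : V), D x -> differentiable (iter_derive vs f) x.

Definition smooth_on (R : realType) (V : normedModType R) (D : set V)
    (f : V -> R[i]) : Prop :=
  rsmooth_on D (fun x => complex.Re (f x)) /\
  rsmooth_on D (fun x => complex.Im (f x)).

Definition smooth (R : realType) (V : normedModType R) (f : V -> R[i]) : Prop :=
  smooth_on setT f.

Definition test_fun (R : realType) (n : nat) (u : 'rV[R]_n -> R[i]) : Prop :=
  smooth u /\ compact (closure [set x | u x != 0]).

Definition dot (R : realType) (n : nat) (x y : 'rV[R]_n) : R :=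
  \sum_(i < n) x 0 i * y 0 i.

(* The norm of the library on 'rV[R]_n is the sup norm. *)
Definition enorm (R : realType) (n : nat) (x : 'rV[R]_n) : R :=
  Num.sqrt (dot x x).

Definition expi (R : realType) (t : R) : R[i] := cos t +i* sin t.

Definition fourier (R : realType) (n : nat) (u : 'rV[R]_n -> R[i])
    (xi : 'rV[R]_n) : R[i] :=
  cint_rV (fun y => expi (- dot y xi) * u y).

(* Operators from test functions to smooth functions are represented by maps
   on all functions, whose values off test functions are irrelevant: two such
   operators are identified when they agree on test functions. *)
Definition op (R : realType) (n : nat) : Type :=
  ('rV[R]_n -> R[i]) -> ('rV[R]_n -> R[i]).

Definition op_eq (R : realType) (n : nat) (A B : op R n) : Prop :=
  forall u, test_fun u -> forall x, A u x = B u x.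

Definition maps_test_to_smooth (R : realType) (n : nat) (A : op R n) : Prop :=
  forall u, test_fun u -> smooth (A u).

Definition op_add (R : realType) (n : nat) (A B : op R n) : op R n :=
  fun u x => A u x + B u x.

Definition kernel_op (R : realType) (n : nat)
    (k : 'rV[R]_n * 'rV[R]_n -> R[i]) : op R n :=
  fun u x => cint_rV (fun y => k (x, y) * u y).

Definition smoothing (R : realType) (n : nat) (A : op R n) : Prop :=
  maps_test_to_smooth A /\
  exists k : 'rV[R]_n * 'rV[R]_n -> R[i], smooth k /\ op_eq A (kernel_op k).

(* p(x, D) *)
Definition quantization (R : realType) (n : nat)
    (p : 'rV[R]_n * 'rV[R]_n -> R[i]) : op R n :=
  fun u x => ((2 * pi) ^- n)%:C *
    cint_rV (fun xi => expi (dot x xi) * p (x, xi) * fourier u xi).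

(* The mixed derivative d_x^a d_xi^b; a multi-index is given by the sequence of
   the coordinates to be differentiated, so that |b| = size b. *)
Definition symbol_derive (R : realType) (n : nat) (a b : seq 'I_n)
    (p : 'rV[R]_n * 'rV[R]_n -> R[i]) : 'rV[R]_n * 'rV[R]_n -> R[i] :=
  iter_cderive ([seq (delta_mx 0 i, 0) | i <- a] ++
                [seq (0, delta_mx 0 j) | j <- b]) p.

Definition homogeneous (R : realType) (n : nat) (d : int)
    (q : 'rV[R]_n * 'rV[R]_n -> R[i]) : Prop :=
  forall (x xi : 'rV[R]_n) (t : R), xi != 0 -> 0 < t ->
    q (x, t *: xi) = (t ^ d)%:C * q (x, xi).

(* The terms ph j have degree m - j in xi. *)
Definition asymptotic (R : realType) (n : nat) (m : int)
    (p : 'rV[R]_n * 'rV[R]_n -> R[i])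
    (ph : nat -> 'rV[R]_n * 'rV[R]_n -> R[i]) : Prop :=
  forall (N : nat) (a b : seq 'I_n) (K : set 'rV[R]_n), compact K ->
    exists C : R, forall x xi : 'rV[R]_n, K x -> 1 <= enorm xi ->
      `|symbol_derive a b (fun z => p z - \sum_(j < N) ph j z) (x, xi)|
        <= (C * enorm xi ^ (m - N%:Z - (size b)%:Z))%:C.

Definition classical_symbol (R : realType) (n : nat) (m : int)
    (p : 'rV[R]_n * 'rV[R]_n -> R[i]) : Prop :=
  smooth p /\
  exists ph : nat -> 'rV[R]_n * 'rV[R]_n -> R[i],
    [/\ forall j, smooth_on [set z | z.2 != 0] (ph j),
        forall j : nat, homogeneous (m - j%:Z) (ph j) &
        asymptotic m p ph].

Definition classical_psido (R : realType) (n : nat) (m : int) (A : op R n) :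
    Prop :=
  maps_test_to_smooth A /\
  exists (p : 'rV[R]_n * 'rV[R]_n -> R[i]) (S : op R n),
    [/\ classical_symbol m p, smoothing S &
        op_eq A (op_add (quantization p) S)].

Definition mul_coord (R : realType) (n : nat) (j : 'I_n) : op R n :=
  fun u x => (x 0 j)%:C * u x.

Definition commutator (R : realType) (n : nat) (A B : op R n) : op R n :=
  fun u x => A (B u) x - B (A u) x.

(* Main.v *)
From HB Require Import structures.
Require Import Defs.
From mathcomp Require Import all_boot all_order all_algebra.
From mathcomp Require Import all_classical all_reals all_analysis.
From mathcomp Require Import measurable_realfun.
From mathcomp Require Import ring lra.
Import Order.TTheory GRing.Theory Num.Theory.
Import numFieldNormedType.Exports.
(** A smoothing operator whose kernel vanishes on the diagonal is a sum of
    commutators of coordinates with smoothing operators: by Taylor's formula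
    (hadamard) such a kernel is a sum of terms (x_j - y_j) h_j(x, y) with h_j
    smooth, and (x_j - y_j) h_j is the kernel of [x_j, H_j] when H_j has kernel
    h_j (commutator_kernel_op). The values k(x, x) of a general kernel k on the
    diagonal are the only obstruction, and they require operators that are not
    smoothing.

    These come from the field xi / |xi|^n. It is homogeneous of degree 1 - n and
    divergence free for xi <> 0, while its flux through spheres around the
    origin is a positive constant. After multiplication by a radial cut-off that
    vanishes near the origin and equals 1 for |xi| >= 1/2, its components rho_j
    are smooth functions, and each is equal to a homogeneous function outside a
    ball, so that a(x) rho_j(xi) is a classical symbol of order 1 - n with a
    single term in its expansion (classical_symbol_psym). The divergence of rho
    is now smooth, nonnegative, supported in a ball, with integral I0 > 0
    (divrhoE, integral_divrho_gt0).

    On the Fourier side, the commutator with x_j differentiates a symbol in xi_j: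
    [x_j, p(x, D)] has symbol i dp/dxi_j. For p_j = - i a(x) rho_j the symbols of
    the commutators add up to a(x) div rho, so that the sum of the commutators is
    the operator with kernel (2 pi)^-n a(x) psi(x - y), where psi, the integral
    of exp(i x.xi) div rho(xi), is smooth and psi(0) = I0
    (commutator_quantization). For a(x) = (2 pi)^n k(x, x) / I0 this kernel
    agrees with k on the diagonal, and the difference is of the first kind.

    The analysis behind this is elementary. Integrals of smooth families are
    differentiated by means of Taylor's formula of order 2 with dominated second
    derivatives (rsmooth_Rintegral); the Lebesgue integral on R^n is handled by
    iterated integration, with the integrable weight prod_i (1 + x_i^2)^-1 as a
    universal bound; the Fourier transform of a test function decreases rapidly
    because (1 + xi_j^2) times it is the transform of another test function
    (rapid_ctrans); and the commutator formula is an integration by parts in xi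
    (integral_derive_eq0, commutator_multiplier) followed by an exchange of
    integrals (inv_fourier_mul). *)
Set Implicit Arguments.
Unset Strict Implicit.
Unset Printing Implicit Defensive.
Local Open Scope classical_set_scope.
Local Open Scope complex_scope.
Local Open Scope ring_scope.

(** * Smooth functions *)

Section smooth_calculus.
Context {R : realType}.
Implicit Types V W : normedModType R.

Lemma iter_derive_rcons V (vs : seq V) v (f : V -> R) :
  iter_derive (rcons vs v) f = iter_derive vs ('D_v f).
Proof. by elim: vs => //= w vs ->. Qed.

Lemma rsmooth_onP V (D : set V) (f : V -> R) :
  rsmooth_on D f <-> (forall x, D x -> differentiable f x) /\
                     (forall v, rsmooth_on D ('D_v f)).
Proof.
split=> [sf|[df sf] vs].
  split=> [x Dx|v vs x Dx]; first exact: (sf [::]).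
  by rewrite -iter_derive_rcons; exact: sf.
case/lastP: vs => [//|vs v] x Dx.
by rewrite iter_derive_rcons; exact: sf.
Qed.

(** Smoothness of finite order: closure properties of smooth functions are proved
    by induction on k, which the lists of directions in rsmooth_on do not allow
    directly, since a product or a composition does not derive into one term. *)
Fixpoint Cn V (k : nat) (D : set V) (f : V -> R) : Prop :=
  (forall x, D x -> differentiable f x) /\
  (if k is k'.+1 then forall v, Cn k' D ('D_v f) else True).

Lemma Cn_differentiable V k (D : set V) f x : D x -> Cn k D f ->
  differentiable f x.
Proof. by case: k => [|k] Dx [+ _]; apply. Qed.

Lemma CnW V k (D : set V) f : Cn k.+1 D f -> Cn k D f.
Proof.
elim: k f => [|k IH] f [df Df]; first by split.
by split=> // v; apply: IH.
Qed.

Lemma CnD V k (D : set V) f v : Cn k.+1 D f -> Cn k D ('D_v f).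
Proof. by case=> _; apply. Qed.

Lemma rsmooth_Cn V (D : set V) f : rsmooth_on D f <-> forall k, Cn k D f.
Proof.
split=> [+ k|].
  elim: k f => [|k IH] f /rsmooth_onP[df sf]; split=> // v; exact/IH/sf.
move=> Cf vs; elim/last_ind: vs f Cf => [|vs v IH] f Cf x Dx.
  exact: (Cn_differentiable Dx (Cf 0)).
rewrite iter_derive_rcons; apply: IH => // k.
by have [_] := Cf k.+1; apply.
Qed.

(** A candidate for the differential is often at hand together with a bound on
    the remainder; this form turns the bound into differentiability. *)
Lemma derive_eps V (f : V -> R) (x : V) (L : {linear V -> R}) :
  continuous L ->
  (forall e : R, 0 < e -> exists2 d : R, 0 < d &
      forall h, `|h| < d -> `|f (h + x) - f x - L h| <= e * `|h|) ->
  differentiable f x /\ forall v, 'D_v f x = L v.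
Proof.
move=> cL dL.
have fL : f \o shift x = cst (f x) + L +o_ 0 id.
  apply/eqaddoP => e e0; have [d d0 dP] := dL e e0.
  rewrite -nbhs_nearE; apply/nbhs_ballP; exists d => // h.
  rewrite -ball_normE /= sub0r normrN => /dP.
  by rewrite !fctE opprD addrA.
have dE := diff_unique cL fL.
have df : differentiable f x by apply/diff_locallyP; rewrite dE; split.
by split=> // v; rewrite deriveE// dE.
Qed.

Lemma differentiable_epsP V (f : V -> R) (x : V) : differentiable f x <->
  exists2 L : {linear V -> R}, continuous L &
    forall e : R, 0 < e -> exists2 d : R, 0 < d &
      forall h, `|h| < d -> `|f (h + x) - f x - L h| <= e * `|h|.
Proof.
split=> [/diff_locallyP[cL dL]|[L cL dL]]; last by case: (derive_eps cL dL).
exists ('d f x) => // e e0.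
have /eqaddoP/(_ e e0) := dL.
rewrite -nbhs_nearE => /nbhs_ballP[d /= d0 dP]; exists d => // h hd.
have /dP /= : ball (0 : V) d h by rewrite -ball_normE /= sub0r normrN.
by rewrite !fctE opprD addrA.
Qed.

Section open_domain.
Context {V : normedModType R}.
Variable D : set V.
Hypothesis oD : open D.

Lemma eq_on_derive (f g : V -> R) v : {in D, f =1 g} ->
  {in D, 'D_v f =1 'D_v g}.
Proof.
move=> fg x xD; apply: near_eq_derive.
have Dx : nbhs x D by apply: open_nbhs_nbhs; split => //; exact/set_mem.
by apply: filterS Dx => y Dy; apply: fg; exact/mem_set.
Qed.

Lemma eq_on_differentiable (f g : V -> R) x : {in D, f =1 g} -> D x ->
  differentiable f x -> differentiable g x.
Proof.
move=> fg Dx /differentiable_epsP[L cL LP].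
apply/differentiable_epsP; exists L => // e /LP[d d0 dP].
have /nbhs_ballP[r /= r0 rD] : nbhs x D by apply: open_nbhs_nbhs.
exists (Num.min d r) => [|h]; first by rewrite lt_min d0 r0.
rewrite lt_min => /andP[/dP + hr]; rewrite !fg//; apply/mem_set => //.
by apply: rD; rewrite -ball_normE /= distrC addrK.
Qed.

Lemma eq_on_Cn k (f g : V -> R) : {in D, f =1 g} -> Cn k D f -> Cn k D g.
Proof.
elim: k f g => [|k IH] f g fg [df Df].
  by split=> // x Dx; exact: (eq_on_differentiable fg Dx (df x Dx)).
split=> [x Dx|v]; first exact: (eq_on_differentiable fg Dx (df x Dx)).
by apply: IH (Df v); exact: eq_on_derive.
Qed.

Lemma eq_on_rsmooth (f g : V -> R) : {in D, f =1 g} -> rsmooth_on D f ->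
  rsmooth_on D g.
Proof. by move=> fg /rsmooth_Cn sf; apply/rsmooth_Cn => k; exact: eq_on_Cn (sf k). Qed.

Lemma CnS k (f : V -> R) (g : V -> V -> R) :
  (forall x, D x -> differentiable f x) ->
  (forall v x, D x -> 'D_v f x = g v x) ->
  (forall v, Cn k D (g v)) -> Cn k.+1 D f.
Proof.
move=> df fg Cg; split=> // v; apply: eq_on_Cn (Cg v) => x /set_mem Dx.
by rewrite fg.
Qed.

Lemma Cn_cst k (c : R) : Cn k D (fun=> c).
Proof.
elim: k c => [|k IH] c.
  by split=> // x _; exact: differentiable_cst.
apply: (CnS (g := fun _ _ => 0)) => [x _|v x _|v].
- exact: differentiable_cst.
- by rewrite derive_cst.
- exact: IH.
Qed.

Lemma Cn_add k (f g : V -> R) : Cn k D f -> Cn k D g ->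
  Cn k D (fun x => f x + g x).
Proof.
elim: k f g => [|k IH] f g Cf Cg.
  by split=> // x Dx; exact: (differentiableD (Cn_differentiable Dx Cf) (Cn_differentiable Dx Cg)).
apply: (CnS (g := fun v x => 'D_v f x + 'D_v g x)) => [x Dx|v x Dx|v].
- by exact: (differentiableD (Cn_differentiable Dx Cf) (Cn_differentiable Dx Cg)).
- have df := @diff_derivable _ _ _ _ _ v (Cn_differentiable Dx Cf).
  have dg := @diff_derivable _ _ _ _ _ v (Cn_differentiable Dx Cg).
  exact: (deriveD df dg).
- by apply: IH; exact: CnD.
Qed.

Lemma Cn_mul k (f g : V -> R) : Cn k D f -> Cn k D g ->
  Cn k D (fun x => f x * g x).
Proof.
elim: k f g => [|k IH] f g Cf Cg.
  by split=> // x Dx; exact: (differentiableM (Cn_differentiable Dx Cf) (Cn_differentiable Dx Cg)).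
apply: (CnS (g := fun v x => f x * 'D_v g x + g x * 'D_v f x))
  => [x Dx|v x Dx|v].
- by exact: (differentiableM (Cn_differentiable Dx Cf) (Cn_differentiable Dx Cg)).
- have df := @diff_derivable _ _ _ _ _ v (Cn_differentiable Dx Cf).
  have dg := @diff_derivable _ _ _ _ _ v (Cn_differentiable Dx Cg).
  exact: (deriveM df dg).
by apply: Cn_add; apply: IH; first [exact: CnW|exact: CnD].
Qed.

Lemma Cn_sum k (I : Type) (r : seq I) (P : pred I) (f : I -> V -> R) :
  (forall i, P i -> Cn k D (f i)) -> Cn k D (fun x => \sum_(i <- r | P i) f i x).
Proof.
move=> Cf; elim: r => [|i r IH].
  rewrite [X in _ X](_ : _ = fun=> 0); first exact: Cn_cst.
  by apply/funext => x; rewrite big_nil.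
case Pi: (P i); last first.
  rewrite [X in _ X](_ : _ = fun x => \sum_(i <- r | P i) f i x) //.
  by apply/funext => x; rewrite big_cons Pi.
rewrite [X in _ X](_ : _ = fun x => f i x + \sum_(i <- r | P i) f i x).
  by apply: Cn_add => //; exact: Cf.
by apply/funext => x; rewrite big_cons Pi.
Qed.

Lemma rsmooth_cst (c : R) : rsmooth_on D (fun=> c).
Proof. by apply/rsmooth_Cn => k; exact: Cn_cst. Qed.

Lemma rsmooth_add (f g : V -> R) : rsmooth_on D f -> rsmooth_on D g ->
  rsmooth_on D (fun x => f x + g x).
Proof. by move=> /rsmooth_Cn ? /rsmooth_Cn ?; apply/rsmooth_Cn => k; exact: Cn_add. Qed.

Lemma rsmooth_mul (f g : V -> R) : rsmooth_on D f -> rsmooth_on D g ->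
  rsmooth_on D (fun x => f x * g x).
Proof. by move=> /rsmooth_Cn ? /rsmooth_Cn ?; apply/rsmooth_Cn => k; exact: Cn_mul. Qed.

Lemma rsmooth_opp (f : V -> R) : rsmooth_on D f -> rsmooth_on D (fun x => - f x).
Proof.
move=> sf; rewrite (_ : (fun x => _) = (fun x => -1 * f x)).
  by apply: rsmooth_mul sf; exact: rsmooth_cst.
by apply/funext => x; rewrite mulN1r.
Qed.

Lemma rsmooth_sub (f g : V -> R) : rsmooth_on D f -> rsmooth_on D g ->
  rsmooth_on D (fun x => f x - g x).
Proof. by move=> sf sg; apply: rsmooth_add => //; exact: rsmooth_opp. Qed.

Lemma rsmooth_sum (I : Type) (r : seq I) (P : pred I) (f : I -> V -> R) :
  (forall i, P i -> rsmooth_on D (f i)) ->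
  rsmooth_on D (fun x => \sum_(i <- r | P i) f i x).
Proof.
by move=> sf; apply/rsmooth_Cn => k; apply: Cn_sum => i /sf/rsmooth_Cn.
Qed.

Lemma rsmooth_linear (L : {linear V -> R}) : continuous L -> rsmooth_on D L.
Proof.
move=> cL; apply/rsmooth_Cn; case=> [|k].
  by split=> // x _; exact: linear_differentiable.
apply: (CnS (g := fun v _ => L v)) => [x _|v x _|v].
- exact: linear_differentiable.
- by rewrite deriveE ?diff_lin//; exact: linear_differentiable.
- exact: Cn_cst.
Qed.

Lemma rsmooth_continuous (f : V -> R) x : rsmooth_on D f -> D x ->
  {for x, continuous f}.
Proof.
by move=> sf Dx; apply: differentiable_continuous; exact: (sf [::]).
Qed.

End open_domain.

Lemma rsmooth_subset V (D E : set V) f : D `<=` E -> rsmooth_on E f ->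
  rsmooth_on D f.
Proof. by move=> DE sf vs x /DE; exact: sf. Qed.

Lemma rsmooth_derive V (D : set V) f v : rsmooth_on D f ->
  rsmooth_on D ('D_v f).
Proof. by move=> /rsmooth_onP[_]; exact. Qed.

Lemma rsmooth_iter V (D : set V) f vs : rsmooth_on D f ->
  rsmooth_on D (iter_derive vs f).
Proof. by move=> sf; elim: vs => //= v vs; exact: rsmooth_derive. Qed.

Lemma CnS1 k (D : set R) (f f' : R -> R) : open D ->
  (forall x, D x -> is_derive x 1 f (f' x)) -> Cn k D f' -> Cn k.+1 D f.
Proof.
move=> oD ff' Cf'.
have df x : D x -> differentiable f x.
  by move=> /ff' [d _]; apply/derivable1_diffP.
apply: (CnS oD (g := fun v x => v * f' x)) => // [v x Dx|v].
  rewrite deriveE; last exact: df.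
  rewrite diff1E /=; last exact: df.
  by rewrite derive1E; have [_ ->] := ff' x Dx.
by apply: Cn_mul => //; exact: Cn_cst.
Qed.

(** The spaces of interest are R, R^n and their products. The chain rule and
    the estimates of Taylor remainders need of them only a finite basis whose
    dual functionals have norm at most 1. *)
Record coords V := Coords {
  cidx : finType;
  cvec : cidx -> V;
  cfun : cidx -> {linear V -> R};
  cfun_le : forall i x, `|cfun i x| <= `|x|;
  cfunK : forall x, x = \sum_i cfun i x *: cvec i }.
Arguments cvec {V} c i : rename.
Arguments cfun {V} c i : rename.
Arguments cfun_le {V} c i x : rename.
Arguments cfunK {V} c x : rename.

Lemma cfun_continuous V (c : coords V) i : continuous (cfun c i).
Proof.
apply/linear_bounded_continuous/linear_boundedP; near=> r => x.
apply: (le_trans (cfun_le c i x)); rewrite ler_peMl//.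
Unshelve. all: by end_near. Qed.

Lemma diff_cfun V W (c : coords W) (phi : V -> W) x v i : differentiable phi x ->
  cfun c i ('d phi x v) = 'D_v (cfun c i \o phi) x.
Proof.
move=> dphi.
have dc : differentiable (cfun c i) (phi x).
  exact/linear_differentiable/cfun_continuous.
rewrite deriveE; last exact: differentiable_comp.
by rewrite (diff_comp dphi dc)/= diff_lin//; exact: cfun_continuous.
Qed.

Lemma differentiable_cfun V W (c : coords W) (phi : V -> W) x :
  (forall i, differentiable (cfun c i \o phi) x) -> differentiable phi x.
Proof.
move=> dphi.
rewrite (_ : phi = \sum_i (fun y => cfun c i (phi y) *: cvec c i)); last first.
  by apply/funext => y; rewrite fct_sumE {1}(cfunK c (phi y)).
elim/big_ind: _ => [|f g df dg|i _]; first exact: differentiable_cst.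
  exact: differentiableD.
apply: (@differentiableZl _ _ _ (cfun c i \o phi)); exact: dphi.
Qed.

Lemma derive_chain V W (c : coords W) (phi : V -> W) (f : W -> R) x v :
  differentiable phi x -> differentiable f (phi x) ->
  'D_v (f \o phi) x = \sum_i 'D_v (cfun c i \o phi) x * 'D_(cvec c i) f (phi x).
Proof.
move=> dphi df; rewrite deriveE; last exact: differentiable_comp.
rewrite (diff_comp dphi df)/= {1}(cfunK c ('d phi x v)) linear_sum; apply: eq_bigr => i _.
by rewrite linearZ /= diff_cfun// -deriveE.
Qed.

(** Induction on the order: by the chain rule, a derivative of the composition is
    a sum of products of a derivative of phi with a composition of lower order. *)
Lemma rsmooth_comp V W (c : coords W) (D : set V) (E : set W) (phi : V -> W)
    (f : W -> R) : open D -> open E -> (forall x, D x -> E (phi x)) ->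
  (forall i, rsmooth_on D (cfun c i \o phi)) -> rsmooth_on E f ->
  rsmooth_on D (f \o phi).
Proof.
move=> oD oE DE sphi /rsmooth_Cn sf; apply/rsmooth_Cn => k.
have dphi x : D x -> differentiable phi x.
  by move=> Dx; apply: (@differentiable_cfun _ _ c) => i; exact: (sphi i [::]).
elim: k f {sf}(sf k) => [|k IH] f Cf.
  split=> // x Dx; apply: differentiable_comp; first exact: dphi.
  exact: (Cn_differentiable (DE _ Dx) Cf).
apply: (CnS oD (g := fun v x =>
  \sum_i 'D_v (cfun c i \o phi) x * ('D_(cvec c i) f \o phi) x)) => [x Dx|v x Dx|v].
- apply: differentiable_comp; first exact: dphi.
  exact: (Cn_differentiable (DE _ Dx) Cf).
- apply: derive_chain; first exact: dphi.
  exact: (Cn_differentiable (DE _ Dx) Cf).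
- apply: Cn_sum => // i _; apply: Cn_mul => //; last exact/IH/CnD.
  by move: k {IH Cf}; apply/rsmooth_Cn/rsmooth_derive.
Qed.

Definition mklin V (f : V -> R) (lf : linear f) : {linear V -> R} :=
  HB.pack f (GRing.isLinear.Build _ _ _ _ f lf).

Lemma coord_rV_le n i (x : 'rV[R]_n) : `|x 0 i| <= `|x|.
Proof.
rewrite [leRHS]/Num.norm /= mx_normrE.
by apply: (le_bigmax _ (fun ij : 'I_1 * 'I_n => `|x ij.1 ij.2|) (0, i)).
Qed.

Let linear_id : linear (@id R). Proof. by []. Qed.

Let coords_R_subproof (x : R) : x = \sum_(i < 1) mklin linear_id x *: 1.
Proof. by rewrite big_ord1 /= [RHS]mulr1. Qed.

Definition coords_R : coords R :=
  @Coords R 'I_1 (fun=> 1) (fun=> mklin linear_id) (fun _ x => lexx `|x|)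
    coords_R_subproof.

Let linear_coord n (i : 'I_n) : linear (fun x : 'rV[R]_n => x 0 i).
Proof. by move=> a x y; rewrite !mxE. Qed.

Definition coords_rV n : coords 'rV[R]_n :=
  @Coords _ 'I_n (fun i => delta_mx 0 i) (fun i => mklin (linear_coord i))
    (@coord_rV_le n) (@row_sum_delta R n).

Section coords_prod.
Context {V W : normedModType R} (c : coords V) (d : coords W).

Let cvec_prod (s : cidx c + cidx d) : V * W :=
  match s with inl i => (cvec c i, 0) | inr i => (0, cvec d i) end.

Let cfun_prod_subproof (s : cidx c + cidx d) : linear (fun x : V * W =>
  match s with inl i => cfun c i x.1 | inr i => cfun d i x.2 end).
Proof. by case: s => i a x y; rewrite linearP. Qed.

Let cfun_prod_le (s : cidx c + cidx d) (x : V * W) :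
  `|mklin (cfun_prod_subproof s) x| <= `|x|.
Proof.
rewrite prod_normE le_max; case: s => i /=; apply/orP; [left|right];
  exact: cfun_le.
Qed.

Let cfun_prodK (z : V * W) :
  z = \sum_s mklin (cfun_prod_subproof s) z *: cvec_prod s.
Proof.
case: z => x y.
rewrite big_sumType /=.
have sum1 (I : finType) (F : I -> V * W) : (\sum_i F i).1 = \sum_i (F i).1.
  exact: (big_morph (fun z : V * W => z.1)).
have sum2 (I : finType) (F : I -> V * W) : (\sum_i F i).2 = \sum_i (F i).2.
  exact: (big_morph (fun z : V * W => z.2)).
have addE (a b : V * W) : a + b = (a.1 + b.1, a.2 + b.2) by [].
rewrite addE !sum1 !sum2 /=.
rewrite -(cfunK c x) -(cfunK d y).
by rewrite !big1 ?addr0 ?add0r// => i _; exact: scaler0.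
Qed.

Definition coords_prod : coords (V * W)%type :=
  @Coords _ (cidx c + cidx d)%type cvec_prod
    (fun s => mklin (cfun_prod_subproof s)) cfun_prod_le cfun_prodK.
End coords_prod.

End smooth_calculus.
Arguments cvec {R V} c i : rename.
Arguments cfun {R V} c i : rename.
Arguments cfun_le {R V} c i x : rename.
Arguments cfunK {R V} c x : rename.

(** * Integrals depending smoothly on a parameter *)

Lemma is_derive_affine (R : realType) (V W : normedModType R) (phi : V -> W)
    (f : W -> R) a v w l :
  (forall h : R, phi (h *: v + a) = h *: w + phi a) ->
  is_derive (phi a) w f l -> is_derive a v (f \o phi) l.
Proof.
move=> phiE [df <-].
have E : (fun e : R => e^-1 *: (((f \o phi) \o shift a) (e *: v) - (f \o phi) a)) =
  (fun e : R => e^-1 *: ((f \o shift (phi a)) (e *: w) - f (phi a))).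
  by apply/funext => e /=; rewrite phiE.
by apply: DeriveDef; rewrite /derivable /derive E.
Qed.

Section mean_value.
Context {R : realType} {V : normedModType R}.
Implicit Types (f : V -> R) (x h : V).

Lemma is_derive_line f x h (t : R) : derivable f (t *: h + x) h ->
  is_derive t 1 (fun s : R => f (s *: h + x)) ('D_h f (t *: h + x)).
Proof.
move=> /derivableP df.
apply: (@is_derive_affine _ _ _ (fun s : R => s *: h + x) f t 1 h _ _ df).
by move=> e; rewrite [e *: 1]mulr1 scalerDl addrA.
Qed.

Lemma mean_value f x h : (forall y, differentiable f y) ->
  exists2 t : R, 0 <= t <= 1 & f (h + x) - f x = 'D_h f (t *: h + x).
Proof.
move=> df.
have dl (t : R) : is_derive t 1 (fun s : R => f (s *: h + x)) ('D_h f (t *: h + x)).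
  exact/is_derive_line/diff_derivable.
have cl : {within `[0, 1], continuous (fun s : R => f (s *: h + x))}.
  apply: continuous_subspaceT => s; apply: differentiable_continuous.
  by apply/derivable1_diffP; case: (dl s).
have [t] := MVT ltr01 (fun t _ => dl t) cl.
rewrite in_itv/= => /andP[t0 t1].
rewrite scale1r scale0r add0r subr0 mulr1 => E.
by exists t; rewrite ?(ltW t0) ?(ltW t1).
Qed.

Lemma derive_coords (c : coords V) f x h : differentiable f x ->
  'D_h f x = \sum_i cfun c i h * 'D_(cvec c i) f x.
Proof.
move=> df; rewrite deriveE// {1}(cfunK c h) linear_sum; apply: eq_bigr => i _.
by rewrite linearZ/= deriveE.
Qed.

Lemma lipschitz_coords (c : coords V) f x h (B : cidx c -> R) :
  (forall y, differentiable f y) ->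
  (forall i (t : R), 0 <= t <= 1 -> `|'D_(cvec c i) f (t *: h + x)| <= B i) ->
  `|f (h + x) - f x| <= `|h| * \sum_i B i.
Proof.
move=> df dB; have [t t01 ->] := mean_value x h df.
rewrite (derive_coords c)// mulr_sumr; apply: (le_trans (ler_norm_sum _ _ _)).
by apply: ler_sum => i _; rewrite normrM ler_pM// ?cfun_le// dB.
Qed.

(** The mean value theorem is used twice, first for f and then for its first
    derivatives along the segment. *)
Lemma taylor2_coords (c : coords V) f x h (B : cidx c -> cidx c -> R) :
  rsmooth_on setT f ->
  (forall i j (t : R), 0 <= t <= 1 ->
     `|'D_(cvec c j) ('D_(cvec c i) f) (t *: h + x)| <= B i j) ->
  `|f (h + x) - f x - 'D_h f x| <= `|h| ^+ 2 * \sum_i \sum_j B i j.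
Proof.
move=> sf dB.
have df y : differentiable f y by exact: (sf [::]).
have [t /andP[t0 t1] ->] := mean_value x h df.
rewrite !(derive_coords c)// -sumrB expr2 -mulrA !mulr_sumr.
apply: (le_trans (ler_norm_sum _ _ _)); apply: ler_sum => i _.
rewrite -mulrBr normrM ler_pM ?cfun_le//.
have th : `|t *: h| <= `|h|.
  by rewrite normrZ ger0_norm// ler_piMl.
have B0 j : 0 <= B i j by apply: le_trans (dB i j 0 _); rewrite ?lexx ?ler01.
apply: (@le_trans _ _ (`|t *: h| * \sum_j B i j)); last first.
  by rewrite ler_wpM2r//; exact: sumr_ge0.
apply: (@lipschitz_coords c ('D_(cvec c i) f) x (t *: h) (B i))
    => [y|j s /andP[s0 s1]].
  exact: (sf [:: cvec c i]).
rewrite scalerA; apply: dB; rewrite mulr_ge0//=.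
by rewrite mulr_ile1.
Qed.

End mean_value.

Lemma finite_lower_bound (R : realType) (I : finType) (d : I -> R) :
  (forall i, 0 < d i) -> exists2 e : R, 0 < e & forall i, e <= d i.
Proof.
move=> d0; exists (\big[Num.min/1]_i d i).
  by apply/bigmin_gtP; split=> // i _.
by move=> i; apply: bigmin_le_cond.
Qed.

Section param_integral.
Context {R : realType} {V : normedModType R} (c : coords V).
Context {d : measure_display} {T : measurableType d}.
Variable mu : {measure set T -> \bar R}.
Implicit Types (F : V -> T -> R).

Definition rintegrable (f : T -> R) := mu.-integrable setT (EFin \o f).

Lemma rintegrable_le (f g : T -> R) : measurable_fun setT f ->
  (forall x, `|f x| <= g x) -> rintegrable g -> rintegrable f.
Proof.
move=> mf fg; apply: le_integrable => //; first exact/measurable_EFinP.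
by move=> x _; rewrite lee_fin (le_trans (fg x))// ler_norm.
Qed.

Lemma rintegrableD f g : rintegrable f -> rintegrable g ->
  rintegrable (fun x => f x + g x).
Proof. by move=> fi gi; exact: (integrableD measurableT fi gi). Qed.

Lemma rintegrableZ (k : R) f : rintegrable f -> rintegrable (fun x => k * f x).
Proof. by move=> fi; exact: (integrableZl measurableT k fi). Qed.

Lemma rintegrable0 : rintegrable (fun=> 0).
Proof. exact: integrable0. Qed.

Lemma rintegrable_sum (I : Type) (r : seq I) (f : I -> T -> R) :
  (forall i, rintegrable (f i)) -> rintegrable (fun x => \sum_(i <- r) f i x).
Proof.
move=> fi; elim: r => [|i r IH].
  rewrite (_ : (fun x => _) = fun=> 0); first exact: rintegrable0.
  by apply/funext => x; rewrite big_nil.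
rewrite (_ : (fun x => _) = fun x => f i x + \sum_(i <- r) f i x).
  exact: rintegrableD.
by apply/funext => x; rewrite big_cons.
Qed.

Lemma Rint_sum (I : Type) (r : seq I) (f : I -> T -> R) :
  (forall i, rintegrable (f i)) ->
  \int[mu]_x (\sum_(i <- r) f i x) = \sum_(i <- r) \int[mu]_x f i x.
Proof.
move=> fi; elim: r => [|i r IH].
  rewrite big_nil -[RHS](mul0r (fine (mu setT))) -Rintegral_cst//.
  by apply: eq_Rintegral => x _; rewrite big_nil.
rewrite big_cons -IH -(RintegralD measurableT (fi i) (rintegrable_sum r fi)).
by apply: eq_Rintegral => x _; rewrite big_cons.
Qed.

Lemma Rint_le (f g : T -> R) : measurable_fun setT f -> rintegrable g ->
  (forall x, `|f x| <= g x) -> `|\int[mu]_x f x| <= \int[mu]_x g x.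
Proof.
move=> mf gi fg; have fi := rintegrable_le mf fg gi.
apply: le_trans (le_normr_Rintegral _ fi) _ => //.
by apply: le_Rintegral => //; exact: (integrable_abse fi).
Qed.

(** Local domination of the derivatives of every order, the condition under
    which integration commutes with all of them. *)
Definition dominated F := forall vs : seq V,
  (forall x, measurable_fun setT (fun y => iter_derive vs (F^~ y) x)) /\
  forall x0, exists2 e : R, 0 < e & exists2 G : T -> R, rintegrable G &
    forall x y, `|x - x0| < e -> `|iter_derive vs (F^~ y) x| <= G y.

Lemma dominated_derive F v : dominated F ->
  dominated (fun x y => 'D_v (F^~ y) x).
Proof.
move=> dF vs; have [mF dF'] := dF (rcons vs v).
have E y : iter_derive (rcons vs v) (F^~ y) = iter_derive vs ('D_v (F^~ y)).
  exact: iter_derive_rcons.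
split=> [x|x0].
  by have := mF x; under eq_fun do rewrite E.
have [e e0 [G Gi GP]] := dF' x0; exists e => //; exists G => // x y xe.
by rewrite -E; exact: GP.
Qed.

Lemma dominated_integrable F x : dominated F -> rintegrable (F x).
Proof.
move=> /(_ [::])/= [mF /(_ x)[e e0 [G Gi GP]]].
apply: rintegrable_le Gi => [|y]; first exact: mF.
by apply: GP; rewrite subrr normr0.
Qed.

(** Near x the Taylor remainder of order 2 of the integrand is bounded by |h|^2
    times an integrable function. Integrating this bound shows that the integral
    of the differentials is a differential, without any limit theorem. *)
Lemma differentiable_Rintegral F x : (forall y, rsmooth_on setT (F^~ y)) ->
  dominated F -> differentiable (fun x => \int[mu]_y F x y) x /\
  forall v, 'D_v (fun x => \int[mu]_y F x y) x = \int[mu]_y 'D_v (F^~ y) x.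
Proof.
move=> sF dF.
(* In coordinates the candidate is visibly linear and continuous. *)
pose L0 (h : V) : R := \sum_i cfun c i h * \int[mu]_y 'D_(cvec c i) (F^~ y) x.
have lL0 : linear L0.
  move=> a h k; rewrite /L0 scaler_sumr -big_split/=; apply: eq_bigr => i _.
  by rewrite linearP/= mulrDl -[a *: (_ * _)]/(a * _) mulrA.
pose L := mklin lL0.
have cL : continuous L.
  rewrite (_ : (L : V -> R) = L0)//.
  rewrite (_ : L0 = \sum_i (cfun c i \* cst (\int[mu]_y 'D_(cvec c i) (F^~ y) x))).
    elim/big_ind: _ => [|f g cf cg|i _] z; first exact: cst_continuous.
      by apply: continuousD; [exact: cf|exact: cg].
    by apply: continuousM; [exact: cfun_continuous|exact: cst_continuous].
  by apply/funext => z; rewrite fct_sumE.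
have iD v : rintegrable (fun y => 'D_v (F^~ y) x).
  exact: (dominated_integrable x (dominated_derive v dF)).
have L0E v : L0 v = \int[mu]_y 'D_v (F^~ y) x.
  rewrite (_ : L0 v =
      \sum_i \int[mu]_y (cfun c i v * 'D_(cvec c i) (F^~ y) x)).
    rewrite -Rint_sum => [|i]; last exact: rintegrableZ.
    by apply: eq_Rintegral => y _; rewrite -derive_coords//; exact: (sF y [::]).
  by apply: eq_bigr => i _; rewrite RintegralZl//; exact: iD.
have iF z : rintegrable (F z) by exact: dominated_integrable.
have dI : forall e : R, 0 < e -> exists2 d : R, 0 < d & forall h, `|h| < d ->
    `|\int[mu]_y F (h + x) y - \int[mu]_y F x y - L h| <= e * `|h|.
  pose ij := (cidx c * cidx c)%type.
  have /choice[e0 He0] (p : ij) : exists e : R, 0 < e /\ exists2 G : T -> R,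
      rintegrable G & forall z y, `|z - x| < e ->
        `|'D_(cvec c p.2) ('D_(cvec c p.1) (F^~ y)) z| <= G y.
    by have [_ /(_ x)[e e0 HG]] := dF [:: cvec c p.2; cvec c p.1]; exists e.
  have /choice[G HG] (p : ij) : exists G : T -> R,
      rintegrable G /\ forall z y, `|z - x| < e0 p ->
        `|'D_(cvec c p.2) ('D_(cvec c p.1) (F^~ y)) z| <= G y.
    by have [_ [G Gi GP]] := He0 p; exists G.
  have [r r0 rP] := finite_lower_bound (fun p => (He0 p).1).
  pose GG y := \sum_i \sum_j G (i, j) y.
  have GGi : rintegrable GG.
    by apply: rintegrable_sum => i; apply: rintegrable_sum => j; case: (HG (i, j)).
  pose M := \int[mu]_y GG y.
  have key h : `|h| < r ->
      `|\int[mu]_y F (h + x) y - \int[mu]_y F x y - L h| <= `|h| ^+ 2 * M.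
    move=> hr; rewrite [L h]L0E.
    have iDh : rintegrable (fun y => 'D_h (F^~ y) x) by exact: iD.
    have iB : rintegrable (fun y => F (h + x) y - F x y).
      exact: (integrableB measurableT (iF (h + x)) (iF x)).
    have iBB : rintegrable (fun y => F (h + x) y - F x y - 'D_h (F^~ y) x).
      exact: (integrableB measurableT iB iDh).
    rewrite -(RintegralB measurableT (iF (h + x)) (iF x)).
    rewrite -(RintegralB measurableT iB iDh).
    rewrite -(RintegralZl _ measurableT GGi).
    apply: Rint_le => [||y].
    - by apply/measurable_EFinP; case/integrableP: iBB.
    - exact: rintegrableZ.
    - apply: (@taylor2_coords _ _ c (F^~ y) x h (fun i j => G (i, j) y)) => //.
      move=> i j t /andP[t0 t1]; have [_ /(_ (t *: h + x) y)] := HG (i, j).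
      apply; rewrite addrK normrZ ger0_norm//.
      rewrite (le_lt_trans (ler_piMl _ _))// (lt_le_trans hr)//.
  move=> e epos; exists (Num.min r (e / (`|M| + 1))).
    by rewrite lt_min r0/= divr_gt0// ltr_wpDl.
  move=> h; rewrite lt_min => /andP[hr hM].
  apply: (le_trans (key h hr)); rewrite expr2 -mulrA mulrC ler_wpM2r//.
  apply: (@le_trans _ _ (`|h| * (`|M| + 1))).
    by rewrite ler_wpM2l// (le_trans (ler_norm _))// lerDl.
  by rewrite -ler_pdivlMr ?ltW// ltr_wpDl.
have [dF' DF] := @derive_eps _ _ (fun x => \int[mu]_y F x y) x L cL dI.
by split=> // v; rewrite DF -L0E.
Qed.

Lemma rsmooth_Rintegral F : (forall y, rsmooth_on setT (F^~ y)) ->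
  dominated F -> rsmooth_on setT (fun x => \int[mu]_y F x y).
Proof.
move=> sF dF; apply/rsmooth_Cn => k; elim: k F sF dF => [|k IH] F sF dF.
  by split=> // x _; case: (differentiable_Rintegral x sF dF).
apply: (CnS openT (g := fun v x => \int[mu]_y 'D_v (F^~ y) x)) => [x _|v x _|v].
- by case: (differentiable_Rintegral x sF dF).
- by case: (differentiable_Rintegral x sF dF).
- by apply: IH; [move=> y; exact: rsmooth_derive|exact: dominated_derive].
Qed.
End param_integral.

(** * Lebesgue integration on R^n *)

Section measurable_continuous.
Context {R : realType} {V : normedModType R} (c : coords V).
Context {d : measure_display} {T : measurableType d}.
Variable iota : T -> V.
Hypothesis miota : forall i, measurable_fun setT (fun t => cfun c i (iota t)).

Let box (p : {ffun cidx c -> rat} * nat) : set V :=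
  [set v | forall i, `|cfun c i v - ratr (p.1 i)| < p.2.+1%:R^-1].

Let measurable_box p : measurable (iota @^-1` box p).
Proof.
rewrite (_ : iota @^-1` box p = \bigcap_(i in [set: cidx c])
  ((fun t => `|cfun c i (iota t) - ratr (p.1 i)|) @^-1` `]-oo, p.2.+1%:R^-1[)).
  apply: fin_bigcap_measurable => // i _.
  rewrite -[X in measurable X]setTI.
  have : measurable_fun setT (fun t => `|cfun c i (iota t) - ratr (p.1 i)|).
    by apply: measurableT_comp => //; apply: measurable_funB.
  by apply => //; exact: measurable_itv.
apply/seteqP; split=> [t /= bt i _|t /= bt i].
  by rewrite /= in_itv/=; exact: bt.
by have := bt i I; rewrite /= in_itv.
Qed.

Let norm_le (v : V) (e : R) : (forall i, `|cfun c i v| <= e) ->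
  `|v| <= e * \sum_i `|cvec c i|.
Proof.
move=> ve; rewrite {1}(cfunK c v) mulr_sumr.
apply: (le_trans (ler_norm_sum _ _ _)); apply: ler_sum => i _.
by rewrite normrZ ler_wpM2r.
Qed.

(** Measurability of iota is known coordinate by coordinate only; an open set is
    a countable union of boxes with rational centres and radii 1/(k+1). *)
Lemma measurable_preimage_open (U : set V) : open U -> measurable (iota @^-1` U).
Proof.
move=> oU.
pose F p := [set t | box p `<=` U /\ box p (iota t)].
have -> : iota @^-1` U = \bigcup_p F p.
  apply/seteqP; split=> [t Ut|t [p _ [+ bt]]]; last by apply.
  have /nbhs_ballP[r /= r0 rU] : nbhs (iota t) U by apply: open_nbhs_nbhs.
  pose S := \sum_i `|cvec c i| + 1.
  have S0 : 0 < S by rewrite ltr_wpDl// sumr_ge0.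
  have [k kr] : exists k : nat, 2 * k.+1%:R^-1 * S < r.
    have e0 : 0 < r / (2 * S) by rewrite divr_gt0// mulr_gt0.
    have [k _ /(_ _ (leqnn _))/= kP] := near_infty_natSinv_lt (PosNum e0).
    exists k; move: kP; rewrite ltr_pdivlMr ?mulr_gt0//.
    by rewrite mulrCA mulrA.
  have /choice[q Hq] (i : cidx c) : exists q : rat,
      `|cfun c i (iota t) - ratr q| < k.+1%:R^-1.
    have [|q] := @rat_in_itvoo R (cfun c i (iota t) - k.+1%:R^-1)
      (cfun c i (iota t) + k.+1%:R^-1).
      by rewrite ltrD2l gtrN// invr_gt0.
    by rewrite in_itv/= => qP; exists q; rewrite ltr_distlC.
  exists ([ffun i => q i], k) => //; split; last by move=> i; rewrite ffunE.
  move=> v bv; apply: rU; rewrite -ball_normE /=.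
  apply: (@le_lt_trans _ _ (2 * k.+1%:R^-1 * \sum_i `|cvec c i|)).
    apply: norm_le => i; rewrite raddfB/=.
    have := bv i; rewrite ffunE/= => bvi.
    rewrite -(subrKA (ratr (q i))) (le_trans (ler_normD _ _))//.
    by rewrite mulr2n mulrDl mul1r lerD// ltW// distrC.
  apply: le_lt_trans kr; rewrite ler_wpM2l// ?lerDl// mulr_ge0//.
apply: countable_bigcupT_measurable => [|p].
  exact: countableP.
case: (pselect (box p `<=` U)) => bU.
  rewrite (_ : F p = iota @^-1` box p)//.
  by apply/seteqP; split=> [t []|t bt]//; split.
by rewrite (_ : F p = set0)//; apply/seteqP; split=> [t []|].
Qed.

Lemma measurable_continuous (f : V -> R) : continuous f ->
  measurable_fun setT (fun t => f (iota t)).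
Proof.
move=> cf; apply: (measurability _ (RGenOInfty.measurableE R)).
move=> _ [_ [a ->] <-]; rewrite setTI.
rewrite (_ : _ @^-1` _ = iota @^-1` (f @^-1` `]a, +oo[)) //.
apply: measurable_preimage_open; apply: open_comp; last exact: interval_open.
by move=> x _; exact: cf.
Qed.
End measurable_continuous.

Section tuple_integral.
Context {R : realType}.
Local Notation tpl n := (n.-tuple (measurableTypeR R)).
Local Notation leb := (@lebesgue_measure R).

Definition rowt n (t : tpl n) : 'rV[R]_n := \row_i tnth t i.

Lemma measurable_rowt n (f : 'rV[R]_n -> R) : continuous f ->
  measurable_fun setT (fun t : tpl n => f (rowt t)).
Proof.
apply: (measurable_continuous (c := coords_rV n)) => i.
rewrite (_ : (fun t => _) = (fun t : tpl n => tnth t (i : 'I_n))).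
  exact: measurable_tnth.
by apply/funext => t; rewrite /= mxE.
Qed.

Let mcons n := @measurable_cons_pair R n.

Lemma ge0_integral_cons n (f : tpl n.+1 -> \bar R) : measurable_fun setT f ->
  (forall t, 0 <= f t)%E ->
  (\int[lebesgue_tuple R n.+1]_t f t =
   \int[leb]_x \int[lebesgue_tuple R n]_s f (cons_pair (x, s)))%E.
Proof.
move=> mf f0.
transitivity (\int[pushforward (leb \x lebesgue_tuple R n)%E
    (@cons_pair R n)]_t f t)%E.
  by apply: eq_measure_integral; first exact: mcons.
rewrite ge0_integral_pushforward//; last exact: mcons.
rewrite preimage_setT fubini_tonelli1//; last by move=> z; exact: f0.
by apply: measurableT_comp => //; exact: mcons.
Qed.

Lemma integral_cons n (f : tpl n.+1 -> \bar R) :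
  (lebesgue_tuple R n.+1).-integrable setT f ->
  (\int[lebesgue_tuple R n.+1]_t f t =
   \int[leb]_x \int[lebesgue_tuple R n]_s f (cons_pair (x, s)))%E.
Proof.
move=> fi; have mf := measurable_int _ fi.
have mfc : measurable_fun setT (f \o @cons_pair R n).
  by apply: measurableT_comp => //; exact: mcons.
have fci : (leb \x lebesgue_tuple R n)%E.-integrable setT (f \o @cons_pair R n).
  apply/integrable12ltyP => //.
  rewrite -(@ge0_integral_cons n (fun t => `|f t|)%E)//.
    by case/integrableP: fi.
  exact: measurableT_comp.
transitivity (\int[pushforward (leb \x lebesgue_tuple R n)%E
    (@cons_pair R n)]_t f t)%E.
  by apply: eq_measure_integral; first exact: mcons.
rewrite integral_pushforward//; last exact: mcons.
by rewrite preimage_setT -integral12_prod_meas1.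
Qed.

Lemma tnth_cons0 n x (s : tpl n) : tnth (cons_pair (x, s)) ord0 = x.
Proof. by []. Qed.

Lemma tnth_consS n x (s : tpl n) i :
  tnth (cons_pair (x, s)) (lift ord0 i) = tnth s i.
Proof. by rewrite tnthS. Qed.

Lemma measurable_prod_tuple m (g : 'I_m -> R -> R) :
  (forall i, measurable_fun setT (g i)) ->
  measurable_fun setT (fun t : tpl m => (\prod_i g i (tnth t i))%:E).
Proof.
move=> mg; apply/measurable_EFinP.
apply: (measurable_prod (h := fun i (t : tpl m) => g i (tnth t i))) => i _.
by apply: (measurableT_comp (mg i)); exact: measurable_tnth.
Qed.

Lemma integral_prod_tuple n (f : 'I_n -> R -> R) (I : 'I_n -> R) :
  (forall i x, 0 <= f i x) -> (forall i, measurable_fun setT (f i)) ->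
  (forall i, \int[leb]_x (f i x)%:E = (I i)%:E)%E ->
  (\int[lebesgue_tuple R n]_t (\prod_i f i (tnth t i))%:E = (\prod_i I i)%:E)%E.
Proof.
elim: n f I => [|n IH] f I f0 mf fI.
  under eq_integral do rewrite big_ord0.
  by rewrite integral_dirac// diracT mul1e big_ord0.
have mp := measurable_prod_tuple.
rewrite ge0_integral_cons; [|exact: mp|]; last first.
  by move=> t; rewrite lee_fin prodr_ge0.
rewrite big_ord_recl EFinM -fI.
rewrite -ge0_integralZr//; last 3 first.
  by apply/measurable_EFinP; exact: (mf ord0).
  by move=> x _; rewrite lee_fin.
  by rewrite -(IH (fun i => f (lift ord0 i)))// integral_ge0// => t _; rewrite lee_fin prodr_ge0.
apply: eq_integral => x _.
rewrite -(IH (fun i => f (lift ord0 i)))//.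
rewrite -ge0_integralZl//; last 3 first.
- by apply: (mp n (fun i => f (lift ord0 i))) => i; exact: mf.
- by move=> t _; rewrite lee_fin prodr_ge0.
- by rewrite lee_fin.
apply: eq_integral => t _; rewrite big_ord_recl EFinM; congr (_ * _%:E)%E.
by apply: eq_bigr => i _; rewrite tnth_consS.
Qed.

(** An integrable weight with polynomial inverse: decay and growth are both
    measured by its powers. *)
Definition wgt n (x : 'rV[R]_n) : R := \prod_i (1 + x 0 i ^+ 2)^-1.

Lemma wgt_gt0 n (x : 'rV[R]_n) : 0 < wgt x.
Proof. by apply: prodr_gt0 => i _; rewrite invr_gt0 ltr_pwDl// sqr_ge0. Qed.

Lemma integral_oneDsqrV :
  (\int[leb]_x ((1 + x ^+ 2)^-1)%:E = pi%:E :> \bar R)%E.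
Proof.
have E : (fun x : R => (1 + x ^+ 2)^-1) = (fun x => (oneDsqr x)^-1) by [].
have := @ge0_symfun_integralT R (fun x => (oneDsqr x)^-1).
rewrite -E => ->.
- rewrite (_ : [set x : R | _] = `[0, +oo[%classic); last first.
    by apply/seteqP; split => x /=; rewrite in_itv/= andbT.
  by rewrite integral0y_oneDsqr -EFinM mulrCA divff ?mulr1.
- by move=> x; rewrite invr_ge0 addr_ge0// sqr_ge0.
- by rewrite E; exact: continuous_oneDsqrV.
- by move=> x /=; rewrite sqrrN.
Qed.

Lemma measurable_oneDsqrV : measurable_fun setT (fun x : R => (1 + x ^+ 2)^-1).
Proof. by apply: continuous_measurable_fun; exact: continuous_oneDsqrV. Qed.

Lemma integrable_wgt n :
  (lebesgue_tuple R n).-integrable setT (fun t => (wgt (rowt t))%:E).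
Proof.
have wE t : wgt (rowt t) = \prod_(i < n) (1 + tnth t i ^+ 2)^-1.
  by apply: eq_bigr => i _; rewrite mxE.
apply/integrableP; split.
  apply/measurable_EFinP; rewrite (_ : (fun t => _) =
    (fun t : tpl n => \prod_(i < n) (1 + tnth t i ^+ 2)^-1)); last exact/funext.
  apply: (measurable_prod (h := fun i (t : tpl n) => (1 + tnth t i ^+ 2)^-1)) => i _.
  apply: (measurableT_comp measurable_oneDsqrV); exact: measurable_tnth.
under eq_integral => t _.
  rewrite gee0_abs ?lee_fin ?(ltW (wgt_gt0 _))// wE; over.
rewrite (@integral_prod_tuple n (fun _ x => (1 + x ^+ 2)^-1) (fun=> pi))//.
- by rewrite ltry.
- by move=> _ x; rewrite invr_ge0 addr_ge0// sqr_ge0.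
- by move=> _; exact: measurable_oneDsqrV.
- by move=> _; exact: integral_oneDsqrV.
Qed.

(** Unlike integrability, this condition passes to every function obtained by
    fixing one coordinate, as iterated integrals require. *)
Definition wdom n (f : 'rV[R]_n -> R) :=
  continuous f /\ exists C, forall x, `|f x| <= C * wgt x.

Lemma wdom_integrable n (f : 'rV[R]_n -> R) : wdom f ->
  (lebesgue_tuple R n).-integrable setT (fun t => (f (rowt t))%:E).
Proof.
move=> [cf [C fC]].
apply: (rintegrable_le (f := fun t => f (rowt t)) (g := fun t => C * wgt (rowt t))).
- exact: measurable_rowt.
- by move=> t; exact: fC.
- exact: (rintegrableZ C (integrable_wgt n)).
Qed.

End tuple_integral.

(** * The integral of a derivative *)

Section integral_derivative.
Context {R : realType}.
Local Notation tpl n := (n.-tuple (measurableTypeR R)).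
Local Notation leb := (@lebesgue_measure R).

(** The integral over [-n, n] is a difference of two values of F that tend to 0. *)
Lemma integral_derive1_eq0 (F f : R -> R) (C : R) :
  (forall x : R, is_derive x 1 F (f x)) -> continuous f ->
  (forall x, `|F x| <= C * (1 + x ^+ 2)^-1) ->
  (forall x, `|f x| <= C * (1 + x ^+ 2)^-1) ->
  (\int[leb]_x (f x)%:E = 0)%E.
Proof.
move=> dF cf FC fC.
pose J (n : nat) : set R := `[- n.+1%:R, n.+1%:R]%classic.
pose f_ n x := ((f \_ (J n)) x)%:E.
have cF : continuous F.
  move=> x; apply: differentiable_continuous; apply/derivable1_diffP.
  by case: (dF x).
have mf : measurable_fun setT f by exact: continuous_measurable_fun.
have mf_ n : measurable_fun setT (f_ n).
  apply/measurable_EFinP; apply/(measurable_restrictT _ _).1 => //.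
    exact: measurable_itv.
  exact: measurable_funTS.
have intf_ n : (\int[leb]_x f_ n x = (F n.+1%:R - F (- n.+1%:R))%:E)%E.
  have n0 : - n.+1%:R < n.+1%:R :> R by rewrite gtrN.
  have fE : f_ n = (EFin \o f) \_ (J n) by rewrite restrict_EFin.
  rewrite fE -integral_mkcond.
  rewrite (@continuous_FTC2 _ f F)// ?EFinB//.
  - by apply: continuous_subspaceT => x; exact: cf.
  - split=> [x _||]; first by case: (dF x).
    + by apply: cvg_at_right_filter; exact: cF.
    + by apply: cvg_at_left_filter; exact: cF.
  - by move=> x _; rewrite derive1E; case: (dF x).
have ig : rintegrable leb (fun x : measurableTypeR R => C * (1 + x ^+ 2)^-1).
  apply: rintegrableZ; apply/integrableP.
  split; first by apply/measurable_EFinP; exact: (@measurable_oneDsqrV R).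
  under eq_integral => t _.
    rewrite gee0_abs ?lee_fin ?invr_ge0 ?addr_ge0 ?sqr_ge0//; over.
  by rewrite integral_oneDsqrV ltry.
have f_f : {ae leb, forall x, setT x -> f_ ^~ x @ \oo --> (EFin \o f) x}.
  apply: aeW => x _; apply: cvg_near_cst.
  have [N _ HN] : \forall n \near \oo, x \in `[- n.+1%:R, n.+1%:R].
    near=> n; rewrite in_itv/= -ler_norml.
    apply: (@le_trans _ _ n%:R); last by rewrite ler_nat.
    by near: n; exact: nbhs_infty_ger.
  by exists N => // n /HN xn; rewrite /f_ patchE mem_set.
have f_g : {ae leb, forall x n, setT x ->
    (`|f_ n x| <= (C * (1 + x ^+ 2)^-1)%:E)%E}.
  apply: aeW => x n _; rewrite /f_ patchE; case: ifPn => _.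
    by rewrite lee_fin.
  by rewrite abse0 lee_fin (le_trans _ (FC x)).
have mEf : measurable_fun setT (EFin \o f) by exact/measurable_EFinP.
have [_ _ cvgf] := @dominated_convergence _ (measurableTypeR R) R leb setT
  measurableT f_ (EFin \o f) _ mf_ mEf f_f ig f_g.
have : (fun n => (\int[leb]_x f_ n x)%E) @ \oo --> (0%:E : \bar R).
  rewrite (_ : (fun n => _) = fun n => (F n.+1%:R - F (- n.+1%:R))%:E); last exact/funext.
  apply: cvg_EFin; first by near=> n.
  apply/cvgr0Pnorm_le => e e0.
  have e'0 : 0 < e / (2 * `|C| + 1) by rewrite divr_gt0// ltr_wpDl// mulr_ge0.
  near=> n.
  have n1 : n.+1%:R^-1 < e / (2 * `|C| + 1).
    by near: n; exact: (near_infty_natSinv_lt (PosNum e'0)).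
  have b m : (m = n.+1%:R \/ m = - n.+1%:R) -> `|F m| <= `|C| * n.+1%:R^-1.
    move=> mn; apply: (le_trans (FC m)).
    have m2 : m ^+ 2 = n.+1%:R ^+ 2 by case: mn => ->; rewrite ?sqrrN.
    apply: (@le_trans _ _ (`|C| * (1 + m ^+ 2)^-1)).
      by rewrite ler_wpM2r ?ler_norm// invr_ge0 addr_ge0// sqr_ge0.
    rewrite ler_wpM2l// lef_pV2 ?posrE//; last by rewrite ltr_pwDl// sqr_ge0.
    rewrite m2 (@le_trans _ _ (n.+1%:R ^+ 2))// ?lerDr//.
    by rewrite expr2 ler_peMl// ler1n.
  apply: (le_trans (ler_normB _ _)).
  apply: (@le_trans _ _ (2 * `|C| * n.+1%:R^-1)).
    have h1 := b _ (or_introl erefl); have h2 := b _ (or_intror erefl).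
    by rewrite -mulrA mulr2n mulrDl mul1r lerD.
  rewrite ltr_pdivlMr in n1; last by rewrite ltr_wpDl// mulr_ge0.
  by apply: le_trans (ltW n1); rewrite mulrC ler_wpM2l// lerDl.
move=> c0; exact: (cvg_unique _ cvgf c0).
Unshelve. all: by end_near. Qed.

Lemma integral_cons_swap n (f : tpl n.+1 -> \bar R) :
  (lebesgue_tuple R n.+1).-integrable setT f ->
  (\int[lebesgue_tuple R n.+1]_t f t =
   \int[lebesgue_tuple R n]_s \int[leb]_x f (cons_pair (x, s)))%E.
Proof.
move=> fi; rewrite integral_cons//.
have mf := measurable_int _ fi.
have mfc : measurable_fun setT (f \o @cons_pair R n).
  by apply: measurableT_comp => //; exact: measurable_cons_pair.
apply: (Fubini (f := f \o @cons_pair R n)).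
apply/integrable12ltyP => //.
rewrite -(@ge0_integral_cons _ n (fun t => `|f t|)%E)//.
  by case/integrableP: fi.
exact: measurableT_comp.
Qed.

(** The row x :: v, written so that it is visibly continuous, and affine in each
    of its arguments. *)
Definition consv n (x : R) (v : 'rV[R]_n) : 'rV[R]_n.+1 :=
  x *: delta_mx 0 ord0 + \sum_i v 0 i *: delta_mx 0 (lift ord0 i).

Lemma consv0 n x (v : 'rV[R]_n) : consv x v 0 ord0 = x.
Proof.
rewrite !mxE !eqxx mulr1 summxE big1 ?addr0// => i _.
by rewrite !mxE/= mulr0.
Qed.

Lemma consvS n x (v : 'rV[R]_n) i : consv x v 0 (lift ord0 i) = v 0 i.
Proof.
rewrite !mxE/= mulr0 add0r summxE (bigD1 i)//= !mxE !eqxx mulr1 big1 ?addr0//.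
by move=> j ji; rewrite !mxE/= (inj_eq lift_inj) eq_sym (negbTE ji) mulr0.
Qed.

Lemma rowt_cons n x (s : tpl n) : rowt (cons_pair (x, s)) = consv x (rowt s).
Proof.
apply/rowP => i; rewrite [LHS]mxE.
have [j ->|->] := unliftP ord0 i; last by rewrite consv0 tnth_cons0.
by rewrite consvS tnth_consS mxE.
Qed.

Lemma wgt_consv n x (v : 'rV[R]_n) :
  wgt (consv x v) = (1 + x ^+ 2)^-1 * wgt v.
Proof.
rewrite /wgt big_ord_recl consv0; congr (_ * _).
by apply: eq_bigr => i _; rewrite consvS.
Qed.

Lemma continuous_consv n (x : R) : continuous (@consv n x).
Proof.
have -> : @consv n x = cst (x *: delta_mx 0 ord0) +
    \sum_i (fun v : 'rV[R]_n => v 0 i *: (delta_mx 0 (lift ord0 i) : 'rV[R]_n.+1)).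
  by apply/funext => w; rewrite /consv fctE fct_sumE.
move=> v; apply: (@continuousD _ _ _ _ _ v); first exact: cst_continuous.
elim/big_ind: _ => [|f g cf cg|i _]; first exact: cst_continuous.
  exact: (@continuousD _ _ _ _ _ v).
by apply: (@continuousZr_tmp _ _ _ _ _ v); exact: coord_continuous.
Qed.

Lemma continuous_consv1 n (v : 'rV[R]_n) : continuous (fun x => consv x v).
Proof.
have -> : (fun x => consv x v) = (fun x => x *: (delta_mx 0 ord0 : 'rV[R]_n.+1)) +
    cst (\sum_i v 0 i *: (delta_mx 0 (lift ord0 i))) by [].
move=> x; apply: (@continuousD _ _ _ _ _ x); last exact: cst_continuous.
by apply: (@continuousZr_tmp _ _ _ _ _ x); exact: cvg_id.
Qed.

Lemma wdom_consv n x (f : 'rV[R]_n.+1 -> R) : wdom f ->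
  wdom (fun v => f (consv x v)).
Proof.
move=> [cf [C fC]]; split.
  by move=> v; apply: continuous_comp; [exact: continuous_consv|exact: cf].
by exists (C * (1 + x ^+ 2)^-1) => v; rewrite -mulrA -wgt_consv.
Qed.

(** Induction on the dimension peels off the first coordinate by iterated
    integration; when the derivative is in that coordinate, it is integrated
    first and the result is the one-variable statement. *)
Lemma integral_derive_eq0 n (j : 'I_n) (f f' : 'rV[R]_n -> R) :
  wdom f -> wdom f' ->
  (forall x, is_derive x (delta_mx 0 j) f (f' x)) ->
  (\int[lebesgue_tuple R n]_t (f' (rowt t))%:E = 0)%E.
Proof.
elim: n j f f' => [[]//|n IH] j f f' wf wf' df.
have [k jk|j0] := unliftP ord0 j.
  rewrite integral_cons; last exact: wdom_integrable.
  rewrite -[RHS](integral0 leb setT).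
  apply: eq_integral => x _.
  under eq_integral do rewrite rowt_cons.
  apply: (IH k (fun v => f (consv x v)) (fun v => f' (consv x v))).
  - exact: wdom_consv.
  - exact: wdom_consv.
  - move=> v; apply: (is_derive_affine (phi := consv x) (w := delta_mx 0 j)).
      move=> h; apply/rowP => i; rewrite [RHS]mxE [X in _ = X + _]mxE.
      rewrite [X in _ = _ * X + _]mxE jk.
      have [l ->|->] := unliftP ord0 i; last by rewrite !consv0/= mulr0 add0r.
      by rewrite !consvS !mxE (inj_eq lift_inj).
rewrite integral_cons_swap; last exact: wdom_integrable.
rewrite -[RHS](integral0 (lebesgue_tuple R n) setT).
apply: eq_integral => s _.
under eq_integral do rewrite rowt_cons.
have [[cf [C fC]] [cf' [C' fC']]] := (wf, wf').
set v := rowt s.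
apply: (@integral_derive1_eq0 (fun x => f (consv x v)) (fun x => f' (consv x v))
  (Num.max C C' * wgt v)) => x.
- apply: (is_derive_affine (phi := fun x => consv x v) (w := delta_mx 0 j)).
    by move=> h; rewrite j0 /consv scalerDl addrA [h *: 1]mulr1.
- by apply: continuous_comp; [exact: continuous_consv1|exact: cf'].
- apply: (le_trans (fC _)); rewrite wgt_consv -mulrA [X in _ <= _ * X]mulrC.
  by rewrite ler_wpM2r ?le_max ?lexx// -wgt_consv ltW// wgt_gt0.
- apply: (le_trans (fC' _)); rewrite wgt_consv -mulrA [X in _ <= _ * X]mulrC.
  by rewrite ler_wpM2r ?le_max ?lexx ?orbT// -wgt_consv ltW// wgt_gt0.
Qed.

End integral_derivative.

(** * Rapidly decreasing functions *)

Section rapid.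
Context {R : realType} {n : nat}.
Implicit Types (f g p : 'rV[R]_n -> R) (x xi : 'rV[R]_n).
Local Notation rV := ('rV[R]_n).

Lemma dotC x xi : dot x xi = dot xi x.
Proof. by apply: eq_bigr => i _; rewrite mulrC. Qed.

Lemma dotDl x y xi : dot (x + y) xi = dot x xi + dot y xi.
Proof.
by rewrite /dot -big_split/=; apply: eq_bigr => i _; rewrite !mxE mulrDl.
Qed.

Lemma dotZl (h : R) x xi : dot (h *: x) xi = h * dot x xi.
Proof.
by rewrite /dot mulr_sumr; apply: eq_bigr => i _; rewrite !mxE mulrA.
Qed.

Lemma dotNl x xi : dot (- x) xi = - dot x xi.
Proof. by rewrite -scaleN1r dotZl mulN1r. Qed.

Lemma dot_delta j xi : dot (delta_mx 0 j) xi = xi 0 j.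
Proof.
rewrite /dot (bigD1 j)//= mxE !eqxx mul1r big1 ?addr0// => i ij.
by rewrite mxE eqxx (negbTE ij) mul0r.
Qed.

Lemma continuous_coord (i : 'I_n) : continuous (fun x : rV => x 0 i).
Proof. by move=> x; exact: coord_continuous. Qed.

Lemma continuous_sum (I : Type) (T : topologicalType) (r : seq I) (f : I -> T -> R) :
  (forall i, continuous (f i)) -> continuous (fun t => \sum_(i <- r) f i t).
Proof.
move=> cf t; elim: r => [|i r IH].
  rewrite (_ : (fun t => _) = cst 0); first exact: cst_continuous.
  by apply/funext => y; rewrite big_nil.
rewrite (_ : (fun t => _) = (fun t => f i t) \+ (fun t => \sum_(i <- r) f i t)).
  by apply: continuousD => //; exact: cf.
by apply/funext => y; rewrite big_cons.
Qed.

Lemma continuous_prod (I : Type) (T : topologicalType) (r : seq I) (f : I -> T -> R) :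
  (forall i, continuous (f i)) -> continuous (fun t => \prod_(i <- r) f i t).
Proof.
move=> cf t; elim: r => [|i r IH].
  rewrite (_ : (fun t => _) = cst 1); first exact: cst_continuous.
  by apply/funext => y; rewrite big_nil.
rewrite (_ : (fun t => _) = (fun t => f i t) \* (fun t => \prod_(i <- r) f i t)).
  by apply: continuousM => //; exact: cf.
by apply/funext => y; rewrite big_cons.
Qed.

Lemma continuous_mul (T : topologicalType) (f g : T -> R) : continuous f ->
  continuous g -> continuous (fun t => f t * g t).
Proof. by move=> cf cg t; apply: continuousM; [exact: cf|exact: cg]. Qed.

Lemma continuous_add (T : topologicalType) (f g : T -> R) : continuous f ->
  continuous g -> continuous (fun t => f t + g t).
Proof. by move=> cf cg t; apply: continuousD; [exact: cf|exact: cg]. Qed.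

Lemma continuous_cst (T : topologicalType) (k : R) : continuous (fun _ : T => k).
Proof. by move=> t; exact: cst_continuous. Qed.

Lemma continuous_inv (T : topologicalType) (f : T -> R) :
  (forall t, f t != 0) -> continuous f -> continuous (fun t => (f t)^-1).
Proof. by move=> f0 cf t; apply: cvgV; [exact: f0|exact: cf]. Qed.

Lemma continuous_exp (T : topologicalType) (f : T -> R) M :
  continuous f -> continuous (fun t => f t ^+ M).
Proof.
move=> cf; elim: M => [|M IH]; first exact: continuous_cst.
rewrite (_ : (fun t => _) = fun t => f t * f t ^+ M); first exact: continuous_mul.
by apply/funext => t; rewrite exprS.
Qed.

Lemma continuous_norm (T : topologicalType) (f : T -> R) :
  continuous f -> continuous (fun t => `|f t|).
Proof.
by move=> cf t; apply: continuous_comp; [exact: cf|exact: norm_continuous].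
Qed.

Lemma continuous_dotl xi : continuous (fun x : rV => dot x xi).
Proof.
apply: continuous_sum => i; apply: continuous_mul; first exact: continuous_coord.
exact: continuous_cst.
Qed.

Lemma continuous_dotr x : continuous (fun xi : rV => dot x xi).
Proof.
rewrite (_ : (fun xi => _) = (fun xi => dot xi x)); first exact: continuous_dotl.
by apply/funext => xi; exact: dotC.
Qed.

Definition rapid f := continuous f /\
  forall M : nat, exists C, forall x, `|f x| <= C * wgt x ^+ M.

(** Growth at most polynomial, a negative power of wgt being a polynomial. *)
Definition moderate p := continuous p /\
  exists K C, forall x, `|p x| * wgt x ^+ K <= C.

Lemma rapid_wdom f : rapid f -> wdom f.
Proof.
by move=> [cf /(_ 1%N)[C fC]]; split=> //; exists C => x; rewrite -[wgt x]expr1.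
Qed.

Lemma rapid_add f g : rapid f -> rapid g -> rapid (fun x => f x + g x).
Proof.
move=> [cf fC] [cg gC]; split; first exact: continuous_add.
move=> M; have [C HC] := fC M; have [C' HC'] := gC M; exists (C + C') => x.
by rewrite mulrDl (le_trans (ler_normD _ _))// lerD.
Qed.

Lemma moderate_rapid p f : moderate p -> rapid f -> rapid (fun x => p x * f x).
Proof.
move=> [cp [K [C pC]]] [cf fC]; split; first exact: continuous_mul.
move=> M; have [C' HC'] := fC (K + M)%N; exists (C * C') => x.
rewrite normrM; apply: (@le_trans _ _ (`|p x| * (C' * wgt x ^+ (K + M)))).
  by rewrite ler_wpM2l.
have w0 : 0 < wgt x ^+ M by rewrite exprn_gt0// wgt_gt0.
have C'0 : 0 <= C'.
  have := le_trans (normr_ge0 _) (HC' x).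
  by rewrite pmulr_lge0// exprn_gt0// wgt_gt0.
rewrite exprD [leLHS](_ : _ = (`|p x| * wgt x ^+ K) * (C' * wgt x ^+ M)); last by ring.
by rewrite -[leRHS]mulrA ler_wpM2r// mulr_ge0// ltW.
Qed.

Lemma wgt_le1 x : wgt x <= 1.
Proof.
rewrite /wgt; apply: prodr_ile1 => i _; rewrite invr_ge0 addr_ge0 ?sqr_ge0//=.
by rewrite invf_le1 ?lerDl ?sqr_ge0// ltr_pwDl// sqr_ge0.
Qed.

Lemma moderate_bounded p C : continuous p -> (forall x, `|p x| <= C) -> moderate p.
Proof.
by move=> cp pC; split=> //; exists 0%N, C => x; rewrite expr0 mulr1.
Qed.

Lemma moderate_cst (k : R) : moderate (fun=> k).
Proof. by apply: (@moderate_bounded _ `|k|) => //; exact: continuous_cst. Qed.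

Lemma moderate_mul p q : moderate p -> moderate q ->
  moderate (fun x => p x * q x).
Proof.
move=> [cp [K [C pC]]] [cq [L [C' qC]]]; split; first exact: continuous_mul.
exists (K + L)%N, (C * C') => x.
rewrite normrM exprD mulrACA ler_pM//; rewrite mulr_ge0// exprn_ge0// ltW//;
  exact: wgt_gt0.
Qed.

Lemma moderate_add p q : moderate p -> moderate q ->
  moderate (fun x => p x + q x).
Proof.
move=> [cp [K [C pC]]] [cq [L [C' qC]]]; split; first exact: continuous_add.
exists (K + L)%N, (C + C') => x.
have w0 M : 0 <= wgt x ^+ M by rewrite exprn_ge0// ltW// wgt_gt0.
have w1 M : wgt x ^+ M <= 1 by rewrite exprn_ile1 ?wgt_le1// ltW// wgt_gt0.
apply: (@le_trans _ _ ((`|p x| + `|q x|) * wgt x ^+ (K + L))).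
  by rewrite ler_wpM2r// ler_normD.
rewrite mulrDl exprD lerD//; apply: le_trans (pC x) || apply: le_trans (qC x).
  by rewrite mulrA ler_piMr// mulr_ge0.
by rewrite [wgt x ^+ K * _]mulrC mulrA ler_piMr// mulr_ge0.
Qed.

Lemma moderate_coord i : moderate (fun x => x 0 i).
Proof.
split; first exact: continuous_coord.
exists 1%N, 1 => x; rewrite expr1 /wgt (bigD1 i)//= mulrA.
have x0 : 0 < 1 + x 0 i ^+ 2 by rewrite ltr_pwDl// sqr_ge0.
rewrite mulr_ile1//.
- by rewrite mulr_ge0// invr_ge0 ltW.
- by apply: prodr_ge0 => j _; rewrite invr_ge0 addr_ge0// sqr_ge0.
- rewrite ler_pdivrMr// mul1r -[x 0 i ^+ 2]real_normK ?num_real//.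
  have := sqr_ge0 (`|x 0 i| - 1); nra.
- apply: prodr_ile1 => j _; rewrite invr_ge0 addr_ge0 ?sqr_ge0//=.
  by rewrite invf_le1 ?lerDl ?sqr_ge0// ltr_pwDl// sqr_ge0.
Qed.

Lemma moderate_sum (I : Type) (r : seq I) (p : I -> rV -> R) :
  (forall i, moderate (p i)) -> moderate (fun x => \sum_(i <- r) p i x).
Proof.
move=> mp; elim: r => [|i r IH].
  rewrite (_ : (fun x => _) = fun=> 0); first exact: moderate_cst.
  by apply/funext => y; rewrite big_nil.
rewrite (_ : (fun x => _) = fun x => p i x + \sum_(i <- r) p i x).
  exact: moderate_add.
by apply/funext => y; rewrite big_cons.
Qed.

Lemma moderate_prod (I : Type) (r : seq I) (p : I -> rV -> R) :
  (forall i, moderate (p i)) -> moderate (fun x => \prod_(i <- r) p i x).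
Proof.
move=> mp; elim: r => [|i r IH].
  rewrite (_ : (fun x => _) = fun=> 1); first exact: moderate_cst.
  by apply/funext => y; rewrite big_nil.
rewrite (_ : (fun x => _) = fun x => p i x * \prod_(i <- r) p i x).
  exact: moderate_mul.
by apply/funext => y; rewrite big_cons.
Qed.

Lemma moderate_dot v : moderate (dot v).
Proof.
apply: (@moderate_sum _ _ (fun i x => v 0 i * x 0 i)) => i.
by apply: moderate_mul; [exact: moderate_cst|exact: moderate_coord].
Qed.

Lemma rapid_mod f p : rapid f -> moderate p -> rapid (fun x => f x * p x).
Proof.
move=> rf mp; rewrite (_ : (fun x => _) = fun x => p x * f x).
  exact: moderate_rapid.
by apply/funext => x; rewrite mulrC.
Qed.

Lemma continuous_wgt : continuous (@wgt R n).
Proof.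
apply: continuous_prod => i; apply: continuous_inv => [x|].
  by rewrite gt_eqF// ltr_pwDl// sqr_ge0.
apply: (continuous_add (f := fun=> 1)); first exact: continuous_cst.
by apply: continuous_exp; exact: continuous_coord.
Qed.

Lemma compact_rapid f (K : set rV) : continuous f -> compact K ->
  (forall x, ~ K x -> f x = 0) -> rapid f.
Proof.
move=> cf cK f0; split=> // M.
have [[x0 Kx0]|K0] := pselect (K !=set0); last first.
  exists 0 => x; rewrite mul0r f0 ?normr0// => Kx; apply: K0; by exists x.
pose h x := `|f x| / wgt x ^+ M.
have ch : {within K, continuous h}.
  apply: continuous_subspaceT; apply: continuous_mul.
    exact: continuous_norm.
  apply: continuous_inv => [x|]; first by rewrite gt_eqF// exprn_gt0// wgt_gt0.
  by apply: continuous_exp; exact: continuous_wgt.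
have [c Kc hc] := @EVT_max_rV R n h K (ex_intro _ x0 Kx0) cK ch.
exists (h c) => x.
rewrite -ler_pdivrMr ?exprn_gt0 ?wgt_gt0//.
have [Kx|nKx] := pselect (K x).
  by apply: hc; exact/mem_set.
by rewrite f0// normr0 mul0r /h divr_ge0// exprn_ge0// ltW// wgt_gt0.
Qed.

End rapid.

(** * Cosine transforms *)

Lemma is_derive_scale_dir (R : realType) (f : R -> R) (x w l : R) :
  is_derive x 1 f l -> is_derive x w f (w * l).
Proof.
move=> [df <-]; have df' : differentiable f x by apply/derivable1_diffP.
apply: DeriveDef; first exact: diff_derivable.
by rewrite deriveE// diff1E//= derive1E.
Qed.

Section cosine_transform.
Context {R : realType} {n : nat}.
Implicit Types (f g u : 'rV[R]_n -> R) (x xi v : 'rV[R]_n) (a k : R).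
Local Notation rV := ('rV[R]_n).
Local Notation mu := (lebesgue_tuple R n).

Let linear_dot xi : linear (fun x : rV => dot x xi).
Proof. by move=> h x y; rewrite dotDl dotZl. Qed.

Lemma rsmooth_dot xi (D : set rV) : open D -> rsmooth_on D (fun x => dot x xi).
Proof.
move=> oD; apply: (rsmooth_linear oD (L := mklin (linear_dot xi))).
exact: continuous_dotl.
Qed.

Lemma is_derive_wave xi a x v : is_derive x v (fun x => cos (dot x xi + a))
  (dot v xi * cos (dot x xi + (a + pi / 2))).
Proof.
apply: (is_derive_affine (phi := fun x => dot x xi + a) (w := dot v xi)).
  by move=> h; rewrite dotDl dotZl addrA.
rewrite addrA cosDpihalf; apply: is_derive_scale_dir.
Qed.

Lemma differentiable_wave xi a x : differentiable (fun x => cos (dot x xi + a)) x.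
Proof.
apply: (differentiable_comp (f := fun x => dot x xi + a) (g := cos)).
  apply: (differentiableD (f := fun x => dot x xi)) => //.
  exact: (@rsmooth_dot xi setT openT [::] x I).
by apply/derivable1_diffP; exact: derivable_cos.
Qed.

Lemma iter_derive_wave xi a k (vs : seq rV) :
  iter_derive vs (fun x => k * cos (dot x xi + a)) =
  (fun x => (\prod_(v <- vs) dot v xi) * k *
    cos (dot x xi + (a + (size vs)%:R * (pi / 2)))).
Proof.
elim/last_ind: vs k a => [|vs v IH] k a.
  by apply/funext => x; rewrite big_nil mul1r mul0r addr0.
rewrite iter_derive_rcons.
have -> : 'D_v (fun x => k * cos (dot x xi + a)) =
    fun x => (dot v xi * k) * cos (dot x xi + (a + pi / 2)).
  apply/funext => x; have [dw Dw] := is_derive_wave xi a x v.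
  rewrite (deriveZ _ dw) Dw -[_ *: _]/(k * _); ring.
rewrite IH; apply/funext => x; rewrite -cats1 big_cat big_seq1 size_cat/= addn1.
congr (_ * cos _); first by rewrite -mulrA.
by rewrite -[(size vs).+1]addn1 natrD; ring.
Qed.

(** The phase a makes a single real integral serve for the real and imaginary
    parts of Fourier transforms, and derivatives only shift it by pi / 2. *)
Definition ctrans a g x : R := \int[mu]_t (cos (dot x (rowt t) + a) * g (rowt t)).

Let F a g x (t : n.-tuple (measurableTypeR R)) :=
  cos (dot x (rowt t) + a) * g (rowt t).

Let FE a g t : (F a g)^~ t = fun x => g (rowt t) * cos (dot x (rowt t) + a).
Proof. by apply/funext => x; rewrite /F mulrC. Qed.

Lemma continuous_wave x a : continuous (fun xi : rV => cos (dot x xi + a)).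
Proof.
move=> xi; apply: continuous_comp; last exact: continuous_cos.
apply: (continuous_add (f := dot x)); first exact: continuous_dotr.
exact: continuous_cst.
Qed.

Lemma moderate_wave x a : moderate (fun xi : rV => cos (dot x xi + a)).
Proof.
apply: (@moderate_bounded _ _ _ 1); first exact: continuous_wave.
by move=> xi; rewrite ler_norml cos_geN1 cos_le1.
Qed.

Let rsmooth_F a g t : rsmooth_on setT ((F a g)^~ t).
Proof.
move=> vs x _; rewrite FE iter_derive_wave.
exact/differentiableZ/differentiable_wave.
Qed.

Let dominated_F a g : rapid g -> dominated mu (F a g).
Proof.
move=> rg vs.
pose h (xi : rV) := g xi * \prod_(v <- vs) dot v xi.
have rh : rapid h.
  apply: rapid_mod => //; apply: moderate_prod => v; exact: moderate_dot.
have FvsE x t : iter_derive vs ((F a g)^~ t) x =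
    h (rowt t) * cos (dot x (rowt t) + (a + (size vs)%:R * (pi / 2))).
  by rewrite FE iter_derive_wave [_ * g _]mulrC.
split=> [x|x0].
  rewrite (_ : (fun t => _) = (fun t => h (rowt t) *
      cos (dot x (rowt t) + (a + (size vs)%:R * (pi / 2)))));
    last by apply/funext => t; rewrite FvsE.
  apply: (@measurable_rowt _ _ (fun xi => h xi *
      cos (dot x xi + (a + (size vs)%:R * (pi / 2))))).
  by apply: continuous_mul; [exact: rh.1|exact: continuous_wave].
exists 1 => //; exists (fun t => `|h (rowt t)|).
  have := wdom_integrable (rapid_wdom rh); exact: integrable_norm.
move=> x t _; rewrite FvsE normrM ler_piMr//.
by rewrite ler_norml cos_geN1 cos_le1.
Qed.

Lemma rsmooth_ctrans a g : rapid g -> rsmooth_on setT (ctrans a g).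
Proof.
move=> rg; apply: (rsmooth_Rintegral (coords_rV n) (F := F a g)) => [t|].
  exact: rsmooth_F.
exact: dominated_F.
Qed.

Lemma derive_ctrans a g x v : rapid g ->
  'D_v (ctrans a g) x = ctrans (a + pi / 2) (fun xi => dot v xi * g xi) x.
Proof.
move=> rg; have [_ ->] := differentiable_Rintegral (coords_rV n) x
  (fun t => @rsmooth_F a g t) (dominated_F a rg).
apply: eq_Rintegral => t _; rewrite FE.
have := iter_derive_wave (rowt t) a (g (rowt t)) [:: v].
by move=> /(congr1 (@^~ x))/=; rewrite big_seq1 mul1r => ->; ring.
Qed.

Lemma ctrans_integrable a g x : rapid g ->
  mu.-integrable setT (fun t => (cos (dot x (rowt t) + a) * g (rowt t))%:E).
Proof.
move=> rg; apply: (@wdom_integrable _ _ (fun xi => cos (dot x xi + a) * g xi)).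
by apply: rapid_wdom; apply: moderate_rapid => //; exact: moderate_wave.
Qed.

Lemma ctransD a f g x : rapid f -> rapid g ->
  ctrans a (fun xi => f xi + g xi) x = ctrans a f x + ctrans a g x.
Proof.
move=> rf rg; rewrite -RintegralD//; [|exact: ctrans_integrable..].
by apply: eq_Rintegral => t _; rewrite mulrDr.
Qed.

Lemma ctransZ a k g x : rapid g ->
  ctrans a (fun xi => k * g xi) x = k * ctrans a g x.
Proof.
move=> rg; rewrite -RintegralZl//; last exact: ctrans_integrable.
by apply: eq_Rintegral => t _; rewrite mulrCA.
Qed.

Lemma ctransN a g x : ctrans (a - pi) g x = ctrans a (fun xi => - g xi) x.
Proof.
apply: eq_Rintegral => t _; rewrite mulrN -mulNr; congr (_ * _).
by rewrite -[dot x _ + a](subrK pi) cosDpi opprK addrA.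
Qed.

Lemma ctrans_le a g : rapid g -> exists C, forall x, `|ctrans a g x| <= C.
Proof.
move=> rg; exists (\int[mu]_t `|g (rowt t)|) => x.
apply: Rint_le.
- apply: (@measurable_rowt _ _ (fun xi => cos (dot x xi + a) * g xi)).
  by apply: continuous_mul; [exact: continuous_wave|exact: rg.1].
- have := wdom_integrable (rapid_wdom rg); exact: integrable_norm.
- by move=> t; rewrite normrM ler_piMl// ler_norml cos_geN1 cos_le1.
Qed.

Definition rtest u := rsmooth_on setT u /\
  exists2 K : set rV, compact K & forall x, ~ K x -> u x = 0.

Lemma rtest_rapid u : rtest u -> rapid u.
Proof.
move=> [su [K cK uK]]; apply: compact_rapid cK uK => x.
exact: (rsmooth_continuous su).
Qed.

Lemma rtest_derive u v : rtest u -> rtest ('D_v u).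
Proof.
move=> [su [K cK uK]]; split; first exact: rsmooth_derive.
exists K => // x nKx.
have oK : open (~` K) by apply: closed_openC; exact: compact_closed.
have := @eq_on_derive _ _ (~` K) oK u (fun=> 0) v.
move=> /(_ _ x); rewrite derive_cst; apply; last exact/mem_set.
by move=> y /set_mem/uK.
Qed.

Lemma rtest_mul u f : rtest u -> rsmooth_on setT f ->
  rtest (fun x => f x * u x).
Proof.
move=> [su [K cK uK]] sf; split; first exact: (rsmooth_mul openT).
by exists K => // x /uK ->; rewrite mulr0.
Qed.

Lemma rtest_add u f : rtest u -> rtest f -> rtest (fun x => f x + u x).
Proof.
move=> [su [K cK uK]] [sf [L cL fL]]; split; first exact: (rsmooth_add openT).
exists (K `|` L); first exact: compactU.
by move=> x /not_orP[/uK -> /fL ->]; rewrite addr0.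
Qed.

(** The y_j-derivative of cos (y.xi + a) u(y) has integral 0. *)
Lemma ctrans_derive a u j xi : rtest u ->
  xi 0 j * ctrans (a + pi / 2) u xi = - ctrans a ('D_(delta_mx 0 j) u) xi.
Proof.
move=> tu; have ru := rtest_rapid tu.
have rdu := rtest_rapid (rtest_derive (delta_mx 0 j) tu).
pose f y := cos (dot y xi + a) * u y.
pose f' y := xi 0 j * (cos (dot y xi + (a + pi / 2)) * u y) +
   cos (dot y xi + a) * 'D_(delta_mx 0 j) u y.
have dotE c : (fun y => cos (dot xi y + c)) = (fun y => cos (dot y xi + c)).
  by apply/funext => y; rewrite dotC.
have mw c : moderate (fun y => cos (dot y xi + c)).
  by rewrite -dotE; exact: moderate_wave.
have rf : rapid f by exact: moderate_rapid.
have rf' : rapid f'.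
  apply: rapid_add; last exact: moderate_rapid.
  by apply: moderate_rapid; [exact: moderate_cst|exact: moderate_rapid].
have df y : is_derive y (delta_mx 0 j) f (f' y).
  have du : is_derive y (delta_mx 0 j) u ('D_(delta_mx 0 j) u y).
    by apply: derivableP; apply: diff_derivable; exact: (tu.1 [::]).
  apply: is_derive_eq (is_deriveM (is_derive_wave xi a y (delta_mx 0 j)) du) _.
  rewrite dot_delta /f' -![_ *: _]/(_ * _); ring.
have : \int[mu]_t f' (rowt t) = 0.
  by rewrite /Rintegral (integral_derive_eq0 (rapid_wdom rf) (rapid_wdom rf') df).
have i1 := ctrans_integrable (a + pi / 2) xi ru.
have i2 := ctrans_integrable a xi rdu.
have -> : \int[mu]_t f' (rowt t) = xi 0 j * ctrans (a + pi / 2) u xi +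
    ctrans a ('D_(delta_mx 0 j) u) xi.
  rewrite -(RintegralZl _ measurableT i1) -RintegralD//; last exact: (rintegrableZ _ i1).
  by apply: eq_Rintegral => t _; rewrite /f' !(dotC (rowt t)).
by move/eqP; rewrite addr_eq0 => /eqP.
Qed.

(** Integrating by parts twice shifts the phase by pi, whence the minus sign. *)
Lemma ctrans_oneD a u j xi : rtest u ->
  (1 + xi 0 j ^+ 2) * ctrans a u xi =
  ctrans a (fun y => u y - 'D_(delta_mx 0 j) ('D_(delta_mx 0 j) u) y) xi.
Proof.
move=> tu; have ru := rtest_rapid tu.
have tdu := rtest_derive (delta_mx 0 j) tu.
have tddu := rtest_derive (delta_mx 0 j) tdu.
have E : (fun y => u y - 'D_(delta_mx 0 j) ('D_(delta_mx 0 j) u) y) =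
    (fun y => u y + -1 * 'D_(delta_mx 0 j) ('D_(delta_mx 0 j) u) y).
  by apply/funext => y; rewrite mulN1r.
rewrite E ctransD//; last first.
  by apply: moderate_rapid; [exact: moderate_cst|exact: rtest_rapid].
rewrite ctransZ; last exact: rtest_rapid.
rewrite mulrDl mul1r; congr (_ + _).
rewrite -[a in LHS](subrK (pi / 2)) expr2 -mulrA ctrans_derive// mulrN.
rewrite -[a - pi / 2](subrK (pi / 2)) ctrans_derive// opprK.
rewrite -addrA -opprD [pi / 2 + pi / 2](_ : _ = pi); last by field.
rewrite ctransN -[RHS]ctransZ; last exact: rtest_rapid.
by congr (ctrans _ _ _); apply/funext => y; rewrite mulN1r.
Qed.

(** Integrating by parts, every weight in the frequency variable is traded for
    derivatives of the test function. *)
Lemma rapid_ctrans a u : rtest u -> rapid (ctrans a u).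
Proof.
move=> tu; have ru := rtest_rapid tu; split.
  by move=> x; apply: (rsmooth_continuous (rsmooth_ctrans a ru)).
move=> M.
(* One factor 1 + xi_j^2 costs two derivatives of the test function. *)
have key (js : seq 'I_n) : forall u, rtest u -> exists w, rtest w /\
    forall xi, (\prod_(j <- js) (1 + xi 0 j ^+ 2)) * ctrans a u xi = ctrans a w xi.
  elim: js => [|j js IH] w tw.
    by exists w; split=> // xi; rewrite big_nil mul1r.
  have [|w' [tw' Hw']] := IH (fun y => w y - 'D_(delta_mx 0 j) ('D_(delta_mx 0 j) w) y).
    rewrite (_ : (fun y => _) = fun y => w y +
        -1 * 'D_(delta_mx 0 j) ('D_(delta_mx 0 j) w) y); last first.
      by apply/funext => y; rewrite mulN1r.
    apply: rtest_add => //; apply: rtest_mul; last exact: (rsmooth_cst openT).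
    exact/rtest_derive/rtest_derive.
  exists w'; split=> // xi.
  by rewrite big_cons [_ * (\prod_(_ <- _) _)]mulrC -mulrA ctrans_oneD.
have [w [tw uw]] : exists w, rtest w /\
    forall xi, ctrans a u xi = wgt xi ^+ M * ctrans a w xi.
  elim: M => [|M [w [tw uw]]].
    by exists u; split=> // xi; rewrite expr0 mul1r.
  have [w' [tw' ww']] := key (index_enum _) w tw.
  exists w'; split=> // xi; rewrite uw exprS -ww'.
  have e : wgt xi * \prod_i (1 + xi 0 i ^+ 2) = 1.
    rewrite /wgt prodfV mulVf// gt_eqF// prodr_gt0// => i _.
    by rewrite ltr_pwDl// sqr_ge0.
  by rewrite mulrACA e mul1r.
have [C HC] := ctrans_le a (rtest_rapid tw); exists C => xi.
have w0 : 0 <= wgt xi ^+ M by rewrite exprn_ge0// ltW// wgt_gt0.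
by rewrite uw normrM mulrC (ger0_norm w0) ler_wpM2r.
Qed.

End cosine_transform.

(** * A smooth cut-off *)

Section cutoff.
Context {R : realType}.
Implicit Types (x s t : R).

Lemma rsmooth_inv (V : normedModType R) (D : set V) (f : V -> R) : open D ->
  (forall y, D y -> f y != 0) -> rsmooth_on D f ->
  rsmooth_on D (fun y => (f y)^-1).
Proof.
move=> oD f0 sf; apply/rsmooth_Cn; elim=> [|k IH].
  split=> // x Dx; apply: differentiableV; last exact: f0.
  exact: (sf [::]).
apply: (CnS oD (g := fun v y => -1 * ((f y)^-1 * (f y)^-1) * 'D_v f y))
  => [x Dx|v x Dx|v].
- by apply: differentiableV; [exact: (sf [::])|exact: f0].
- rewrite deriveV; [|exact: f0|by apply: diff_derivable; exact: (sf [::])].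
  by rewrite -[_ *: _]/(_ * _) expr2 invfM mulN1r.
- apply: Cn_mul => //; last by move: k {IH}; exact/rsmooth_Cn/rsmooth_derive.
  apply: Cn_mul => //; first exact: Cn_cst.
  exact: Cn_mul.
Qed.

(** The function exp(-1/x) extended by 0 is smooth because the family obtained by
    allowing the factors x^-k is closed under differentiation. *)
Definition flat (k : nat) x : R := if 0 < x then x ^- k * expR (- x^-1) else 0.

Lemma flat_ge0 k x : 0 <= flat k x.
Proof.
rewrite /flat; case: ifPn => // x0.
by rewrite mulr_ge0 ?expR_ge0// invr_ge0 exprn_ge0// ltW.
Qed.

Lemma flat_gt0 k x : 0 < x -> 0 < flat k x.
Proof.
by move=> x0; rewrite /flat x0 mulr_gt0 ?expR_gt0// invr_gt0 exprn_gt0.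
Qed.

(** The term of degree k + 2 of the series of exp(1/x) bounds it from below. The
    resulting zero of second order settles differentiability at 0. *)
Lemma flat_le k x : `|flat k x| <= (k.+2)`!%:R * `|x| ^+ 2.
Proof.
rewrite ger0_norm ?flat_ge0// /flat; case: ifPn => x0; last by rewrite mulr_ge0.
rewrite gtr0_norm// expRN.
have y0 : 0 < x^-1 by rewrite invr_gt0.
have h := expR_ge1Dxn k.+1 (ltW y0).
have f0 : 0 < (k.+2)`!%:R :> R by rewrite ltr0n fact_gt0.
have h' : x^-1 ^+ k.+2 / (k.+2)`!%:R <= expR x^-1.
  by apply: le_trans h; rewrite lerDr.
have h2 : (expR x^-1)^-1 <= (k.+2)`!%:R * x ^+ k.+2.
  rewrite -[leRHS]invrK lef_pV2 ?posrE ?expR_gt0//.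
    by rewrite invfM -exprVn mulrC.
  by rewrite invr_gt0 mulr_gt0// exprn_gt0.
have xk0 : 0 < x ^+ k by rewrite exprn_gt0.
rewrite mulrC ler_pdivrMr//; apply: (le_trans h2).
by rewrite -mulrA -exprD add2n lexx.
Qed.

Lemma is_derive_flat k x :
  is_derive x 1 (flat k) (- k%:R * flat k.+1 x + flat k.+2 x).
Proof.
have [x0|x0|->] := ltgtP x 0.
- rewrite /flat !ltNge !(ltW x0)/= mulr0 addr0.
  apply: (@near_eq_is_derive _ _ _ (cst 0) (flat k) x 1 0).
  near=> y; rewrite /flat; suff -> : (0 < y) = false by [].
  by apply/negbTE; rewrite -leNgt ltW//; near: y; exact: lt_nbhsl.
- apply: (@near_eq_is_derive R R R (fun y : R => y^-1 ^+ k * expR (- y^-1))).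
    near=> y; rewrite /flat; suff -> : 0 < y by rewrite exprVn.
    by near: y; exact: lt_nbhsr.
  have xn0 : x != 0 by rewrite gt_eqF.
  have dv : is_derive x 1 (fun y : R => y^-1) (- x ^- 2 *: 1) by exact: is_deriveV.
  have dN : is_derive x 1 (fun y : R => - y^-1) (- (- x ^- 2 *: 1)) by exact: is_deriveN.
  have dE := @is_derive1_comp R expR (fun y : R => - y^-1) x _ _ (is_derive_expR _) dN.
  have dX : is_derive x 1 (fun y : R => y^-1 ^+ k) (k%:R * x^-1 ^+ k.-1 *: (- x ^- 2 *: 1)).
    have -> : (fun y : R => y^-1 ^+ k) = (fun y : R => y^-1) ^+ k.
      by rewrite exprfctE.
    exact: is_deriveX.
  apply: is_derive_eq (is_deriveM dX dE) _.
  rewrite /flat x0 -![_ *: _]/(_ * _) !mulr1 -!exprVn.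
  case: k {dX} => [|k]/=; rewrite ?exprS ?expr0; ring.
- have -> : - k%:R * flat k.+1 0 + flat k.+2 0 = 0 by rewrite /flat ltxx mulr0 addr0.
  have lin0 : linear (fun _ : R => 0 : R) by move=> a y z; rewrite scaler0 addr0.
  have [||df Df] := @derive_eps R R (flat k) 0 (mklin lin0).
  + exact: cst_continuous.
  + move=> e e0; pose N : R := (k.+2)`!%:R.
    have N0 : 0 < N by rewrite ltr0n fact_gt0.
    exists (e / N) => [|h hN]; first by rewrite divr_gt0.
    rewrite addr0 {2}/flat ltxx !subr0 (le_trans (flat_le k h))//.
    by rewrite expr2 mulrA ler_wpM2r// mulrC -ler_pdivlMr// ltW.
  + by apply: DeriveDef; [exact: diff_derivable|rewrite Df].
Unshelve. all: by end_near.
Qed.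

Lemma rsmooth_flat k : rsmooth_on setT (flat k).
Proof.
apply/rsmooth_Cn => m; elim: m k => [|m IH] k.
  split=> // x _; apply/derivable1_diffP; case: (is_derive_flat k x) => + _; exact.
apply: (CnS1 openT (fun x _ => is_derive_flat k x)).
apply: (Cn_add openT); last exact: IH.
by apply: (Cn_mul openT); [exact: (Cn_cst openT)|exact: IH].
Qed.

(** The thresholds are meant for s = |xi|^2: the cut-off takes place in the shell
    1/4 <= |xi| <= 1/2. *)
Definition step s : R := flat 0 (s - 16^-1) / (flat 0 (s - 16^-1) + flat 0 (4^-1 - s)).

Lemma step_den_gt0 s : 0 < flat 0 (s - 16^-1) + flat 0 (4^-1 - s).
Proof.
have [h|h] := ltP 16^-1 s.
  by rewrite ltr_pwDl ?flat_ge0// flat_gt0// subr_gt0.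
by rewrite ltr_wpDl ?flat_ge0// flat_gt0// subr_gt0 (le_lt_trans h)//; lra.
Qed.

Lemma step_eq0 s : s <= 16^-1 -> step s = 0.
Proof. by move=> h; rewrite /step {1}/flat subr_gt0 ltNge h mul0r. Qed.

Lemma step_eq1 s : 4^-1 <= s -> step s = 1.
Proof.
move=> h; have := step_den_gt0 s.
have -> : flat 0 (4^-1 - s) = 0 by rewrite /flat subr_gt0 ltNge h.
by rewrite addr0 /step => d0; rewrite {3}/flat subr_gt0 ltNge h addr0 divff// gt_eqF.
Qed.

Lemma rsmooth_comp1 (V : normedModType R) (D : set V) (f : R -> R) (phi : V -> R) :
  open D -> rsmooth_on setT f -> rsmooth_on D phi ->
  rsmooth_on D (fun y => f (phi y)).
Proof.
move=> oD sf sphi.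
by apply: (rsmooth_comp (c := coords_R) (E := setT) (phi := phi) (f := f)) => //;
  exact: openT.
Qed.

Lemma rsmooth_id (D : set R) : open D -> rsmooth_on D (fun x : R => x).
Proof.
move=> oD; apply: (rsmooth_linear oD (L := cfun coords_R ord0)).
exact: cfun_continuous.
Qed.

Lemma rsmooth_step : rsmooth_on setT step.
Proof.
have oT : open [set: R] by exact: openT.
have sA : rsmooth_on setT (fun s => flat 0 (s - 16^-1)).
  apply: rsmooth_comp1 => //; first exact: rsmooth_flat.
  by apply: rsmooth_sub => //; [exact: rsmooth_id|exact: rsmooth_cst].
have sB : rsmooth_on setT (fun s => flat 0 (4^-1 - s)).
  apply: rsmooth_comp1 => //; first exact: rsmooth_flat.
  by apply: rsmooth_sub => //; [exact: rsmooth_cst|exact: rsmooth_id].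
apply: rsmooth_mul => //; apply: rsmooth_inv => // [s _|].
  by rewrite gt_eqF// step_den_gt0.
exact: rsmooth_add.
Qed.

(** The derivative of step, in a form that shows its sign. *)
Definition step' s : R :=
  (flat 2 (s - 16^-1) * flat 0 (4^-1 - s) + flat 0 (s - 16^-1) * flat 2 (4^-1 - s)) /
  (flat 0 (s - 16^-1) + flat 0 (4^-1 - s)) ^+ 2.

Lemma is_derive_step s : is_derive s 1 step (step' s).
Proof.
have d1 : is_derive s 1 (fun t : R => t - 16^-1) 1.
  by apply: is_derive_eq (is_deriveB (is_derive_id s 1) (is_derive_cst _ s 1)) _; rewrite subr0.
have d2 : is_derive s 1 (fun t : R => 4^-1 - t) (-1).
  by apply: is_derive_eq (is_deriveB (is_derive_cst _ s 1) (is_derive_id s 1)) _; rewrite sub0r.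
have dA := @is_derive1_comp R (flat 0) _ s _ _ (is_derive_flat 0 _) d1.
have dB := @is_derive1_comp R (flat 0) _ s _ _ (is_derive_flat 0 _) d2.
have n0 := lt0r_neq0 (step_den_gt0 s).
have dI := @is_deriveV R (fun t => flat 0 (t - 16^-1) + flat 0 (4^-1 - t)) s _ _
  n0 (is_deriveD dA dB).
apply: is_derive_eq (is_deriveM dA dI) _.
rewrite -![_ *: _]/(_ * _) /step' /=.
move: n0; set A := flat 0 (s - _); set B := flat 0 (4^-1 - s) => n0.
by field.
Qed.

Lemma step'_ge0 s : 0 <= step' s.
Proof.
by rewrite /step' mulr_ge0// ?invr_ge0 ?sqr_ge0// addr_ge0// mulr_ge0// flat_ge0.
Qed.

Lemma step'_gt0 s : 16^-1 < s -> s < 4^-1 -> 0 < step' s.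
Proof.
move=> s1 s2; have A0 : 0 < s - 16^-1 by rewrite subr_gt0.
have B0 : 0 < 4^-1 - s by rewrite subr_gt0.
rewrite /step' mulr_gt0// ?invr_gt0 ?exprn_gt0 ?step_den_gt0//.
by rewrite addr_gt0// mulr_gt0// flat_gt0.
Qed.

Lemma step'_eq0 s : 4^-1 <= s -> step' s = 0.
Proof.
move=> h; have B0 : (0 < 4^-1 - s) = false by rewrite subr_gt0 ltNge h.
by rewrite /step' [flat 0 (4^-1 - s)]/flat [flat 2 (4^-1 - s)]/flat B0 !mulr0 addr0 mul0r.
Qed.

Lemma rsmooth_powR (p : R) : rsmooth_on [set s : R | 0 < s] (fun s => s `^ p).
Proof.
have oD : open [set s : R | 0 < s] by exact: open_gt.
apply/rsmooth_Cn => k; elim: k p => [|k IH] p.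
  split=> // x x0; apply/derivable1_diffP.
  by case: (is_derive1_powR p x0) => + _; exact.
apply: (@CnS1 _ k _ (fun s => s `^ p) (fun x => p * x `^ (p - 1)) oD).
by apply: (Cn_mul oD); [exact: (Cn_cst oD)|exact: IH].
Qed.

(** Used with s = |xi|^2 and p = - n / 2, which gives |xi|^-n cut off near 0. *)
Definition profile (p s : R) : R := step s * s `^ p.

Lemma profile_eq0 p s : s <= 16^-1 -> profile p s = 0.
Proof. by move=> h; rewrite /profile step_eq0// mul0r. Qed.

Lemma profile_eq p s : 4^-1 <= s -> profile p s = s `^ p.
Proof. by move=> h; rewrite /profile step_eq1// mul1r. Qed.

Lemma rsmooth_profile p : rsmooth_on setT (profile p).
Proof.
have oD : open [set s : R | 0 < s] by exact: open_gt.
have oE : open [set s : R | s < 16^-1] by exact: open_lt.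
move=> vs s _; have [s0|s0] := ltP 0 s.
  suff : rsmooth_on [set s : R | 0 < s] (profile p) by apply.
  apply: rsmooth_mul => //; last exact: rsmooth_powR.
  exact: rsmooth_subset rsmooth_step.
suff : rsmooth_on [set s : R | s < 16^-1] (profile p).
  by apply; rewrite /= (le_lt_trans s0)// invr_gt0.
apply: (eq_on_rsmooth oE (f := fun=> 0)); last exact: rsmooth_cst.
by move=> y /set_mem /= h; rewrite profile_eq0// ltW.
Qed.

(** Euler's identity for s^p, with the derivative of the cut-off as error term. *)
Lemma derive_profile p s : 0 < s -> s * 'D_1 (profile p) s =
  s * step' s * s `^ p + p * profile p s.
Proof.
move=> s0.
have [_ Dp] := is_deriveM (is_derive_step s) (is_derive1_powR p s0).
rewrite [X in _ * X]Dp -![_ *: _]/(_ * _) /profile powRB.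
  by rewrite powRr1 ?ltW//; field; rewrite gt_eqF.
by apply/implyP => _; rewrite gt_eqF.
Qed.

End cutoff.

(** * The cut-off radial field *)

Section radial_field.
Context {R : realType} {n : nat}.
Implicit Types (x xi v : 'rV[R]_n).
Local Notation rV := ('rV[R]_n).
Local Notation p := (- (n%:R / 2) : R).
Local Notation mu := (lebesgue_tuple R n).

Lemma dot_ge0 xi : 0 <= dot xi xi.
Proof. by apply: sumr_ge0 => i _; rewrite -expr2 sqr_ge0. Qed.

Lemma dot_eq0 xi : (dot xi xi == 0) = (xi == 0).
Proof.
apply/eqP/eqP => [|->]; last by rewrite /dot big1// => i _; rewrite mxE mul0r.
move=> d0; apply/rowP => i; rewrite mxE; apply/eqP; rewrite -sqrf_eq0 expr2.
move/eqP: d0; rewrite psumr_eq0 => [/allP/(_ i)|j _]; last by rewrite -expr2 sqr_ge0.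
by apply; rewrite mem_index_enum.
Qed.

Lemma dot_gt0 xi : xi != 0 -> 0 < dot xi xi.
Proof. by move=> xi0; rewrite lt0r dot_eq0 xi0 dot_ge0. Qed.

Lemma enorm2 xi : enorm xi ^+ 2 = dot xi xi.
Proof. by rewrite sqr_sqrtr// dot_ge0. Qed.

Lemma rsmooth_coord (D : set rV) (i : 'I_n) : open D ->
  rsmooth_on D (fun x => x 0 i).
Proof.
move=> oD; apply: (rsmooth_linear oD (L := cfun (coords_rV n) i)).
exact: cfun_continuous.
Qed.

Lemma rsmooth_sqnorm (D : set rV) : open D -> rsmooth_on D (fun x => dot x x).
Proof.
move=> oD; apply: rsmooth_sum => // i _.
by apply: rsmooth_mul => //; exact: rsmooth_coord.
Qed.

(** Cut-off of the field xi / |xi|^n, which is homogeneous of degree 1 - n and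
    divergence free away from the origin. *)
Definition rho (j : 'I_n) xi : R := xi 0 j * profile p (dot xi xi).

Definition divrho xi : R := \sum_j 'D_(delta_mx 0 j) (rho j) xi.

Lemma rsmooth_rho j : rsmooth_on setT (rho j).
Proof.
apply: rsmooth_mul; [exact: openT|exact: (rsmooth_coord _ openT)|].
apply: rsmooth_comp1; [exact: openT|exact: rsmooth_profile|].
exact: (rsmooth_sqnorm openT).
Qed.

Lemma is_derive_coord xi v (i : 'I_n) :
  is_derive xi v (fun x : rV => x 0 i) (v 0 i).
Proof.
have dl : differentiable (fun x : rV => x 0 i) xi.
  exact: (@rsmooth_coord setT i openT [::]).
apply: DeriveDef; first exact: diff_derivable.
rewrite deriveE//.
exact: (congr1 (@^~ v) (diff_lin _ (@cfun_continuous R _ (coords_rV n) i))).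
Qed.

Lemma is_derive_sqnorm xi v : is_derive xi v (fun x => dot x x) (2 * dot v xi).
Proof.
have dc := is_derive_coord xi v.
have E : (fun x : rV => dot x x) = \sum_i (fun x : rV => x 0 i * x 0 i).
  by apply/funext => x; rewrite fct_sumE.
rewrite E.
apply: is_derive_eq (is_derive_sum (fun i => is_deriveM (dc i) (dc i))) _.
rewrite /dot mulr_sumr; apply: eq_bigr => i _.
by rewrite -![_ *: _]/(_ * _) mulrC -mulr2n mulr_natl.
Qed.

Lemma derive_rho j xi : 'D_(delta_mx 0 j) (rho j) xi =
  profile p (dot xi xi) + 2 * xi 0 j ^+ 2 * 'D_1 (profile p) (dot xi xi).
Proof.
set e := delta_mx 0 j.
have [ds Ds] := is_derive_sqnorm xi e.
have ds' : differentiable (fun x : rV => dot x x) xi.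
  exact: (@rsmooth_sqnorm setT openT [::]).
have dp : differentiable (profile p) (dot xi xi).
  exact: (@rsmooth_profile R p [::]).
have dc : is_derive xi e ((profile p) \o (fun x => dot x x))
    (2 * xi 0 j * 'D_1 (profile p) (dot xi xi)).
  apply: DeriveDef; first exact/diff_derivable/differentiable_comp.
  rewrite (derive_chain coords_R)// big_ord1 -[LHS]/('D_e (fun x => dot x x) xi * _).
  by rewrite Ds dot_delta.
have [_ ->] := is_deriveM (is_derive_coord xi e j) dc.
rewrite -![_ *: _]/(_ * _) /e mxE !eqxx /=. ring.
Qed.

(** The field xi / |xi|^n being divergence free, only the derivative of the
    cut-off contributes. *)
Lemma divrhoE xi : divrho xi = 2 * dot xi xi * step' (dot xi xi) * dot xi xi `^ p.
Proof.
rewrite /divrho; under eq_bigr do rewrite derive_rho.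
rewrite big_split/= sumr_const card_ord -mulr_suml -mulr_sumr.
have -> : \sum_i xi 0 i ^+ 2 = dot xi xi by apply: eq_bigr => i _; rewrite expr2.
have [/eqP d0|dn0] := eqVneq (dot xi xi) 0.
  by rewrite (eqP d0) !mulr0 !mul0r addr0 profile_eq0 ?mul0rn// invr_ge0.
have d0 : 0 < dot xi xi by rewrite lt0r dn0 dot_ge0.
by rewrite -mulr_natl -(mulrA 2) derive_profile//; field.
Qed.

Lemma divrho_ge0 xi : 0 <= divrho xi.
Proof. by rewrite divrhoE mulr_ge0 ?powR_ge0// mulr_ge0 ?step'_ge0// mulr_ge0 ?dot_ge0. Qed.

Lemma divrho_eq0 xi : 4^-1 <= dot xi xi -> divrho xi = 0.
Proof. by move=> h; rewrite divrhoE step'_eq0// mulr0 mul0r. Qed.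

Lemma divrho_gt0 xi : 16^-1 < dot xi xi -> dot xi xi < 4^-1 -> 0 < divrho xi.
Proof.
move=> h1 h2; have d0 : 0 < dot xi xi by rewrite (lt_trans _ h1).
by rewrite divrhoE mulr_gt0 ?powR_gt0// mulr_gt0 ?step'_gt0// mulr_gt0.
Qed.

Lemma rsmooth_divrho : rsmooth_on setT divrho.
Proof.
apply: rsmooth_sum; first exact: openT.
by move=> j _; apply: rsmooth_derive; exact: rsmooth_rho.
Qed.

Lemma coord_le_enorm xi i : `|xi 0 i| <= enorm xi.
Proof.
rewrite -[leLHS]sqrtr_sqr ler_sqrt ?dot_ge0// /dot (bigD1 i)//= -expr2 lerDl.
by apply: sumr_ge0 => j _; rewrite -expr2 sqr_ge0.
Qed.

Lemma norm_le_enorm xi : `|xi| <= enorm xi.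
Proof.
rewrite [leLHS]/Num.norm /= mx_normrE; apply: bigmax_le; first exact: sqrtr_ge0.
by move=> [i j] _ /=; rewrite ord1; exact: coord_le_enorm.
Qed.

Lemma compact_sqnorm_le (r : R) : compact [set xi : rV | dot xi xi <= r].
Proof.
apply: bounded_closed_compact.
  exists (Num.sqrt r); split; first exact: num_real.
  move=> M rM xi /= xir; apply: (le_trans (norm_le_enorm xi)).
  by rewrite (le_trans _ (ltW rM))// ler_wsqrtr.
have -> : [set xi : rV | dot xi xi <= r] = (fun xi : rV => dot xi xi) @^-1` [set t | t <= r].
  by [].
apply: closed_comp; last exact: closed_le.
move=> xi _; exact: (rsmooth_continuous (rsmooth_sqnorm openT)).
Qed.

Lemma rapid_divrho : rapid divrho.
Proof.
apply: (@compact_rapid _ _ divrho _ _ (@compact_sqnorm_le 4^-1)) => [x|x /= /negP].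
  exact: (rsmooth_continuous rsmooth_divrho).
by rewrite -ltNge => /ltW; exact: divrho_eq0.
Qed.

Lemma powR_le_neg (b s q : R) : 0 < b -> b <= s -> q <= 0 -> s `^ q <= b `^ q.
Proof.
move=> b0 bs q0; have s0 : 0 < s by rewrite (lt_le_trans b0).
rewrite -[q]opprK !(powRN _ (- q)) lef_pV2 ?posrE ?powR_gt0//.
by apply: ge0_ler_powR; rewrite ?nnegrE ?oppr_ge0// ltW.
Qed.

Let p_le0 : p <= 0. Proof. by rewrite oppr_le0 divr_ge0. Qed.

Lemma step_ge0_le1 (s : R) : 0 <= step s <= 1.
Proof.
rewrite divr_ge0 ?flat_ge0 ?addr_ge0 ?flat_ge0//=.
by rewrite ler_pdivrMr ?step_den_gt0// mul1r lerDl flat_ge0.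
Qed.

Lemma profile_bounded s : `|profile p s| <= 16^-1 `^ p.
Proof.
have [s0 s1] := andP (step_ge0_le1 s).
have [h|h] := leP s 16^-1; first by rewrite profile_eq0// normr0 powR_ge0.
rewrite /profile ger0_norm; last by rewrite mulr_ge0// powR_ge0.
apply: (@le_trans _ _ (s `^ p)); first by rewrite ler_piMl// powR_ge0.
by apply: powR_le_neg; [rewrite invr_gt0|exact: ltW|exact: p_le0].
Qed.

(** On [0, 1] by compactness; beyond 1 the profile is a power with negative
    exponent. *)
Lemma derive_profile_bounded : exists C, forall s, 0 <= s -> `|'D_1 (profile p) s| <= C.
Proof.
have sD : rsmooth_on setT ('D_1 (profile p)) by exact/rsmooth_derive/rsmooth_profile.
have cD : {within `[0, 1], continuous (fun s => `|'D_1 (profile p) s|)}.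
  apply: continuous_subspaceT; apply: continuous_norm => s.
  exact: (rsmooth_continuous sD).
have [c cc Hc] := EVT_max (@ler01 R) cD.
exists (Num.max `|'D_1 (profile p) c| (`|p| * 4^-1 `^ (p - 1))) => s s0.
rewrite le_max; have [s1|s1] := leP s 1.
  by rewrite Hc// in_itv/= s0.
have s4 : 4^-1 < s :> R by rewrite (lt_trans _ s1)// invf_lt1// ltr1n.
have oD : open [set s : R | 4^-1 < s] by exact: open_gt.
have E : {in [set s : R | 4^-1 < s], profile p =1 (fun s => s `^ p)}.
  by move=> y /set_mem/= /ltW/profile_eq.
rewrite (eq_on_derive oD 1 E); last exact/mem_set.
have sp : 0 < s by rewrite (lt_trans _ s4).
have [_ ->] := is_derive1_powR p sp.
apply/orP; right; rewrite normrM ler_wpM2l// ger0_norm ?powR_ge0//.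
apply: powR_le_neg; [by rewrite invr_gt0|exact: ltW|].
by rewrite subr_le0 (le_trans p_le0).
Qed.

Let continuous_compR (f : R -> R) : rsmooth_on setT f ->
  continuous (fun x : rV => f (dot x x)).
Proof.
move=> sf x.
have sc := rsmooth_comp1 openT sf (@rsmooth_sqnorm setT openT).
exact: (rsmooth_continuous sc).
Qed.

Lemma moderate_rho j : moderate (rho j).
Proof.
apply: moderate_mul; first exact: moderate_coord.
apply: (moderate_bounded (C := 16^-1 `^ p)); last by move=> x; exact: profile_bounded.
exact: (continuous_compR (rsmooth_profile p)).
Qed.

Lemma moderate_derive_rho j : moderate ('D_(delta_mx 0 j) (rho j)).
Proof.
rewrite (_ : 'D_ _ _ = fun xi => profile p (dot xi xi) +
    2 * (xi 0 j * xi 0 j) * 'D_1 (profile p) (dot xi xi)); last first.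
  by apply/funext => xi; rewrite derive_rho expr2.
apply: moderate_add.
  apply: (moderate_bounded (C := 16^-1 `^ p)); last by move=> x; exact: profile_bounded.
  exact: (continuous_compR (rsmooth_profile p)).
apply: moderate_mul.
  apply: moderate_mul; first exact: moderate_cst.
  by apply: moderate_mul; exact: moderate_coord.
have [C HC] := derive_profile_bounded.
apply: (moderate_bounded (C := C)); last by move=> x; exact/HC/dot_ge0.
apply: (@continuous_compR ('D_1 (profile p))); exact/rsmooth_derive/rsmooth_profile.
Qed.

(** A continuous nonnegative function, positive somewhere, dominates on R^n a
    multiple of the indicator of a cube, whose integral is a product. *)
Lemma integral_rapid_gt0 (f : rV -> R) xi0 : rapid f -> (forall xi, 0 <= f xi) ->
  0 < f xi0 -> 0 < \int[mu]_t f (rowt t).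
Proof.
move=> rf f0 fxi0; set m := f xi0 / 2.
have m0 : 0 < m by rewrite divr_gt0.
have [d d0 dP] : exists2 d : R, 0 < d & forall xi, `|xi - xi0| < d -> m <= f xi.
  have /cvgrPdist_lt/(_ m m0) := rf.1 xi0.
  move=> /nbhs_ballP[d /= d0 dP]; exists d => // xi xid.
  have /dP/= : ball xi0 d xi by rewrite -ball_normE /= distrC.
  move=> /(le_lt_trans (ler_norm _)); rewrite /m; lra.
pose J i : set R := `[xi0 0 i - d / 2, xi0 0 i + d / 2]%classic.
have mJ i : measurable (J i) by exact: measurable_itv.
have IJ i : (\int[lebesgue_measure]_x (\1_(J i) x)%:E = d%:E)%E.
  have -> := @integral_indic _ _ R lebesgue_measure setT measurableT _ (mJ i).
  rewrite setIT; transitivity ((@lebesgue_measure R (J i)) : \bar R) => //.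
  rewrite /J lebesgue_measure_itv/= lte_fin.
  rewrite ifT; last by rewrite ltrD2l (@lt_trans _ _ 0) ?oppr_lt0 ?divr_gt0.
  by rewrite -EFinB; congr EFin; field.
have Ibox : (\int[mu]_t (\prod_i \1_(J i) (tnth t i))%:E = (d ^+ n)%:E)%E.
  rewrite (@integral_prod_tuple _ n (fun i => \1_(J i)) (fun=> d))//.
  by rewrite prodr_const card_ord.
have fi := wdom_integrable (rapid_wdom rf).
have mbox : measurable_fun setT (fun t : n.-tuple (measurableTypeR R) =>
    (\prod_i \1_(J i) (tnth t i) : R)%:E).
  by apply: (@measurable_prod_tuple _ n (fun i => \1_(J i))) => i; exact: measurable_indic.
have box0 (t : n.-tuple (measurableTypeR R)) : 0 <= \prod_i \1_(J i) (tnth t i) :> R.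
  exact: prodr_ge0.
have boxle (t : n.-tuple (measurableTypeR R)) :
    m * \prod_i \1_(J i) (tnth t i) <= f (rowt t).
  have [/forallP h|/forallPn[i hi]] := boolP [forall i, tnth t i \in J i]; last first.
    by rewrite (bigD1 i)//= indicE (negbTE hi) mul0r mulr0.
  rewrite big1 ?mulr1 => [|i _]; last by rewrite indicE h.
  apply: dP; rewrite [ltLHS]/Num.norm /= mx_normrE; apply/bigmax_ltP; split=> //.
  move=> [i j] _ /=; rewrite ord1 !mxE ltr_norml.
  have := h j; rewrite inE /J /= in_itv /=; lra.
have : (((m * d ^+ n)%:E : \bar R) <= \int[mu]_t (f (rowt t))%:E)%E.
  rewrite EFinM -Ibox -ge0_integralZl//; last 2 first.
  - by move=> t _; rewrite lee_fin.
  - by rewrite lee_fin ltW.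
  apply: ge0_le_integral => //.
  - by move=> t _; rewrite -EFinM lee_fin mulr_ge0// ltW.
  - exact: measurable_funeM.
  - exact: measurable_int fi.
  - by move=> t _; rewrite -EFinM lee_fin.
move=> le2; have : m * d ^+ n <= \int[mu]_t f (rowt t).
  rewrite -lee_fin /Rintegral fineK; first exact: le2.
  exact: (integrable_fin_num measurableT fi).
by apply: lt_le_trans; rewrite mulr_gt0// exprn_gt0.
Qed.

(** The value is the flux of xi / |xi|^n through a sphere around the origin. It
    is positive because the divergence is nonnegative, and positive in the shell. *)
Lemma integral_divrho_gt0 : (0 < n)%N -> 0 < \int[mu]_t divrho (rowt t).
Proof.
move=> n0; pose j := Ordinal n0; pose xi0 : rV := 3^-1 *: delta_mx 0 j.
apply: (integral_rapid_gt0 (xi0 := xi0)) => [||]; first exact: rapid_divrho.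
  exact: divrho_ge0.
(* The norm 1/3 lies inside the shell: 1/16 < 1/9 < 1/4. *)
have d9 : dot xi0 xi0 = 9^-1.
  by rewrite dotZl dotC dotZl dot_delta mxE !eqxx /=; field.
by apply: divrho_gt0; rewrite d9 ltf_pV2 ?posrE ?ltr_nat.
Qed.

End radial_field.

(** * Symbols with a homogeneous end *)

Lemma eq_on_iter_derive (R : realType) (V : normedModType R) (D : set V)
    (f g : V -> R) vs : open D -> {in D, f =1 g} ->
  {in D, iter_derive vs f =1 iter_derive vs g}.
Proof. by move=> oD fg; elim: vs => //= v vs IH; exact: eq_on_derive. Qed.

Lemma derive_comp_linear (R : realType) (V W : normedModType R)
    (L : {linear V -> W}) (f : W -> R) x v :
  'D_v (f \o L) x = 'D_(L v) f (L x).
Proof.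
have E : (fun h : R => h^-1 *: (((f \o L) \o shift x) (h *: v) - (f \o L) x)) =
    (fun h : R => h^-1 *: ((f \o shift (L x)) (h *: L v) - f (L x))).
  by apply/funext => h /=; rewrite (linearD L) linearZZ.
by rewrite /derive E.
Qed.

Section symbols.
Context {R : realType} {n : nat}.
Local Notation rV := ('rV[R]_n).
Local Notation V := (rV * rV)%type.
Implicit Types (f g : V -> R) (x xi : rV) (m e : int).

Definition offzero : set V := [set z | z.2 != 0].

Lemma open_offzero : open offzero.
Proof.
have -> : offzero = snd @^-1` (~` [set (0 : rV)]).
  by apply/seteqP; split=> z /eqP.
apply: open_comp => [z _|]; first exact: cvg_snd.
apply: closed_openC; apply: accessible_closed_set1.
by apply: hausdorff_accessible; exact: norm_hausdorff.
Qed.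

Definition rhomogeneous e g := forall x xi (t : R), xi != 0 -> 0 < t ->
  g (x, t *: xi) = t ^ e * g (x, xi).

Let dilate (t : R) (z : V) : V := (z.1, t *: z.2).

Let linear_dilate t : linear (dilate t).
Proof.
by move=> a x y; rewrite /dilate /= scalerDr !scalerA [t * a]mulrC -scalerA.
Qed.

Let Dilate t : {linear V -> V} :=
  HB.pack (dilate t) (GRing.isLinear.Build _ _ _ _ (dilate t) (linear_dilate t)).

(** Dilation of the second variable is linear, so the homogeneity relation may be
    differentiated by the chain rule. *)
Lemma derive_homogeneous e g w x xi (t : R) : rsmooth_on offzero g ->
  rhomogeneous e g -> xi != 0 -> 0 < t ->
  'D_(dilate t w) g (x, t *: xi) = t ^ e * 'D_w g (x, xi).
Proof.
move=> sg hg xi0 t0.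
rewrite -[LHS](@derive_comp_linear _ _ _ (Dilate t) g (x, xi) w).
have E : {in offzero, g \o Dilate t =1 (fun z => t ^ e * g z)}.
  by move=> [y eta] /set_mem /= eta0; exact: hg.
rewrite (eq_on_derive open_offzero w E); last exact/mem_set.
rewrite deriveZ//; apply: diff_derivable; exact: (sg [::]).
Qed.

Lemma homogeneous_derive_l e g a : rsmooth_on offzero g ->
  rhomogeneous e g -> rhomogeneous e ('D_(a, 0) g).
Proof.
move=> sg hg x xi t xi0 t0; have := derive_homogeneous (a, 0) x sg hg xi0 t0.
by rewrite {1}/dilate scaler0.
Qed.

Lemma homogeneous_derive_r e g b : rsmooth_on offzero g ->
  rhomogeneous e g -> rhomogeneous (e - 1) ('D_(0, b) g).
Proof.
move=> sg hg x xi t xi0 t0.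
have tn0 : t != 0 by rewrite gt_eqF.
have dg : differentiable g (x, t *: xi).
  by apply: (sg [::]); rewrite /offzero/= scaler_eq0 negb_or tn0.
rewrite expfzDr// exprN1 [t ^ e * _]mulrC -mulrA -(derive_homogeneous _ _ sg hg)//.
have -> : dilate t (0, b) = t *: ((0, b) : V).
  by rewrite /dilate -[RHS]/(t *: (0 : rV), t *: b) scaler0.
rewrite !deriveE// linearZ/=.
by rewrite -[t *: ('d g _ _)]/(t * _) mulKf.
Qed.

Lemma homogeneous_iter_derive e g (a b : seq 'I_n) : rsmooth_on offzero g ->
  rhomogeneous e g ->
  rhomogeneous (e - (size b)%:Z)
    (iter_derive ([seq (delta_mx 0 i, 0) | i <- a] ++
                  [seq (0, delta_mx 0 j) | j <- b]) g).
Proof.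
move=> sg hg; elim: a => [|i a IH] /=; last first.
  by apply: homogeneous_derive_l => //; exact: rsmooth_iter.
elim: b => [|j b IH] /=; first by rewrite subr0.
rewrite -addn1 PoszD opprD addrA; apply: homogeneous_derive_r => //.
exact: rsmooth_iter.
Qed.

(** The function is bounded on the product of K with the unit sphere, and its
    values elsewhere follow by homogeneity. *)
Lemma homogeneous_bound e g (K : set rV) : rsmooth_on offzero g ->
  rhomogeneous e g -> compact K ->
  exists C, forall x xi, K x -> 1 <= enorm xi ->
    `|g (x, xi)| <= C * enorm xi ^ e.
Proof.
move=> sg hg cK.
pose S : set rV := [set xi | dot xi xi = 1].
have cS : compact S.
  apply: subclosed_compact (@compact_sqnorm_le R n 1) _; last by move=> xi /= ->.
  have -> : S = (fun xi : rV => dot xi xi) @^-1` [set 1] by [].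
  apply: closed_comp; last exact: closed_eq.
  by move=> xi _; exact: (rsmooth_continuous (rsmooth_sqnorm openT)).
have cKS : compact (K `*` S) by exact: compact_setX.
have S0 xi : S xi -> xi != 0.
  by move=> /= h; rewrite -dot_eq0 h oner_eq0.
have cg : {within K `*` S, continuous (fun z => `|g z|)}.
  apply: continuous_in_subspaceT => z /set_mem[_ /S0 z0].
  apply: continuous_comp; last exact: norm_continuous.
  exact: (rsmooth_continuous sg).
have unit xi : 1 <= enorm xi -> S ((enorm xi)^-1 *: xi).
  move=> h; have e0 : enorm xi != 0 by rewrite gt_eqF// (lt_le_trans _ h).
  by rewrite /S/= dotZl dotC dotZl mulrA -enorm2 -invfM -expr2 mulVf// expf_neq0.
have [KS0|KS0] := pselect (K `*` S !=set0); last first.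
  exists 0 => x xi Kx /unit Sxi; exfalso; apply: KS0.
  by exists (x, (enorm xi)^-1 *: xi).
have [z zKS zmax] := compact_EVT_max KS0 cKS cg.
exists `|g z| => x xi Kx h.
have e0 : 0 < enorm xi by rewrite (lt_le_trans _ h).
have Sxi := unit _ h.
rewrite -[xi in g (_, xi)](scalerKV (lt0r_neq0 e0)) hg//; last exact: S0.
rewrite normrM mulrC (ger0_norm (exprz_ge0 _ (ltW e0))) ler_wpM2r//.
  by rewrite exprz_ge0// ltW.
by apply: zmax; exact/mem_set.
Qed.

Lemma normc_le (a b A B : R) : `|a| <= A -> `|b| <= B ->
  `|a +i* b| <= (A + B)%:C :> R[i].
Proof.
move=> aA bB; rewrite normc_def lecR /=.
have A0 : 0 <= A by exact: le_trans aA.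
have B0 : 0 <= B by exact: le_trans bB.
rewrite -[leRHS]ger0_norm ?addr_ge0// -sqrtr_sqr ler_wsqrtr//.
rewrite -[a ^+ 2]real_normK ?num_real// -[b ^+ 2]real_normK ?num_real//.
have := normr_ge0 a; have := normr_ge0 b; nra.
Qed.

(** A symbol that coincides with a homogeneous function outside a ball has that
    function as its whole asymptotic expansion: the remainders after the first
    term vanish identically for |xi| >= 1. *)
Lemma classical_symbol_homogeneous m (f1 f2 g1 g2 : V -> R) :
  rsmooth_on setT f1 -> rsmooth_on setT f2 ->
  rsmooth_on offzero g1 -> rsmooth_on offzero g2 ->
  rhomogeneous m g1 -> rhomogeneous m g2 ->
  (forall x xi, 4^-1 <= dot xi xi -> f1 (x, xi) = g1 (x, xi)) ->
  (forall x xi, 4^-1 <= dot xi xi -> f2 (x, xi) = g2 (x, xi)) ->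
  classical_symbol m (fun z => f1 z +i* f2 z).
Proof.
move=> sf1 sf2 sg1 sg2 hg1 hg2 fg1 fg2; split; first by split.
pose ph (j : nat) (z : V) : R[i] := if j is 0 then g1 z +i* g2 z else 0.
exists ph; split.
- case=> [|j]; first by split.
  by split; exact: (rsmooth_cst open_offzero).
- case=> [|j] x xi t xi0 t0; last by rewrite mulr0.
  by rewrite /= subr0 hg1// hg2//; simpc.
pose D : set V := [set z | 4^-1 < dot z.2 z.2].
have oD : open D.
  have -> : D = (fun z : V => dot z.2 z.2) @^-1` [set s | 4^-1 < s] by [].
  apply: open_comp => [z _|]; last exact: open_gt.
  apply: (@continuous_comp _ _ _ snd (fun y : rV => dot y y)); first exact: cvg_snd.
  exact: (rsmooth_continuous (rsmooth_sqnorm openT)).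
have inD x xi : 1 <= enorm xi -> D (x, xi).
  move=> h; rewrite /D/= -enorm2 (@lt_le_trans _ _ 1) ?invf_lt1 ?ltr1n//.
  by rewrite exprn_ege1.
have fgD1 : {in D, f1 =1 g1} by move=> [x xi] /set_mem/= /ltW; exact: fg1.
have fgD2 : {in D, f2 =1 g2} by move=> [x xi] /set_mem/= /ltW; exact: fg2.
(* For N = 0 no term is subtracted, and the estimate is that of g1 and g2. *)
move=> [|N] a b K cK; last first.
  exists 0 => x xi Kx h.
  have E z : \sum_(j < N.+1) ph j z = g1 z +i* g2 z.
    by rewrite big_ord_recl big1 ?addr0// => j _.
  have Z (F : R[i] -> R) f g : (forall z, F (f1 z +i* f2 z - (g1 z +i* g2 z)) = f z - g z) ->
      {in D, f =1 g} ->
      iter_derive ([seq (delta_mx 0 i, 0) | i <- a] ++ [seq (0, delta_mx 0 j) | j <- b])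
        (fun z => F (f1 z +i* f2 z - \sum_(j < N.+1) ph j z)) (x, xi) = 0.
    move=> Ff fg.
    have EE : {in D, (fun z => F (f1 z +i* f2 z - \sum_(j < N.+1) ph j z)) =1 (fun=> 0)}.
      by move=> z zD; rewrite E Ff fg// subrr.
    rewrite (eq_on_iter_derive _ oD EE); last exact/mem_set/inD.
    move: (_ ++ _) => vs; elim/last_ind: vs => // vs v IH.
    rewrite iter_derive_rcons (_ : 'D_v _ = fun=> 0)//.
    by apply/funext => z; rewrite derive_cst.
  rewrite /symbol_derive /iter_cderive (Z _ f1 g1)// (Z _ f2 g2)//.
  by rewrite mul0r complexr0 normr0.
have [C1 HC1] := homogeneous_bound (rsmooth_iter _ sg1)
  (homogeneous_iter_derive a b sg1 hg1) cK.
have [C2 HC2] := homogeneous_bound (rsmooth_iter _ sg2)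
  (homogeneous_iter_derive a b sg2 hg2) cK.
exists (C1 + C2) => x xi Kx h.
have E : (fun z => f1 z +i* f2 z - \sum_(j < 0) ph j z) = fun z => f1 z +i* f2 z.
  by apply/funext => z; rewrite big_ord0 subr0.
rewrite /symbol_derive E subr0 mulrDl; apply: normc_le.
  by rewrite (eq_on_iter_derive _ oD fgD1) ?HC1//; exact/mem_set/inD.
by rewrite (eq_on_iter_derive _ oD fgD2) ?HC2//; exact/mem_set/inD.
Qed.

End symbols.

(** * Integral operators with smooth kernel *)

Lemma rsmooth_comp_linear (R : realType) (V W : normedModType R)
    (L : {linear V -> W}) (f : W -> R) : continuous L -> rsmooth_on setT f ->
  rsmooth_on setT (f \o L).
Proof.
move=> cL sf; apply/rsmooth_Cn => k.
have dL x : differentiable L x by exact: linear_differentiable.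
elim: k f sf => [|k IH] f sf.
  split=> // x _; apply: differentiable_comp => //; exact: (sf [::]).
apply: (CnS openT (g := fun v => 'D_(L v) f \o L)) => [x _|v x _|v].
- apply: differentiable_comp => //; exact: (sf [::]).
- exact: derive_comp_linear.
- exact/IH/rsmooth_derive.
Qed.

Section projections.
Context {R : realType} {V W : normedModType R}.

Let linear_fst : linear (@fst V W). Proof. by []. Qed.
Let linear_snd : linear (@snd V W). Proof. by []. Qed.

Lemma rsmooth_fst (f : V -> R) : rsmooth_on setT f ->
  rsmooth_on setT (fun z : V * W => f z.1).
Proof.
pose L : {linear (V * W)%type -> V} := HB.pack (@fst V W) (GRing.isLinear.Build _ _ _ _ _ linear_fst).
apply: (@rsmooth_comp_linear _ _ _ L) => x; exact: cvg_fst.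
Qed.

Lemma rsmooth_snd (f : W -> R) : rsmooth_on setT f ->
  rsmooth_on setT (fun z : V * W => f z.2).
Proof.
pose L : {linear (V * W)%type -> W} := HB.pack (@snd V W) (GRing.isLinear.Build _ _ _ _ _ linear_snd).
apply: (@rsmooth_comp_linear _ _ _ L) => x; exact: cvg_snd.
Qed.

Lemma continuous_pairl (g : V * W -> R) x : continuous g ->
  continuous (fun y => g (x, y)).
Proof.
move=> cg y; apply: (@continuous_comp _ _ _ (fun y => (x, y)) g); last exact: cg.
by apply: cvg_pair => //; exact: cvg_cst.
Qed.

Lemma continuous_pairr (g : V * W -> R) y : continuous g ->
  continuous (fun x => g (x, y)).
Proof.
move=> cg x; apply: (@continuous_comp _ _ _ (fun x => (x, y)) g); last exact: cg.
by apply: cvg_pair => //; exact: cvg_cst.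
Qed.
End projections.

Section smooth_kernel.
Context {R : realType} {V W : normedModType R} (c : coords V).
Context {d : measure_display} {T : measurableType d}.
Variable mu : {measure set T -> \bar R}.
Variables (iota : T -> W) (u : T -> R) (C : set W).
Hypothesis miota : forall h : W -> R, continuous h ->
  measurable_fun setT (fun t => h (iota t)).
Hypothesis mu_u : measurable_fun setT u.
Hypothesis iu : rintegrable mu u.
Hypothesis cC : compact C.
Hypothesis uC : forall t, ~ C (iota t) -> u t = 0.
Variable K : V * W -> R.
Hypothesis sK : rsmooth_on setT K.

Let F x t := K (x, iota t) * u t.

Lemma derive_section (g : V * W -> R) v x y :
  'D_v (fun x => g (x, y)) x = 'D_(v, 0) g (x, y).
Proof.
have E : (fun h : R => h^-1 *: (((fun x => g (x, y)) \o shift x) (h *: v) - g (x, y))) =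
    (fun h => h^-1 *: ((g \o shift (x, y)) (h *: (v, 0)) - g (x, y))).
  apply/funext => h /=; congr (_ *: (g _ - _)).
  by rewrite -[RHS]/(h *: v + x, h *: 0 + y) scaler0 add0r.
by rewrite /derive E.
Qed.

Let sec (vs : seq V) : seq (V * W) := [seq (v, 0) | v <- vs].

Lemma differentiable_section (g : V * W -> R) y x : differentiable g (x, y) ->
  differentiable (fun x => g (x, y)) x.
Proof.
by move=> dg; apply: (differentiable_comp (f := fun x => (x, y))).
Qed.

Let iter_derive_F vs t :
  iter_derive vs (F^~ t) = (fun x => iter_derive (sec vs) K (x, iota t) * u t).
Proof.
elim: vs => [//|v vs IH]; apply/funext => x; rewrite /= IH.
pose g := iter_derive (sec vs) K.
rewrite (_ : (fun x => _) = (fun x => u t * g (x, iota t))); last first.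
  by apply/funext => y; rewrite mulrC.
rewrite deriveZ; last first.
  apply: diff_derivable; apply: differentiable_section; exact: sK.
by rewrite derive_section mulrC.
Qed.

Let cK vs : continuous (iter_derive (sec vs) K).
Proof. by move=> z; apply: differentiable_continuous; exact: sK. Qed.

(** The density lives on a compact set C, so by a tube argument each derivative
    of the kernel is bounded on the product of C with a ball around x0. *)
Lemma kernel_dominated : dominated mu F.
Proof.
move=> vs; pose g := iter_derive (sec vs) K.
split=> [x|x0].
  rewrite (_ : (fun t => _) = (fun t => g (x, iota t) * u t)); last first.
    by apply/funext => t; rewrite iter_derive_F.
  apply: measurable_funM => //.
  by apply: (miota (h := fun y => g (x, y))); apply: continuous_pairl; exact: cK.
have [M HM] : exists M, \forall x \near x0, forall y, C y -> `|g (x, y)| <= M.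
  have [C0|C0] := pselect (C !=set0); last first.
    exists 0; near=> x => y Cy; exfalso; apply: C0; by exists y.
  have cg0 : {within C, continuous (fun y => `|g (x0, y)|)}.
    apply: continuous_subspaceT; apply: continuous_norm.
    by apply: continuous_pairl; exact: cK.
  have [y0 y0C y0max] := compact_EVT_max C0 cC cg0.
  exists (`|g (x0, y0)| + 1).
  have /compact_near_coveringP nC := cC.
  apply: (nC _ (nbhs x0) (fun x y => `|g (x, y)| <= `|g (x0, y0)| + 1)) => y Cy.
  have /cvgrPdist_lt/(_ 1 ltr01) := @cK vs (x0, y).
  move=> [[B1 B2] [/= n1 n2] sub]; exists (B2, B1) => // -[y' x] [/= By' Bx].
  have /= h := sub (x, y') (conj Bx By').
  have := y0max y (mem_set Cy) => /(le_trans _) h0.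
  rewrite -lerBlDr; apply: h0; rewrite lerBlDl.
  rewrite -[g (x, y')](subrK (g (x0, y))) (le_trans (ler_normD _ _))// lerD2r.
  by rewrite distrC ltW.
have /nbhs_ballP[e /= e0 He] := HM.
exists e => //; exists (fun t => M * `|u t|).
  by apply: rintegrableZ; exact: (integrable_norm iu).
move=> x t xx0; rewrite iter_derive_F normrM.
have [Ct|nCt] := pselect (C (iota t)); last by rewrite uC// normr0 !mulr0.
rewrite ler_wpM2r//; apply: He => //.
by rewrite -ball_normE /= distrC.
Unshelve. all: by end_near.
Qed.

Lemma kernel_integrable x : rintegrable mu (F x).
Proof. exact: (dominated_integrable x kernel_dominated). Qed.

Lemma rsmooth_kernel : rsmooth_on setT (fun x => \int[mu]_t (K (x, iota t) * u t)).
Proof.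
apply: (rsmooth_Rintegral c (F := F)); last exact: kernel_dominated.
move=> t vs x _; rewrite iter_derive_F.
apply: differentiableM; last exact: differentiable_cst.
by apply: differentiable_section; exact: sK.
Qed.

End smooth_kernel.

(** * Division by the coordinate differences *)

Section hadamard.
Context {R : realType} {n : nat}.
Local Notation rV := ('rV[R]_n).
Local Notation V := (rV * rV)%type.
Local Notation leb := (@lebesgue_measure R).

Let seg (z : V * R) : V := (z.1.1, z.1.1 + z.2 *: (z.1.2 - z.1.1)).

Let rsmooth_seg (g : V -> R) : rsmooth_on setT g -> rsmooth_on setT (g \o seg).
Proof.
move=> sg; apply: (rsmooth_comp (c := coords_prod (coords_rV n) (coords_rV n))
  (E := setT)) => //; [exact: openT|exact: openT|].
have sx (i : 'I_n) : rsmooth_on setT (fun z : V * R => z.1.1 0 i).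
  apply: (rsmooth_fst (f := fun z : V => z.1 0 i)).
  by apply: (rsmooth_fst (f := fun x : rV => x 0 i)); exact: (rsmooth_coord _ openT).
have sy (i : 'I_n) : rsmooth_on setT (fun z : V * R => z.1.2 0 i).
  apply: (rsmooth_fst (f := fun z : V => z.2 0 i)).
  by apply: (rsmooth_snd (f := fun x : rV => x 0 i)); exact: (rsmooth_coord _ openT).
have st : rsmooth_on setT (fun z : V * R => z.2).
  exact: (rsmooth_snd (rsmooth_id openT)).
case=> i; first exact: (sx i).
rewrite (_ : _ \o _ = fun z : V * R =>
    z.1.1 0 (i : 'I_n) + z.2 * (z.1.2 0 (i : 'I_n) - z.1.1 0 (i : 'I_n))).
  apply: rsmooth_add => //; first exact: openT.
  apply: rsmooth_mul => //; first exact: openT.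
  by apply: rsmooth_sub => //; exact: openT.
by apply/funext => z; rewrite /= !mxE.
Qed.

Let J : set R := `[0, 1]%classic.

(** Taylor's formula of order 0 with integral remainder on the segment from
    (x, x) to (x, y). *)
Lemma hadamard (f : V -> R) : rsmooth_on setT f -> (forall x, f (x, x) = 0) ->
  exists h : 'I_n -> V -> R, (forall j, rsmooth_on setT (h j)) /\
    forall x y, f (x, y) = \sum_j (x 0 j - y 0 j) * h j (x, y).
Proof.
move=> sf f0.
pose D j := 'D_((0, delta_mx 0 j) : V) f.
have sD j : rsmooth_on setT (D j \o seg) by exact/rsmooth_seg/rsmooth_derive.
have mJ : measurable (J : set (measurableTypeR R)) by exact: measurable_itv.
have mu_J : measurable_fun setT (\1_J : measurableTypeR R -> R).
  exact: measurable_indic.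
have iJ : rintegrable leb (\1_J : measurableTypeR R -> R).
  exact: integrable_indic_itv.
have mid (h : R -> R) : continuous h ->
    measurable_fun setT (fun t : measurableTypeR R => h (id t)).
  by move=> ch; exact: continuous_measurable_fun.
have J0 (t : measurableTypeR R) : ~ J (id t) -> \1_J t = 0 :> R.
  by move=> nJt; rewrite indicE memNset.
pose h j (z : V) := - \int[leb]_t ((D j \o seg) (z, t) * \1_J t).
exists h; split.
  move=> j; apply: rsmooth_opp; first exact: openT.
  exact: (rsmooth_kernel (coords_prod (coords_rV n) (coords_rV n)) mid mu_J iJ
    (@segment_compact R 0 1) J0 (sD j)).
move=> x y.
(* The fundamental theorem of calculus is applied to f along the segment. *)
pose phi (t : R) := f (seg ((x, y), t)).
pose phi' (t : R) := \sum_j (y 0 j - x 0 j) * (D j \o seg) ((x, y), t).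
have dphi (t : R) : is_derive t 1 phi (phi' t).
  pose line (s : R) : V := (x, x + s *: (y - x)).
  have df : differentiable f (line t) by exact: (sf [::]).
  have Df : is_derive (line t) (0, y - x) f ('D_(0, y - x) f (line t)).
    exact/derivableP/diff_derivable.
  have -> : phi' t = 'D_(0, y - x) f (line t).
    rewrite (derive_coords (coords_prod (coords_rV n) (coords_rV n)))// big_sumType/=.
    rewrite [X in X + _]big1 ?add0r => [|i _]; last by rewrite mxE mul0r.
    by apply: eq_bigr => i _; rewrite /= !mxE.
  apply: (is_derive_affine (phi := line) (w := (0, y - x) : V)) => s.
  rewrite -[RHS]/(s *: 0 + x, s *: (y - x) + (x + t *: (y - x))) scaler0 add0r.
  by rewrite /line [s *: 1]mulr1 scalerDl addrCA.
have cD j (z : V) : continuous (fun t : R => (D j \o seg) (z, t)).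
  move=> t; apply: differentiable_continuous.
  apply: (differentiable_comp (f := fun t : R => (z, t))) => //.
  exact: (sD j [::]).
have cphi' : continuous phi'.
  apply: continuous_sum => j; apply: continuous_mul; first exact: continuous_cst.
  exact: cD.
have FTC : (\int[leb]_(t in J) (phi' t)%:E = (phi 1)%:E - (phi 0)%:E)%E.
  apply: continuous_FTC2 => //.
  - by apply: continuous_subspaceT => t; exact: cphi'.
  - have cphi : continuous phi.
      by move=> t; apply: differentiable_continuous; apply/derivable1_diffP; case: (dphi t).
    split=> [t _||]; first by case: (dphi t).
    + by apply: cvg_at_right_filter; exact: cphi.
    + by apply: cvg_at_left_filter; exact: cphi.
  - by move=> t _; rewrite derive1E; case: (dphi t).
have phi1 : phi 1 = f (x, y) by rewrite /phi /seg/= scale1r addrC subrK.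
have phi0 : phi 0 = 0 by rewrite /phi /seg/= scale0r addr0 f0.
have E : f (x, y) = \int[leb]_(t in J) phi' t.
  by rewrite /Rintegral FTC phi1 phi0 sube0.
rewrite E Rintegral_mkcond.
have iDJ j : rintegrable leb (fun t : measurableTypeR R => (D j \o seg) ((x, y), t) * \1_J t).
  exact: (kernel_integrable mid mu_J iJ (@segment_compact R 0 1) J0 (sD j) (x, y)).
transitivity (\int[leb]_t (\sum_j (y 0 j - x 0 j) * ((D j \o seg) ((x, y), t) * \1_J t))).
  apply: eq_Rintegral => t _; rewrite patchE indicE.
  case: ifPn => _; first by apply: eq_bigr => j _; rewrite mulr1.
  by rewrite big1// => j _; rewrite !mulr0.
rewrite Rint_sum => [|j]; last exact: rintegrableZ.
apply: eq_bigr => j _; rewrite RintegralZl//; last exact: iDJ.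
by rewrite /h mulrN -mulNr opprB.
Qed.

End hadamard.

(** * Complex-valued functions and the Fourier transform *)

Section complex_parts.
Context {R : realType}.
Implicit Types a b : R[i].
Local Notation Re := (@complex.Re R).
Local Notation Im := (@complex.Im R).

Lemma cReM a b : Re (a * b) = Re a * Re b - Im a * Im b.
Proof. by case: a; case: b. Qed.
Lemma cImM a b : Im (a * b) = Re a * Im b + Im a * Re b.
Proof. by case: a; case: b. Qed.
Lemma cReD a b : Re (a + b) = Re a + Re b.
Proof. by case: a; case: b. Qed.
Lemma cImD a b : Im (a + b) = Im a + Im b.
Proof. by case: a; case: b. Qed.
Lemma cReN a : Re (- a) = - Re a.
Proof. by case: a. Qed.
Lemma cImN a : Im (- a) = - Im a.
Proof. by case: a. Qed.
Lemma eq_ReIm a b : Re a = Re b -> Im a = Im b -> a = b.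
Proof. by case: a => ? ?; case: b => ? ? /= -> ->. Qed.
Lemma expiD (s t : R) : expi (s + t) = expi s * expi t.
Proof.
by apply: eq_ReIm; rewrite ?cReM ?cImM /= ?cosD ?sinD// addrC [X in X + _]mulrC.
Qed.
Lemma expi0 : expi (0 : R) = 1.
Proof. by rewrite /expi cos0 sin0. Qed.
Definition reimE := (cReM, cImM, cReD, cImD, cReN, cImN).
End complex_parts.

Section complex_functions.
Context {R : realType} {n : nat}.
Local Notation rV := ('rV[R]_n).
Local Notation Re := (@complex.Re R).
Local Notation Im := (@complex.Im R).
Local Notation mu := (lebesgue_tuple R n).
Implicit Types (f g p : rV -> R[i]).

Section smooth_closure.
Context {V : normedModType R}.
Implicit Types F G : V -> R[i].

Lemma smooth_add F G : smooth F -> smooth G -> smooth (fun x => F x + G x).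
Proof.
move=> [F1 F2] [G1 G2]; split.
  rewrite (_ : (fun x => _) = fun x => Re (F x) + Re (G x)).
    exact: (rsmooth_add openT).
  by apply/funext => x; rewrite cReD.
rewrite (_ : (fun x => _) = fun x => Im (F x) + Im (G x)).
  exact: (rsmooth_add openT).
by apply/funext => x; rewrite cImD.
Qed.

Lemma smooth_mul F G : smooth F -> smooth G -> smooth (fun x => F x * G x).
Proof.
move=> [F1 F2] [G1 G2]; split.
  rewrite (_ : (fun x => _) = fun x => Re (F x) * Re (G x) - Im (F x) * Im (G x)).
    by apply: (rsmooth_sub openT); exact: (rsmooth_mul openT).
  by apply/funext => x; rewrite cReM.
rewrite (_ : (fun x => _) = fun x => Re (F x) * Im (G x) + Im (F x) * Re (G x)).
  by apply: (rsmooth_add openT); exact: (rsmooth_mul openT).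
by apply/funext => x; rewrite cImM.
Qed.

Lemma smooth_cst (k : R[i]) : smooth (fun _ : V => k).
Proof. by split; exact: (rsmooth_cst openT). Qed.
End smooth_closure.

Definition crapid g := rapid (fun x => Re (g x)) /\ rapid (fun x => Im (g x)).
Definition cmoderate p := moderate (fun x => Re (p x)) /\ moderate (fun x => Im (p x)).

Lemma rapid_opp (h : rV -> R) : rapid h -> rapid (fun x => - h x).
Proof.
move=> rh; rewrite (_ : (fun x => _) = fun x => -1 * h x).
  by apply: moderate_rapid => //; exact: moderate_cst.
by apply/funext => x; rewrite mulN1r.
Qed.

Lemma crapid_mul p g : cmoderate p -> crapid g -> crapid (fun x => p x * g x).
Proof.
move=> [p1 p2] [g1 g2]; split.
  rewrite (_ : (fun x => _) = fun x => Re (p x) * Re (g x) + - (Im (p x) * Im (g x))).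
    by apply: rapid_add; [|apply: rapid_opp]; exact: moderate_rapid.
  by apply/funext => x; rewrite cReM.
rewrite (_ : (fun x => _) = fun x => Re (p x) * Im (g x) + Im (p x) * Re (g x)).
  by apply: rapid_add; exact: moderate_rapid.
by apply/funext => x; rewrite cImM.
Qed.

Lemma crapid_add f g : crapid f -> crapid g -> crapid (fun x => f x + g x).
Proof.
move=> [f1 f2] [g1 g2]; split.
  rewrite (_ : (fun x => _) = fun x => Re (f x) + Re (g x)).
    exact: rapid_add.
  by apply/funext => x; rewrite cReD.
rewrite (_ : (fun x => _) = fun x => Im (f x) + Im (g x)).
  exact: rapid_add.
by apply/funext => x; rewrite cImD.
Qed.

Lemma cmoderate_cst (k : R[i]) : cmoderate (fun=> k).
Proof. by split; exact: moderate_cst. Qed.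

Lemma cmoderate_real (q : rV -> R) : moderate q -> cmoderate (fun x => (q x)%:C).
Proof. by move=> mq; split => //=; exact: moderate_cst. Qed.

Lemma sinE (t : R) : sin t = cos (t + - (pi / 2)).
Proof. by rewrite -cosN opprD opprK cosDpihalf sinN opprK. Qed.

Lemma cmoderate_expi x : cmoderate (fun xi => expi (dot x xi)).
Proof.
split=> /=.
  rewrite (_ : (fun x => _) = fun xi => cos (dot x xi + 0)); first exact: moderate_wave.
  by apply/funext => xi; rewrite addr0.
rewrite (_ : (fun x => _) = fun xi => cos (dot x xi + - (pi / 2))); first exact: moderate_wave.
by apply/funext => xi; rewrite sinE.
Qed.

Lemma int_rVE (h : rV -> R) : int_rV h = \int[mu]_t h (rowt t).
Proof. by []. Qed.

Lemma rapid_integrable (h : rV -> R) : rapid h ->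
  rintegrable mu (fun t => h (rowt t)).
Proof. by move=> /rapid_wdom; exact: wdom_integrable. Qed.

Lemma cintD f g : crapid f -> crapid g ->
  cint_rV (fun x => f x + g x) = cint_rV f + cint_rV g.
Proof.
move=> [f1 f2] [g1 g2]; apply: eq_ReIm; rewrite /cint_rV /= !int_rVE.
  rewrite -(RintegralD measurableT (rapid_integrable f1) (rapid_integrable g1)).
  by apply: eq_Rintegral => t _; rewrite cReD.
rewrite -(RintegralD measurableT (rapid_integrable f2) (rapid_integrable g2)).
by apply: eq_Rintegral => t _; rewrite cImD.
Qed.

Lemma cintZ (k : R[i]) g : crapid g -> cint_rV (fun x => k * g x) = k * cint_rV g.
Proof.
move=> [/rapid_integrable g1 /rapid_integrable g2].
apply: eq_ReIm; rewrite reimE /cint_rV /= !int_rVE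
  -!(RintegralZl _ measurableT g1) -!(RintegralZl _ measurableT g2).
  rewrite -(RintegralB measurableT (rintegrableZ _ g1) (rintegrableZ _ g2)).
  by apply: eq_Rintegral => t _; rewrite cReM.
rewrite -(RintegralD measurableT (rintegrableZ _ g2) (rintegrableZ _ g1)).
by apply: eq_Rintegral => t _; rewrite cImM.
Qed.

Lemma eq_cint f g : f =1 g -> cint_rV f = cint_rV g.
Proof. by move=> /funext ->. Qed.

Lemma cint_sum (I : Type) (r : seq I) (F : I -> rV -> R[i]) :
  (forall i, crapid (F i)) ->
  cint_rV (fun x => \sum_(i <- r) F i x) = \sum_(i <- r) cint_rV (F i).
Proof.
move=> rF.
have rs (s : seq I) : crapid (fun x => \sum_(i <- s) F i x).
  elim: s => [|i s IH].
    rewrite (_ : (fun x => _) = fun=> 0).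
      split; apply: (@compact_rapid _ _ _ set0) => //;
        try exact: continuous_cst; exact: compact0.
    by apply/funext => x; rewrite big_nil.
  rewrite (_ : (fun x => _) = fun x => F i x + \sum_(i <- s) F i x).
    exact: crapid_add.
  by apply/funext => x; rewrite big_cons.
elim: r => [|i r IH].
  rewrite big_nil (eq_cint (g := fun=> 0)); last by move=> x; rewrite big_nil.
  by apply: eq_ReIm; rewrite /cint_rV/= int_rVE Rintegral_cst// mul0r.
rewrite big_cons -IH -cintD//; apply: eq_cint => x; by rewrite big_cons.
Qed.

Definition ctest (u : rV -> R[i]) :=
  rtest (fun x => Re (u x)) /\ rtest (fun x => Im (u x)).

Lemma test_fun_ctest u : test_fun u -> ctest u.
Proof.
move=> [[s1 s2] cK].
have uK x : ~ closure [set x | u x != 0] x -> u x = 0.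
  move=> nx; apply/eqP/negP => /negP ux; apply: nx; exact: subset_closure.
by split; split=> //; exists (closure [set x | u x != 0]) => // x /uK ->.
Qed.

Lemma ctest_crapid u : ctest u -> crapid u.
Proof. by move=> [u1 u2]; split; exact: rtest_rapid. Qed.

Lemma ctest_mul u f : ctest u -> smooth f -> ctest (fun x => f x * u x).
Proof.
move=> [u1 u2] [f1 f2]; split.
  rewrite (_ : (fun x => _) = fun x => - Im (f x) * Im (u x) + Re (f x) * Re (u x)).
    by apply: rtest_add; apply: rtest_mul => //; exact: (rsmooth_opp openT).
  by apply/funext => x; rewrite cReM addrC mulNr.
rewrite (_ : (fun x => _) = fun x => Re (f x) * Im (u x) + Im (f x) * Re (u x)).
  by apply: rtest_add; exact: rtest_mul.
by apply/funext => x; rewrite cImM.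
Qed.

Lemma smooth_coord (j : 'I_n) : smooth (fun x : rV => (x 0 j)%:C).
Proof.
by split=> /=; [exact: (rsmooth_coord _ openT)|exact: (rsmooth_cst openT)].
Qed.

Lemma ctest_coord u j : ctest u -> ctest (mul_coord j u).
Proof. by move=> tu; apply: ctest_mul => //; exact: smooth_coord. Qed.

Lemma Re_fourier u xi : ctest u -> Re (fourier u xi) =
  ctrans 0 (fun x => Re (u x)) xi + ctrans (- (pi / 2)) (fun x => Im (u x)) xi.
Proof.
move=> /ctest_crapid[u1 u2]; rewrite /fourier /cint_rV /= int_rVE.
rewrite -(RintegralD measurableT (ctrans_integrable _ _ u1) (ctrans_integrable _ _ u2)).
apply: eq_Rintegral => t _; rewrite cReM /= cosN sinN mulNr opprK addr0.
by rewrite dotC -sinE.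
Qed.

Lemma Im_fourier u xi : ctest u -> Im (fourier u xi) =
  ctrans 0 (fun x => Im (u x)) xi - ctrans (- (pi / 2)) (fun x => Re (u x)) xi.
Proof.
move=> /ctest_crapid[u1 u2]; rewrite /fourier /cint_rV /= int_rVE.
rewrite -(RintegralB measurableT (ctrans_integrable _ _ u2) (ctrans_integrable _ _ u1)).
apply: eq_Rintegral => t _; rewrite cImM /= cosN sinN mulNr addr0.
by rewrite dotC -sinE.
Qed.

Lemma crapid_fourier u : ctest u -> crapid (fourier u).
Proof.
move=> tu; have [u1 u2] := tu; split.
  rewrite (_ : (fun x => _) = fun xi => ctrans 0 (fun x => Re (u x)) xi +
      ctrans (- (pi / 2)) (fun x => Im (u x)) xi).
    by apply: rapid_add; exact: rapid_ctrans.
  by apply/funext => xi; exact: Re_fourier.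
rewrite (_ : (fun x => _) = fun xi => ctrans 0 (fun x => Im (u x)) xi +
    - ctrans (- (pi / 2)) (fun x => Re (u x)) xi).
  by apply: rapid_add; [|apply: rapid_opp]; exact: rapid_ctrans.
by apply/funext => xi; exact: Im_fourier.
Qed.

Definition inv_fourier g (x : rV) : R[i] :=
  cint_rV (fun xi => expi (dot x xi) * g xi).

Lemma smooth_inv_fourier g : crapid g -> smooth (inv_fourier g).
Proof.
move=> [g1 g2]; split.
  rewrite (_ : (fun x => _) = fun x => ctrans 0 (fun xi => Re (g xi)) x -
      ctrans (- (pi / 2)) (fun xi => Im (g xi)) x).
    by apply: (rsmooth_sub openT); exact: rsmooth_ctrans.
  apply/funext => x; rewrite /inv_fourier /cint_rV /= int_rVE.
  rewrite -(RintegralB measurableT (ctrans_integrable _ _ g1) (ctrans_integrable _ _ g2)).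
  by apply: eq_Rintegral => t _; rewrite cReM /= addr0 -sinE.
rewrite (_ : (fun x => _) = fun x => ctrans 0 (fun xi => Im (g xi)) x +
    ctrans (- (pi / 2)) (fun xi => Re (g xi)) x).
  by apply: (rsmooth_add openT); exact: rsmooth_ctrans.
apply/funext => x; rewrite /inv_fourier /cint_rV /= int_rVE.
rewrite -(RintegralD measurableT (ctrans_integrable _ _ g2) (ctrans_integrable _ _ g1)).
by apply: eq_Rintegral => t _; rewrite cImM /= addr0 -sinE.
Qed.

Definition cder (v : rV) f f' := forall x,
  is_derive x v (fun y => Re (f y)) (Re (f' x)) /\
  is_derive x v (fun y => Im (f y)) (Im (f' x)).

Lemma cderM v f f' g g' : cder v f f' -> cder v g g' ->
  cder v (fun x => f x * g x) (fun x => f' x * g x + f x * g' x).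
Proof.
move=> df dg x; have [f1 f2] := df x; have [g1 g2] := dg x; split.
  rewrite (_ : (fun y => _) = fun y => Re (f y) * Re (g y) - Im (f y) * Im (g y)).
    apply: is_derive_eq (is_deriveB (is_deriveM f1 g1) (is_deriveM f2 g2)) _.
    rewrite !reimE -![_ *: _]/(_ * _); ring.
  by apply/funext => y; rewrite cReM.
rewrite (_ : (fun y => _) = fun y => Re (f y) * Im (g y) + Im (f y) * Re (g y)).
  apply: is_derive_eq (is_deriveD (is_deriveM f1 g2) (is_deriveM f2 g1)) _.
  rewrite !reimE -![_ *: _]/(_ * _); ring.
by apply/funext => y; rewrite cImM.
Qed.

Lemma cder_expi x j : cder (delta_mx 0 j) (fun xi => expi (dot x xi))
  (fun xi => (0 +i* x 0 j) * expi (dot x xi)).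
Proof.
move=> xi.
have h a : is_derive xi (delta_mx 0 j) (fun y => cos (dot x y + a))
    (x 0 j * cos (dot x xi + (a + pi / 2))).
  rewrite (_ : (fun y => _) = fun y => cos (dot y x + a)); last first.
    by apply/funext => y; rewrite dotC.
  apply: is_derive_eq (is_derive_wave x a xi (delta_mx 0 j)) _.
  by rewrite dot_delta dotC.
split.
  rewrite (_ : (fun y => _) = fun y => cos (dot x y + 0)); last first.
    by apply/funext => y; rewrite addr0.
  by apply: is_derive_eq (h 0) _; rewrite !reimE /= add0r cosDpihalf; ring.
rewrite (_ : (fun y => _) = fun y => cos (dot x y + - (pi / 2))); last first.
  by apply/funext => y /=; rewrite sinE.
by apply: is_derive_eq (h _) _; rewrite !reimE /= addNr addr0; ring.
Qed.

Lemma cder_real j (q : rV -> R) : rsmooth_on setT q ->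
  cder (delta_mx 0 j) (fun x => (q x)%:C) (fun x => ('D_(delta_mx 0 j) q x)%:C).
Proof.
move=> sq x; split => /=; last exact: is_derive_cst.
by apply/derivableP/diff_derivable; exact: (sq [::]).
Qed.

Lemma cder_fourier u j : ctest u -> cder (delta_mx 0 j) (fourier u)
  (fun xi => (0 +i* -1) * fourier (mul_coord j u) xi).
Proof.
move=> tu xi; have tju := ctest_coord j tu.
have [u1 u2] := ctest_crapid tu.
have [ju1 ju2] := ctest_crapid tju.
have dct a (w : rV -> R) : rapid w ->
    is_derive xi (delta_mx 0 j) (ctrans a w)
      (ctrans (a + pi / 2) (fun y => y 0 j * w y) xi).
  move=> rw; have -> : ctrans (a + pi / 2) (fun y => y 0 j * w y) xi =
      'D_(delta_mx 0 j) (ctrans a w) xi.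
    rewrite derive_ctrans//; congr (ctrans _ _ _).
    by apply/funext => y; rewrite dot_delta.
  apply/derivableP/diff_derivable; exact: (rsmooth_ctrans a rw [::]).
have jE1 : (fun y : rV => y 0 j * Re (u y)) = (fun y => Re (mul_coord j u y)).
  by apply/funext => y; rewrite /mul_coord !reimE /= mul0r subr0.
have jE2 : (fun y : rV => y 0 j * Im (u y)) = (fun y => Im (mul_coord j u y)).
  by apply/funext => y; rewrite /mul_coord !reimE /= mul0r addr0.
have flip (w : rV -> R) : rapid w ->
    ctrans (0 + pi / 2) w xi = - ctrans (- (pi / 2)) w xi.
  move=> rw; have -> : - (pi / 2) = (0 + pi / 2) - pi :> R by field.
  rewrite ctransN (_ : (fun y => _) = fun y => -1 * w y); last first.
    by apply/funext => y; rewrite mulN1r.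
  by rewrite ctransZ// mulN1r opprK.
split.
  rewrite (_ : (fun y => _) = ctrans 0 (fun x => Re (u x)) +
      ctrans (- (pi / 2)) (fun x => Im (u x))); last first.
    by apply/funext => y; rewrite Re_fourier.
  apply: is_derive_eq (is_deriveD (dct 0 _ u1) (dct _ _ u2)) _.
  rewrite !reimE Re_fourier// Im_fourier//= jE1 jE2 flip// addNr; ring.
rewrite (_ : (fun y => _) = ctrans 0 (fun x => Im (u x)) -
    ctrans (- (pi / 2)) (fun x => Re (u x))); last first.
  by apply/funext => y; rewrite Im_fourier.
apply: is_derive_eq (is_deriveB (dct 0 _ u2) (dct _ _ u1)) _.
rewrite !reimE Re_fourier// Im_fourier//= jE1 jE2 flip// addNr; ring.
Qed.

Lemma cint_cder_eq0 j g g' : crapid g -> crapid g' ->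
  cder (delta_mx 0 j) g g' -> cint_rV g' = 0.
Proof.
move=> [g1 g2] [g1' g2'] dg; apply: eq_ReIm; rewrite /cint_rV /= int_rVE /Rintegral.
  by rewrite (integral_derive_eq0 (rapid_wdom g1) (rapid_wdom g1') (fun x => (dg x).1)).
by rewrite (integral_derive_eq0 (rapid_wdom g2) (rapid_wdom g2') (fun x => (dg x).2)).
Qed.

End complex_functions.

(** * Commutators of coordinates and multipliers *)

Section fubini.
Context {R : realType} {n : nat}.
Local Notation rV := ('rV[R]_n).
Local Notation V := (rV * rV)%type.
Local Notation mu := (lebesgue_tuple R n).
Local Notation Re := (@complex.Re R).
Local Notation Im := (@complex.Im R).

(** The product of the two weights is integrable on the product space, so
    Fubini's theorem applies. *)
Lemma int_swap (H : V -> R) (C : R) : continuous H ->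
  (forall x y, `|H (x, y)| <= C * (wgt x * wgt y)) ->
  \int[mu]_s (\int[mu]_t H (rowt s, rowt t)) =
  \int[mu]_t (\int[mu]_s H (rowt s, rowt t)).
Proof.
move=> cH HC.
have wd x : wdom (fun y => H (x, y)).
  split; first exact: continuous_pairl.
  by exists (C * wgt x) => y; rewrite -mulrA.
have wd' y : wdom (fun x => H (x, y)).
  split; first exact: continuous_pairr.
  by exists (C * wgt y) => x; rewrite (le_trans (HC _ _))// -mulrA [wgt y * _]mulrC.
pose G (z : n.-tuple (measurableTypeR R) * n.-tuple (measurableTypeR R)) :=
  (H (rowt z.1, rowt z.2))%:E.
have mG : measurable_fun setT G.
  apply/measurable_EFinP.
  apply: (measurable_continuous (c := coords_prod (coords_rV n) (coords_rV n))
    (iota := fun z => (rowt z.1, rowt z.2))) => // -[i|i] /=.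
  - rewrite (_ : (fun z => _) = (fun t => tnth t (i : 'I_n)) \o fst); last first.
      by apply/funext => z; rewrite /= mxE.
    by apply: measurableT_comp => //; exact: measurable_tnth.
  - rewrite (_ : (fun z => _) = (fun t => tnth t (i : 'I_n)) \o snd); last first.
      by apply/funext => z; rewrite /= mxE.
    by apply: measurableT_comp => //; exact: measurable_tnth.
have iG : (mu \x mu)%E.-integrable setT G.
  apply/integrable12ltyP => //; rewrite /G /=.
  have C0 : 0 <= C.
    have := le_trans (normr_ge0 _) (HC 0 0).
    by rewrite pmulr_lge0// mulr_gt0// wgt_gt0.
  pose w (t : n.-tuple (measurableTypeR R)) : R := wgt (rowt t).
  have iw : rintegrable mu w by exact: integrable_wgt.
  pose W := \int[mu]_t w t.
  have Hle s : (\int[mu]_t `|(H (rowt s, rowt t))%:E| <= ((C * W) * w s)%:E)%E.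
    have iCw : rintegrable mu (fun t => (C * w s) * w t) by exact: rintegrableZ.
    have -> : ((C * W) * w s)%:E = (\int[mu]_t ((C * w s) * w t)%:E)%E.
      rewrite -[RHS]fineK; last exact: (integrable_fin_num measurableT iCw).
      rewrite -[fine _]/(Rintegral mu setT (fun t => (C * w s) * w t)).
      by rewrite (RintegralZl _ measurableT iw) mulrAC.
    apply: ge0_le_integral => //.
    - apply: measurableT_comp => //; exact: measurable_int (wdom_integrable (wd _)).
    - exact: measurable_int iCw.
    - by move=> t _; rewrite /= lee_fin -mulrA; exact: HC.
  have iCW : rintegrable mu (fun s => (C * W) * w s) by exact: rintegrableZ.
  apply: (@le_lt_trans _ _ (\int[mu]_s ((C * W) * w s)%:E)%E).
    apply: ge0_le_integral => //.
    - by move=> s _; exact: integral_ge0.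
    - apply: (measurable_fun_fubini_tonelli_F (fun z => `|G z|)%E) => //.
      exact: measurableT_comp.
    - exact: measurable_int iCW.
    - by move=> s _; exact: Hle.
  exact: (integrable_lty measurableT iCW).
have inner1 s : (\int[mu]_t (H (rowt s, rowt t))%:E)%E =
    (\int[mu]_t H (rowt s, rowt t))%:E.
  by rewrite /Rintegral fineK//; exact: (integrable_fin_num measurableT (wdom_integrable (wd _))).
have inner2 t : (\int[mu]_s (H (rowt s, rowt t))%:E)%E =
    (\int[mu]_s H (rowt s, rowt t))%:E.
  by rewrite /Rintegral fineK//; exact: (integrable_fin_num measurableT (wdom_integrable (wd' _))).
have := Fubini iG; rewrite /G /=.
under eq_integral do rewrite inner1.
under [X in _ = X -> _]eq_integral do rewrite inner2.
by move=> E; rewrite /Rintegral E.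
Qed.

Lemma cint_swap (H : V -> R[i]) (C : R) :
  continuous (fun z => Re (H z)) -> continuous (fun z => Im (H z)) ->
  (forall x y, `|Re (H (x, y))| <= C * (wgt x * wgt y)) ->
  (forall x y, `|Im (H (x, y))| <= C * (wgt x * wgt y)) ->
  cint_rV (fun x => cint_rV (fun y => H (x, y))) =
  cint_rV (fun y => cint_rV (fun x => H (x, y))).
Proof.
move=> c1 c2 b1 b2; apply: eq_ReIm; rewrite /cint_rV/= !int_rVE.
  exact: (int_swap c1 b1).
exact: (int_swap c2 b2).
Qed.

Lemma rapid_bound (f : rV -> R) : rapid f -> exists2 C, 0 <= C & forall x, `|f x| <= C * wgt x.
Proof.
move=> /rapid_wdom[_ [C HC]]; exists C => //.
have := le_trans (normr_ge0 _) (HC 0).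
by rewrite pmulr_lge0// wgt_gt0.
Qed.

(** Both sides are iterated integrals of one function of (xi, y), which decays in
    xi because r does and in y because u does. *)
Lemma inv_fourier_mul (r : rV -> R) (u : rV -> R[i]) x :
  rapid r -> ctest u ->
  inv_fourier (fun xi => (r xi)%:C * fourier u xi) x =
  cint_rV (fun y => inv_fourier (fun xi => (r xi)%:C) (x - y) * u y).
Proof.
move=> rr tu.
have ru := ctest_crapid tu.
have rrC : crapid (fun xi => (r xi)%:C).
  split=> //=; apply: (@compact_rapid _ _ _ set0) => //; last exact: compact0.
  exact: continuous_cst.
pose H (z : V) : R[i] := expi (dot (x - z.2) z.1) * ((r z.1)%:C * u z.2).
have -> : inv_fourier (fun xi => (r xi)%:C * fourier u xi) x =
    cint_rV (fun xi => cint_rV (fun y => H (xi, y))).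
  apply: eq_cint => xi; rewrite mulrA /fourier -cintZ; last first.
    rewrite (_ : (fun y => _) = fun y => expi (dot (- xi) y) * u y).
      by apply: crapid_mul => //; exact: cmoderate_expi.
    by apply/funext => y; rewrite dotNl dotC.
  apply: eq_cint => y; rewrite /H /=.
  have -> : dot (x - y) xi = dot x xi + - dot y xi by rewrite dotDl dotNl.
  rewrite expiD; ring.
have [C1 C10 HC1] := rapid_bound rr.
have [C2 C20 HC2] := rapid_bound ru.1.
have [C3 C30 HC3] := rapid_bound ru.2.
pose a (z : V) := r z.1 * Re (u z.2).
pose b (z : V) := r z.1 * Im (u z.2).
pose ph (z : V) := dot (x - z.2) z.1.
have ReH : (fun z => Re (H z)) = fun z => cos (ph z) * a z - sin (ph z) * b z.
  by apply/funext => z; rewrite /H !reimE /= /a /b; ring.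
have ImH : (fun z => Im (H z)) = fun z => cos (ph z) * b z + sin (ph z) * a z.
  by apply/funext => z; rewrite /H !reimE /= /a /b; ring.
have cfst (h : rV -> R) : continuous h -> continuous (fun z : V => h z.1).
  by move=> ch z; apply: (@continuous_comp _ _ _ fst h); [exact: cvg_fst|exact: ch].
have csnd (h : rV -> R) : continuous h -> continuous (fun z : V => h z.2).
  by move=> ch z; apply: (@continuous_comp _ _ _ snd h); [exact: cvg_snd|exact: ch].
have ca : continuous a.
  by apply: continuous_mul; [exact: (cfst _ rr.1)|exact: (csnd _ ru.1.1)].
have cb : continuous b.
  by apply: continuous_mul; [exact: (cfst _ rr.1)|exact: (csnd _ ru.2.1)].
have cph : continuous ph.
  apply: continuous_sum => i; apply: continuous_mul.
    apply: (csnd (fun y : rV => (x - y) 0 i)).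
    rewrite (_ : (fun y => _) = fun y : rV => x 0 i + -1 * y 0 i).
      apply: (continuous_add (f := fun=> x 0 i)); first exact: continuous_cst.
      by apply: continuous_mul; [exact: continuous_cst|exact: continuous_coord].
    by apply/funext => y; rewrite !mxE mulN1r.
  by apply: (cfst (fun xi : rV => xi 0 i)); exact: continuous_coord.
have ccos : continuous (fun z => cos (ph z)).
  by move=> z; apply: continuous_comp; [exact: cph|exact: continuous_cos].
have csin : continuous (fun z => sin (ph z)).
  by move=> z; apply: continuous_comp; [exact: cph|exact: continuous_sin].
have bound (s t : R) xi y : `|s| <= 1 -> `|t| <= 1 ->
    `|s * a (xi, y)| + `|t * b (xi, y)| <= C1 * (C2 + C3) * (wgt xi * wgt y) /\
    `|t * b (xi, y)| + `|s * a (xi, y)| <= C1 * (C2 + C3) * (wgt xi * wgt y).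
  move=> s1 t1.
  have h : `|s * a (xi, y)| + `|t * b (xi, y)| <= C1 * (C2 + C3) * (wgt xi * wgt y).
    apply: (@le_trans _ _ ((C1 * wgt xi) * (C2 * wgt y) + (C1 * wgt xi) * (C3 * wgt y))).
      by apply: lerD; rewrite normrM (le_trans (ler_piMl _ _))// normrM ler_pM.
    by rewrite [leRHS](_ : _ = (C1 * wgt xi) * (C2 * wgt y) + (C1 * wgt xi) * (C3 * wgt y))//; ring.
  by split=> //; rewrite addrC.
have trig1 t : `|cos t| <= 1 :> R by rewrite ler_norml cos_geN1 cos_le1.
have trig2 t : `|sin t| <= 1 :> R by rewrite ler_norml sin_geN1 sin_le1.
rewrite (@cint_swap _ (C1 * (C2 + C3))); last 4 first.
- rewrite ReH => z.
  apply: (@continuousB _ _ _ (fun z => cos (ph z) * a z) (fun z => sin (ph z) * b z) z).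
    by apply: continuous_mul; [exact: ccos|exact: ca].
  by apply: continuous_mul; [exact: csin|exact: cb].
- rewrite ImH; apply: continuous_add; apply: continuous_mul => //.
- move=> xi y; rewrite -[Re _]/((fun z => Re (H z)) (xi, y)) ReH.
  rewrite (le_trans (ler_normB _ _))//.
  by have [] := bound _ _ xi y (trig1 (ph (xi, y))) (trig2 (ph (xi, y))).
- move=> xi y; rewrite -[Im _]/((fun z => Im (H z)) (xi, y)) ImH.
  rewrite (le_trans (ler_normD _ _))//.
  by have [] := bound _ _ xi y (trig2 (ph (xi, y))) (trig1 (ph (xi, y))).
apply: eq_cint => y; rewrite mulrC -cintZ.
  by apply: eq_cint => xi; rewrite /H /=; ring.
by apply: crapid_mul => //; exact: cmoderate_expi.
Qed.

(** Integration by parts in xi_j: the exponential yields the factor x_j, the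
    transform of u the multiplication of u by its coordinate, and rho_j the left
    hand side. *)
Lemma commutator_multiplier j (u : rV -> R[i]) x : ctest u ->
  inv_fourier (fun xi => ('D_(delta_mx 0 j) (rho j) xi)%:C * fourier u xi) x =
  (0 +i* -1) * ((x 0 j)%:C * inv_fourier (fun xi => (rho j xi)%:C * fourier u xi) x
   - inv_fourier (fun xi => (rho j xi)%:C * fourier (mul_coord j u) xi) x).
Proof.
move=> tu; have rU := crapid_fourier tu.
have tju := ctest_coord j tu; have rUj := crapid_fourier tju.
pose e xi := expi (dot x xi).
pose q xi : R[i] := (rho j xi)%:C.
pose q' xi : R[i] := ('D_(delta_mx 0 j) (rho j) xi)%:C.
have me : cmoderate e by exact: cmoderate_expi.
have mq : cmoderate q by apply: cmoderate_real; exact: moderate_rho.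
have mq' : cmoderate q' by apply: cmoderate_real; exact: moderate_derive_rho.
pose A1 xi := e xi * (q xi * fourier u xi).
pose A2 xi := e xi * (q' xi * fourier u xi).
pose A3 xi := e xi * (q xi * fourier (mul_coord j u) xi).
have r1 : crapid A1 by apply: crapid_mul => //; exact: crapid_mul.
have r2 : crapid A2 by apply: crapid_mul => //; exact: crapid_mul.
have r3 : crapid A3 by apply: crapid_mul => //; exact: crapid_mul.
have r1' : crapid (fun xi => (0 +i* x 0 j) * A1 xi).
  by apply: crapid_mul => //; exact: cmoderate_cst.
have r3' : crapid (fun xi => (0 +i* -1) * A3 xi).
  by apply: crapid_mul => //; exact: cmoderate_cst.
pose G' xi := (0 +i* x 0 j) * e xi * (q xi * fourier u xi) +
  e xi * (q' xi * fourier u xi + q xi * ((0 +i* -1) * fourier (mul_coord j u) xi)).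
have dG : cder (delta_mx 0 j) A1 G'.
  apply: cderM; first exact: cder_expi.
  by apply: cderM; [exact/cder_real/rsmooth_rho|exact: cder_fourier].
have G'E : G' = fun xi => (0 +i* x 0 j) * A1 xi + (A2 xi + (0 +i* -1) * A3 xi).
  by apply/funext => xi; rewrite /G' /A1 /A2 /A3 /e /q /q'; ring.
have rG' : crapid G'.
  by rewrite G'E; apply: crapid_add => //; exact: crapid_add.
have := cint_cder_eq0 r1 rG' dG.
rewrite G'E cintD//; last exact: crapid_add.
rewrite cintD// !cintZ//.
rewrite -[cint_rV A1]/(inv_fourier _ x) -[cint_rV A2]/(inv_fourier _ x)
  -[cint_rV A3]/(inv_fourier _ x).
set I1 := inv_fourier _ x; set I2 := inv_fourier _ x; set I3 := inv_fourier _ x.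
move=> /eqP; rewrite addrC -addrA addr_eq0 => /eqP ->.
have -> : (0 +i* x 0 j : R[i]) = (0 +i* 1) * (x 0 j)%:C.
  by apply: eq_ReIm; rewrite !reimE /=; ring.
have -> : (0 +i* -1 : R[i]) = - (0 +i* 1).
  by apply: eq_ReIm; rewrite !reimE /=; ring.
ring.
Qed.

End fubini.

(** * Smoothing operators as sums of commutators *)

Section operators.
Context {R : realType} {n : nat}.
Local Notation rV := ('rV[R]_n).
Local Notation V := (rV * rV)%type.
Local Notation mu := (lebesgue_tuple R n).
Local Notation Re := (@complex.Re R).
Local Notation Im := (@complex.Im R).
Implicit Types (k : V -> R[i]) (u a : rV -> R[i]) (x : rV).

Lemma rsmooth_kernel_test (g : V -> R) (w : rV -> R) :
  rsmooth_on setT g -> rtest w ->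
  rsmooth_on setT (fun x => \int[mu]_t (g (x, rowt t) * w (rowt t))).
Proof.
move=> sg tw; have [sw [K cK wK]] := tw; have rw := rtest_rapid tw.
apply: (rsmooth_kernel (coords_rV n) (iota := @rowt R n) (u := fun t => w (rowt t))
  _ _ _ cK) => //.
- by move=> h ch; exact: measurable_rowt.
- exact: measurable_rowt rw.1.
- exact: rapid_integrable.
- by move=> t; exact: wK.
Qed.

Lemma rapid_kernel_test (g : V -> R) (w : rV -> R) x :
  rsmooth_on setT g -> rtest w -> rapid (fun y => g (x, y) * w y).
Proof.
move=> sg tw; have [sw [K cK wK]] := tw; have rw := rtest_rapid tw.
apply: (@compact_rapid _ _ _ K) => // [|y /wK ->]; last by rewrite mulr0.
apply: continuous_mul; last exact: rw.1.
by apply: continuous_pairl => z; exact: (rsmooth_continuous sg).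
Qed.

Lemma crapid_kernel k u x : smooth k -> ctest u ->
  crapid (fun y => k (x, y) * u y).
Proof.
move=> [k1 k2] [u1 u2]; split.
  rewrite (_ : (fun y => _) = fun y => Re (k (x, y)) * Re (u y) + - (Im (k (x, y)) * Im (u y))).
    apply: rapid_add; [|apply: rapid_opp].
      exact: (rapid_kernel_test x k1 u1).
    exact: (rapid_kernel_test x k2 u2).
  by apply/funext => y; rewrite cReM.
rewrite (_ : (fun y => _) = fun y => Re (k (x, y)) * Im (u y) + Im (k (x, y)) * Re (u y)).
  apply: rapid_add; [exact: (rapid_kernel_test x k1 u2)|exact: (rapid_kernel_test x k2 u1)].
by apply/funext => y; rewrite cImM.
Qed.

Lemma smoothing_kernel_op k : smooth k -> smoothing (kernel_op k).
Proof.
move=> sk; split; last by exists k.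
move=> u /test_fun_ctest[u1 u2]; have [k1 k2] := sk.
have i11 x := rapid_integrable (rapid_kernel_test x k1 u1).
have i12 x := rapid_integrable (rapid_kernel_test x k1 u2).
have i21 x := rapid_integrable (rapid_kernel_test x k2 u1).
have i22 x := rapid_integrable (rapid_kernel_test x k2 u2).
split.
  rewrite (_ : (fun x => _) = fun x =>
      \int[mu]_t (Re (k (x, rowt t)) * Re (u (rowt t))) -
      \int[mu]_t (Im (k (x, rowt t)) * Im (u (rowt t)))).
    apply: (rsmooth_sub openT).
      exact: (rsmooth_kernel_test k1 u1).
    exact: (rsmooth_kernel_test k2 u2).
  apply/funext => x; rewrite /kernel_op /cint_rV /= int_rVE.
  rewrite -(RintegralB measurableT (i11 x) (i22 x)).
  by apply: eq_Rintegral => t _; rewrite cReM.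
rewrite (_ : (fun x => _) = fun x =>
    \int[mu]_t (Re (k (x, rowt t)) * Im (u (rowt t))) +
    \int[mu]_t (Im (k (x, rowt t)) * Re (u (rowt t)))).
  apply: (rsmooth_add openT).
    exact: (rsmooth_kernel_test k1 u2).
  exact: (rsmooth_kernel_test k2 u1).
apply/funext => x; rewrite /kernel_op /cint_rV /= int_rVE.
rewrite -(RintegralD measurableT (i12 x) (i21 x)).
by apply: eq_Rintegral => t _; rewrite cImM.
Qed.

Lemma commutator_kernel_op k j u x : smooth k -> ctest u ->
  commutator (mul_coord j) (kernel_op k) u x =
  cint_rV (fun y => (x 0 j - y 0 j)%:C * k (x, y) * u y).
Proof.
move=> sk tu; rewrite /commutator {1}/mul_coord /kernel_op.
have rk := crapid_kernel x sk tu.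
have rkj := crapid_kernel x sk (ctest_coord j tu).
rewrite -cintZ// -[X in _ - X]mul1r -mulNr -cintZ// -cintD; last first.
- by apply: crapid_mul => //; exact: cmoderate_cst.
- by apply: crapid_mul => //; exact: cmoderate_cst.
apply: eq_cint => y; rewrite /mul_coord rmorphB/=; ring.
Qed.

Local Notation p := (- (n%:R / 2) : R).

(** The factor -i compensates the i in the symbol i dp/dxi_j of [x_j, p(x, D)];
    the coefficient a is left free to prescribe a kernel on the diagonal. *)
Definition psym a (j : 'I_n) (z : V) : R[i] := a z.1 * (0 +i* - rho j z.2).

(** The field before the cut-off. *)
Let rho0 (j : 'I_n) (xi : rV) : R := xi 0 j * dot xi xi `^ p.

Let homogeneous_rho0 j (xi : rV) (t : R) : 0 < t ->
  rho0 j (t *: xi) = t ^ (- n%:Z + 1) * rho0 j xi.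
Proof.
move=> t0; rewrite /rho0 dotZl dotC dotZl mulrA mxE.
rewrite powRM ?mulr_ge0 ?dot_ge0 ?ltW//.
have -> : (t * t) `^ p = t ^ (- n%:Z).
  rewrite -expr2 -powR_mulrn ?ltW// -powRrM.
  have -> : 2%:R * p = - n%:R by field.
  by rewrite powR_invn ?ltW// -exprnN.
rewrite expfzDr ?gt_eqF// expr1z; ring.
Qed.

Lemma classical_symbol_psym a j : smooth a ->
  classical_symbol (- n%:Z + 1) (psym a j).
Proof.
move=> [a1 a2].
have oO := @open_offzero R n.
have srho0 : rsmooth_on (@offzero R n) (fun z => rho0 j z.2).
  apply: rsmooth_mul => //.
    apply: (rsmooth_subset (E := setT)) => //.
    apply: (rsmooth_snd (f := fun xi : rV => xi 0 j)); exact: (rsmooth_coord _ openT).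
  have oE : open [set s : R | 0 < s] by exact: open_gt.
  have DE (z : V) : offzero z -> [set s : R | 0 < s] (dot z.2 z.2) by exact: dot_gt0.
  have sq : rsmooth_on (@offzero R n) (fun z => dot z.2 z.2).
    apply: (rsmooth_subset (E := setT)) => //.
    exact: (rsmooth_snd (rsmooth_sqnorm openT)).
  exact: (@rsmooth_comp _ _ _ coords_R _ _ (fun z : V => dot z.2 z.2)
    (fun s => s `^ p) oO oE DE (fun=> sq) (@rsmooth_powR R p)).
have sa (h : rV -> R) : rsmooth_on setT h -> rsmooth_on setT (fun z : V => h z.1).
  exact: rsmooth_fst.
have srho : rsmooth_on setT (fun z : V => rho j z.2).
  exact: (rsmooth_snd (rsmooth_rho j)).
have sna1 : rsmooth_on setT (fun x => - Re (a x)) by exact: (rsmooth_opp openT).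
rewrite (_ : psym a j = fun z => (Im (a z.1) * rho j z.2) +i* (- Re (a z.1) * rho j z.2)).
  apply: (@classical_symbol_homogeneous _ _ _ _ _
    (fun z => Im (a z.1) * rho0 j z.2) (fun z => - Re (a z.1) * rho0 j z.2)).
  - exact: (rsmooth_mul openT (sa _ a2) srho).
  - exact: (rsmooth_mul openT (sa _ sna1) srho).
  - exact: (rsmooth_mul oO (rsmooth_subset (@subsetT _ _) (sa _ a2)) srho0).
  - exact: (rsmooth_mul oO (rsmooth_subset (@subsetT _ _) (sa _ sna1)) srho0).
  - by move=> x xi t _ t0; rewrite /= homogeneous_rho0// mulrCA.
  - by move=> x xi t _ t0; rewrite /= homogeneous_rho0// mulrCA.
  - by move=> x xi h; rewrite /= /rho profile_eq.
  - by move=> x xi h; rewrite /= /rho profile_eq.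
by apply/funext => z; rewrite /psym; apply: eq_ReIm; rewrite !reimE /=; ring.
Qed.

Lemma quantization_psym a j u x : ctest u ->
  quantization (psym a j) u x =
  ((2 * pi) ^- n)%:C * (a x * (0 +i* -1)) *
  inv_fourier (fun xi => (rho j xi)%:C * fourier u xi) x.
Proof.
move=> tu; rewrite /quantization -mulrA; congr (_ * _).
rewrite /inv_fourier -cintZ; last first.
  apply: crapid_mul; first exact: cmoderate_expi.
  apply: crapid_mul; last exact: crapid_fourier.
  by apply: cmoderate_real; exact: moderate_rho.
apply: eq_cint => xi; rewrite /psym /=.
have -> : (0 +i* - rho j xi : R[i]) = (0 +i* -1) * (rho j xi)%:C.
  by apply: eq_ReIm; rewrite !reimE /=; ring.
ring.
Qed.

Lemma smooth_quantization_psym a j : smooth a ->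
  maps_test_to_smooth (quantization (psym a j)).
Proof.
move=> sa u /test_fun_ctest tu.
rewrite (_ : quantization _ _ = fun x => ((2 * pi) ^- n)%:C * (a x * (0 +i* -1)) *
  inv_fourier (fun xi => (rho j xi)%:C * fourier u xi) x); last first.
  by apply/funext => x; exact: quantization_psym.
apply: smooth_mul; last first.
  apply: smooth_inv_fourier; apply: crapid_mul; last exact: crapid_fourier.
  by apply: cmoderate_real; exact: moderate_rho.
apply: smooth_mul; first exact: smooth_cst.
by apply: smooth_mul => //; exact: smooth_cst.
Qed.

(** Summation over j assembles the derivatives of the rho_j into a divergence,
    which is smooth with compact support: the commutators of operators of order
    1 - n add up to a smoothing operator, with kernel of convolution type up to
    the factor a(x). *)
Lemma commutator_quantization a u x : ctest u ->
  \sum_j commutator (mul_coord j) (quantization (psym a j)) u x =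
  ((2 * pi) ^- n)%:C * a x *
  cint_rV (fun y => inv_fourier (fun xi => (divrho xi)%:C) (x - y) * u y).
Proof.
move=> tu; rewrite -inv_fourier_mul//; last exact: rapid_divrho.
have -> : inv_fourier (fun xi => (divrho xi)%:C * fourier u xi) x =
    \sum_j inv_fourier (fun xi => ('D_(delta_mx 0 j) (rho j) xi)%:C * fourier u xi) x.
  rewrite /inv_fourier -cint_sum => [|j]; last first.
    apply: crapid_mul; first exact: cmoderate_expi.
    apply: crapid_mul; last exact: crapid_fourier.
    by apply: cmoderate_real; exact: moderate_derive_rho.
  by apply: eq_cint => xi; rewrite /divrho rmorph_sum mulr_suml mulr_sumr.
rewrite mulr_sumr; apply: eq_bigr => j _.
rewrite commutator_multiplier// /commutator {1}/mul_coord.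
rewrite !quantization_psym//; last exact: ctest_coord.
move: (((2 * pi) ^- n)%:C) (inv_fourier _ x) (inv_fourier _ x) => b I1 I2.
by move: (a x) (_ +i* _) ((x 0 j)%:C) => *; ring.
Qed.

Lemma inv_fourier_at0 (r : rV -> R) :
  inv_fourier (fun xi => (r xi)%:C) 0 = (\int[mu]_t r (rowt t))%:C.
Proof.
have d0 xi : dot (0 : rV) xi = 0.
  by rewrite -(scale0r (0 : rV)) dotZl mul0r.
have -> : inv_fourier (fun xi => (r xi)%:C) 0 = cint_rV (fun xi => (r xi)%:C).
  by apply: eq_cint => xi; rewrite d0 expi0 mul1r.
by apply: eq_ReIm; rewrite /cint_rV /= int_rVE// Rintegral_cst// mul0r.
Qed.

Let linear_diff : linear (fun z : V => z.1 - z.2).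
Proof. by move=> h y z /=; rewrite scalerBr opprD addrACA. Qed.

Lemma smooth_comp_linear (W1 W2 : normedModType R) (L : {linear W1 -> W2})
    (F : W2 -> R[i]) : continuous L -> smooth F -> smooth (F \o L).
Proof.
move=> cL [F1 F2]; split.
  exact: (rsmooth_comp_linear cL F1).
exact: (rsmooth_comp_linear cL F2).
Qed.

Lemma smooth_diag k : smooth k -> smooth (fun x => k (x, x)).
Proof.
have lin : linear (fun x : rV => (x, x)) by [].
pose L : {linear rV -> V} := HB.pack (fun x : rV => (x, x)) (GRing.isLinear.Build _ _ _ _ _ lin).
apply: (@smooth_comp_linear _ _ L) => x; apply: differentiable_continuous.
exact: (@differentiable_pair _ _ _ _ id id).
Qed.

Lemma smooth_fst (F : rV -> R[i]) : smooth F -> smooth (fun z : V => F z.1).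
Proof.
by move=> [F1 F2]; split; [exact: (rsmooth_fst F1)|exact: (rsmooth_fst F2)].
Qed.

Lemma smooth_diff (F : rV -> R[i]) : smooth F -> smooth (fun z : V => F (z.1 - z.2)).
Proof.
pose L : {linear V -> rV} := HB.pack (fun z : V => z.1 - z.2)
  (GRing.isLinear.Build _ _ _ _ _ linear_diff).
apply: (@smooth_comp_linear _ _ L) => z.
by apply: (@continuousB _ _ _ fst snd z); [exact: cvg_fst|exact: cvg_snd].
Qed.

End operators.

Theorem lemma4p1 (R : realType) (n : nat) (hn : (0 < n)%N) (A : op R n)
    (hA : smoothing A) :
  exists P : 'I_n -> op R n,
    (forall j : 'I_n, classical_psido (- n%:Z + 1) (P j)) /\
    op_eq A (fun u x => \sum_(j < n) commutator (mul_coord j) (P j) u x).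
Proof.
have [_ [k [sk Ak]]] := hA.
pose I0 : R := Rintegral (lebesgue_tuple R n) setT (fun t => divrho (rowt t)).
have I00 : I0 != 0 by rewrite gt_eqF//; exact: integral_divrho_gt0.
have pi0 : (2 * pi) ^+ n != 0 :> R by rewrite expf_neq0// mulf_neq0// gt_eqF// pi_gt0.
pose psi := inv_fourier (fun xi : 'rV[R]_n => (divrho xi)%:C).
have spsi : smooth psi.
  apply: smooth_inv_fourier; split; first exact: rapid_divrho.
  apply: (@compact_rapid _ _ _ set0) => //; last exact: compact0.
  exact: continuous_cst.
(* With this normalization the commutators of the quantizations add up to the
   operator with kernel k0, and k0 = k on the diagonal since psi 0 = I0. *)
pose a (x : 'rV[R]_n) := ((2 * pi) ^+ n / I0)%:C * k (x, x).
have sa : smooth a by apply: smooth_mul; [exact: smooth_cst|exact: smooth_diag].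
pose k0 (z : 'rV[R]_n * 'rV[R]_n) := k (z.1, z.1) * ((I0^-1)%:C * psi (z.1 - z.2)).
have sk0 : smooth k0.
  apply: smooth_mul; first exact: (smooth_fst (smooth_diag sk)).
  by apply: smooth_mul; [exact: smooth_cst|exact: smooth_diff].
pose k1 z := k z + (-1) * k0 z.
have [k11 k12] : smooth k1.
  by apply: smooth_add => //; apply: smooth_mul => //; exact: smooth_cst.
have k1diag x : k1 (x, x) = 0.
  rewrite /k1 /k0 /= subrr /psi inv_fourier_at0 -/I0 -rmorphM/= mulVf// rmorph1.
  by rewrite mulr1 mulN1r subrr.
have [h1 [sh1 Hh1]] := hadamard k11 (fun x => congr1 (@complex.Re R) (k1diag x)).
have [h2 [sh2 Hh2]] := hadamard k12 (fun x => congr1 (@complex.Im R) (k1diag x)).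
pose h j z : R[i] := h1 j z +i* h2 j z.
have sh j : smooth (h j) by split; [exact: sh1|exact: sh2].
have k1E x y : k1 (x, y) = \sum_j (x 0 j - y 0 j)%:C * h j (x, y).
  apply: eq_ReIm.
    rewrite Hh1 (big_morph (@complex.Re R) (@cReD R) (erefl : complex.Re 0 = 0)).
    by apply: eq_bigr => j _; rewrite !reimE /= mul0r subr0.
  rewrite Hh2 (big_morph (@complex.Im R) (@cImD R) (erefl : complex.Im 0 = 0)).
  by apply: eq_bigr => j _; rewrite !reimE /= mul0r addr0.
(* The remaining kernel k1 vanishes on the diagonal, and (x_j - y_j) h_j is the
   kernel of a commutator with the operator of kernel h_j. *)
exists (fun j => op_add (quantization (psym a j)) (kernel_op (h j))); split.
  move=> j; have smk := smoothing_kernel_op (sh j); split; last first.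
    exists (psym a j), (kernel_op (h j)); split=> //.
    exact: classical_symbol_psym.
  move=> u tu; apply: smooth_add; first exact: smooth_quantization_psym.
  by case: smk => + _; apply.
move=> u tu x; rewrite Ak//; have ctu := test_fun_ctest tu.
rewrite (eq_bigr (fun j => commutator (mul_coord j) (quantization (psym a j)) u x +
    commutator (mul_coord j) (kernel_op (h j)) u x)); last first.
  by move=> j _; rewrite /commutator /op_add {1}/mul_coord mulrDr opprD addrACA.
rewrite big_split/= commutator_quantization// -/psi.
rewrite (eq_bigr (fun j =>
    cint_rV (fun y => (x 0 j - y 0 j)%:C * h j (x, y) * u y))); last first.
  by move=> j _; exact: commutator_kernel_op.
have rh j : crapid (fun y => (x 0 j - y 0 j)%:C * h j (x, y) * u y).
  rewrite (_ : (fun y => _) = fun y : 'rV[R]_n => (x 0 j - y 0 j)%:C * (h j (x, y) * u y)).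
    apply: crapid_mul; last exact: crapid_kernel.
    apply: cmoderate_real.
    rewrite (_ : (fun y => _) = fun y : 'rV[R]_n => x 0 j + -1 * y 0 j).
      apply: moderate_add; first exact: moderate_cst.
      by apply: moderate_mul; [exact: moderate_cst|exact: moderate_coord].
    by apply/funext => y; rewrite mulN1r.
  by apply/funext => y; rewrite mulrA.
have rpsi : crapid (fun y => psi (x - y) * u y).
  exact: (crapid_kernel x (smooth_diff spsi) ctu).
rewrite -cint_sum// -cintZ// -cintD; last first.
- rewrite (_ : (fun y => _) = fun y => k1 (x, y) * u y).
    exact: crapid_kernel.
  by apply/funext => y; rewrite k1E mulr_suml.
- by apply: crapid_mul => //; exact: cmoderate_cst.
apply: eq_cint => y; rewrite -mulr_suml -k1E /k1 /k0 /a /=.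
have -> : (((2 * pi) ^+ n)^-1)%:C * (((2 * pi) ^+ n / I0)%:C * k (x, x)) =
    (I0^-1)%:C * k (x, x) :> R[i].
  by rewrite mulrA -rmorphM/= mulrA mulVf// mul1r.
ring.
Qed.
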